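(* Let $H$ be a graph which is not a forest and let $q$ be a positive integer. Suppose that either $q\geq 2$, or there exists a subgraph $H'\subseteq H$ such that $d_2(H')=m_2(H)$, $H'$ is strictly 2-balanced and $H'$ is not a triangle. Then there exist constants $c,C>0$, depending only on $H$ and $q$, such that for $p=p(n)$, in the Client-Waiter game $CW(G_{n,p},H,q)$, $$\lim_{n\to\infty} \Pr[\text{Client wins } CW(G_{n,p},H,q)]=\begin{cases} 1, & \text{if } p\geq Cn^{-1/m_2(H)}, \\ 0, & \text{if } p\leq cn^{-1/m_2(H)}. \end{cases}$$
   Context: Client-Waiter game on a board $X$ with bias $q$ (a positive integer): two players, Client and Waiter, play in turns. In each turn Waiter offers Client a set of at least $1$ and at most $q+1$ unclaimed elements of $X$; Client claims exactly one of the offered elements and Waiter claims all the other offered elements. The game ends when all elements of $X$ have been claimed. For graphs $G,H$, $CW(G,H,q)$ is the Client-Waiter game on the board $E(G)$ with bias $q$ in which Client wins if at the end of the game the graph formed by the edges he claimed contains a copy of $H$ (as a not necessarily induced subgraph), and otherwise Waiter wins. ''Client wins'' means Client has a winning strategy. $G_{n,p}$ is the random graph on $n$ vertices in which each edge of $K_n$ is included independently with probability $p=p(n)$. For a graph $G$ with $v_G$ vertices and $e_G$ edges, the 2-density is $d_2(G)=\frac{e_G-1}{v_G-2}$ if $v_G\ge 3$ and $d_2(G)=0$ if $v_G\leq 2$; the maximum 2-density is $m_2(G)=\max_{G'\subseteq G} d_2(G')$. A graph $G$ is strictly 2-balanced if $d_2(G')<m_2(G)$ for every proper subgraph $G'\subset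 G$ (so $d_2(G)=m_2(G)$). *)

(* Defs.v *)
From HB Require Import structures.
From mathcomp Require Import all_boot all_order all_algebra.
From mathcomp Require Import boolp reals.

Set Implicit Arguments.
Unset Strict Implicit.
Unset Printing Implicit Defensive.

Import Order.TTheory GRing.Theory Num.Theory.
Local Open Scope ring_scope.

(* Finite simple graphs with vertices in an ambient finite type.  The vertex  *)
(* set is part of the data, so that graphs on T include all subgraphs of a    *)
(* graph on T; an edge is a 2-element set of vertices.                        *)

Definition wf_graph (T : finType) (G : {set T} * {set {set T}}) : bool :=
  [forall e in G.2, (#|e| == 2) && (e \subset G.1)].

Record graph (T : finType) := Graph {
  graph_val : {set T} * {set {set T}};
  graph_wf : wf_graph graph_val
}.

HB.instance Definition _ (T : finType) := [isSub for @graph_val T].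
HB.instance Definition _ (T : finType) := [Equality of graph T by <:].
HB.instance Definition _ (T : finType) := [Choice of graph T by <:].
HB.instance Definition _ (T : finType) := [Countable of graph T by <:].
HB.instance Definition _ (T : finType) := [Finite of graph T by <:].

Definition vset (T : finType) (G : graph T) : {set T} := (graph_val G).1.
Definition eset (T : finType) (G : graph T) : {set {set T}} := (graph_val G).2.

Definition adj (T : finType) (G : graph T) : rel T :=
  fun x y => [set x; y] \in eset G.

Definition subgraph (T : finType) (G' G : graph T) : bool :=
  (vset G' \subset vset G) && (eset G' \subset eset G).

Definition proper_subgraph (T : finType) (G' G : graph T) : bool :=
  subgraph G' G && (G' != G).

(* Every ucycle of length at most 2 is degenerate (an edge traversed back and *)
(* forth); those of length at least 3 are the graph-theoretic cycles.         *)
Definition forest (T : finType) (G : graph T) : Prop :=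
  forall s : seq T, ucycle (adj G) s -> (size s <= 2)%N.

Definition triangle (T : finType) (G : graph T) : Prop :=
  exists x y z : T,
    [/\ uniq [:: x; y; z],
        vset G = [set x; y; z] &
        eset G = [set [set x; y]; [set y; z]; [set x; z]]].

Definition contains_copy (T U : finType) (G : graph U) (H : graph T) : Prop :=
  exists f : T -> U,
    [/\ {in vset H &, injective f},
        f @: vset H \subset vset G &
        forall e : {set T}, e \in eset H -> f @: e \in eset G].

Lemma edge_restrict_wf (T : finType) (G : graph T) (F : {set {set T}}) :
  wf_graph (vset G, eset G :&: F).
Proof.
apply/forallP => e; apply/implyP; rewrite inE => /andP[eG _].
exact: (implyP (forallP (graph_wf G) e)).
Qed.

Definition edge_restrict (T : finType) (G : graph T) (F : {set {set T}}) :
  graph T := Graph (edge_restrict_wf G F).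

Definition d2 (T : finType) (G : graph T) : rat :=
  if (3 <= #|vset G|)%N then (#|eset G|%:R - 1) / (#|vset G|%:R - 2) else 0.

(* The default value 0 of the maximum is harmless: it is attained by the      *)
(* subgraphs with at most 2 vertices.                                         *)
Definition m2 (T : finType) (G : graph T) : rat :=
  \big[Num.max/0]_(G' : graph T | subgraph G' G) d2 G'.

Definition strictly_2_balanced (T : finType) (G : graph T) : Prop :=
  forall G' : graph T, proper_subgraph G' G -> d2 G' < m2 G.

(* Client-Waiter games.  A complete line of play of Waiter is the sequence of *)
(* his offers: all elements of an offer get claimed in that turn, hence the   *)
(* unclaimed elements are those of X outside the previous offers, and play    *)
(* stops exactly when nothing is left.                                        *)

Fixpoint legal_offers (E : finType) (q : nat) (X : {set E})
    (os : seq {set E}) : bool :=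
  if os is Q :: os' then
    [&& Q \subset X, (1 <= #|Q| <= q.+1)%N & legal_offers q (X :\: Q) os']
  else X == set0.

(* A strategy maps the past offers and the current offer to Client's pick;    *)
(* his own past picks need not be recorded, as the strategy determines them.  *)
(* (E is nonempty in all uses below; otherwise there would be no strategy.)   *)
Definition client_strategy (E : finType) := seq {set E} -> {set E} -> E.

Fixpoint picks (E : finType) (sigma : client_strategy E)
    (past os : seq {set E}) : seq E :=
  if os is Q :: os' then sigma past Q :: picks sigma (rcons past Q) os'
  else [::].

Definition client_wins (E : finType) (q : nat) (X : {set E})
    (win : {set E} -> Prop) : Prop :=
  exists sigma : client_strategy E,
    forall os : seq {set E}, legal_offers q X os ->
      all2 (fun (e : E) (Q : {set E}) => e \in Q) (picks sigma [::] os) os /\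
      win [set e in picks sigma [::] os].

Definition client_wins_CW (T U : finType) (G : graph U) (H : graph T)
    (q : nat) : Prop :=
  client_wins q (eset G) (fun F => contains_copy (edge_restrict G F) H).

(* The binomial random graph on the vertex set 'I_n: the probability of an    *)
(* event A is the sum of the weights of the graphs in A with vertex set 'I_n. *)

Definition Gnp_weight (R : realType) (n : nat) (p : R) (G : graph 'I_n) : R :=
  \prod_(e : {set 'I_n} | #|e| == 2) (if e \in eset G then p else 1 - p).

Definition Gnp_prob (R : realType) (n : nat) (p : R)
    (A : graph 'I_n -> Prop) : R :=
  \sum_(G : graph 'I_n | (vset G == [set: 'I_n]) && `[< A G >])
     Gnp_weight p G.

(* Main.v *)
(* Let m = m_2(H) and t = n^(-1/m).

   Client, p = C t.  Against an offer Q, Client claims the edge that maximizes a potential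
   in which an alive copy with k edges already claimed has weight (q+1)^k.  Averaging over Q
   shows that the potential drops only because of copies meeting Q in two or more edges.
   So he wins as soon as some subgraph of the board has many copies of H compared with its
   edges and its pairs of copies sharing two edges.  Second moments give the copies; a deletion argument
   (Markov's inequality for tuples of disjoint bad pairs) makes the bad pairs few with
   probability arbitrarily close to 1.

   Waiter, p = c t.  Let H' be strictly 2-balanced with d_2(H') = m = a/b.  The board splits
   into atoms, the minimal sets closed under copies of H'.  Exploring an atom copy by copy, a
   weight of the explored part is a supermartingale, whence whp every atom U satisfies
   b |U| <= a |cover U|; as H' is strictly 2-balanced, the same holds for all nonempty
   subsets of U.  On such sets Waiter wins: when H' is not a triangle, by offering pairs so that
   Client's share obeys an intersecting submodular bound that no copy of H' obeys; when it is
   a triangle and q >= 2, by an induction over vertices of degree at most 4. *)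

Require Import Defs.
From mathcomp Require Import all_boot all_order all_algebra.
From mathcomp Require Import zify ring lra boolp reals.

Set Implicit Arguments.
Unset Strict Implicit.
Unset Printing Implicit Defensive.
Import Order.TTheory GRing.Theory Num.Theory.

(** At the threshold an edge lies in a constant expected number of copies, so no first moment of
    copies tends to 0; the limits need a gain from elsewhere. For Waiter the gain is integrality: an
    overdense [U] has [b * #|U| - a * #|cover U|] at least 1, which is worth a factor t^(1/b). Atoms
    have no size bound given in advance, so the union bound runs over histories of an exploration.
    Attachments in a single edge behave like a branching process that is subcritical for small c.
    All other attachments are polynomially many in the explored size, but boundedly many of them
    already make the explored part overdense. For Client the pairs of copies sharing two edges are
    rarer than the critical scale only by the constant factor C; a plain Markov bound would leave a
    fixed failure probability. The property of boards that is shown to be likely is closed upwards,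
    so only p = C t needs moments. *)

(** * Waiter's side *)

(* [Y] is the unclaimed part of the board, [C] the elements claimed by Client. *)
Inductive waiter_forces (E : finType) (q : nat) (Post : {set E} -> Prop) :
    {set E} -> {set E} -> Prop :=
  | WF_done (C : {set E}) : Post C -> waiter_forces q Post set0 C
  | WF_offer (Y C Q : {set E}) : Q \subset Y -> 0 < #|Q| <= q.+1 ->
      (forall e, e \in Q -> waiter_forces q Post (Y :\: Q) (e |: C)) ->
      waiter_forces q Post Y C.

Lemma waiter_forces_not_client_wins (E : finType) q (X : {set E})
    (win : {set E} -> Prop) :
  waiter_forces q (fun C => ~ win C) X set0 -> ~ client_wins q X win.
Proof.
move=> wf [sigma Hs].
suff [os los Hos] : exists2 os, legal_offers q X os &
    all2 (fun (e : E) (Q : {set E}) => e \in Q) (picks sigma [::] os) os ->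
    ~ win (set0 :|: [set e in picks sigma [::] os]).
  by have [H1 H2] := Hs os los; apply: (Hos H1); rewrite set0U.
elim: wf [::] {Hs} => {X} [C nC|X C Q QX Qq _ IH] past.
  exists [::] => /= [|_]; first exact: eqxx.
  have -> : [set e in (Nil E)] = set0 by apply/setP => x; rewrite !inE.
  by rewrite setU0.
case: (boolP (sigma past Q \in Q)) => [pQ|npQ].
  have [os los Hos] := IH _ pQ (rcons past Q).
  exists (Q :: os) => /=; first by rewrite QX Qq los.
  move=> /andP[_ Ha]; move: (Hos Ha); congr (~ win _).
  by apply/setP => x; rewrite !inE orbCA orbA.
(* An illegal pick makes the [all2] premise false, so the play may continue with any [e] of the
   offer. *)
have [e eQ] : exists e, e \in Q by apply/card_gt0P; case/andP: Qq.
have [os los Hos] := IH _ eQ (rcons past Q).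
exists (Q :: os) => /=; first by rewrite QX Qq los.
by rewrite (negPf npQ).
Qed.

(** The strategy on [Y2] is chosen after [Y1] is exhausted and may depend on what Client took there;
    plays in several phases rest on this. *)
Lemma waiter_forces_cat (E : finType) q (Post : {set E} -> Prop)
    (Y1 Y2 C : {set E}) : [disjoint Y1 & Y2] ->
  waiter_forces q (waiter_forces q Post Y2) Y1 C ->
  waiter_forces q Post (Y1 :|: Y2) C.
Proof.
move=> + wf; elim: wf => {Y1 C} [C wC _|Y C Q QY Qq _ IH dY]; first by rewrite set0U.
apply: (WF_offer (Q := Q)) => //; first exact: subset_trans QY (subsetUl _ _).
move=> e eQ.
have -> : (Y :|: Y2) :\: Q = (Y :\: Q) :|: Y2.
  apply/setP => x; rewrite !inE; case: (boolP (x \in Q)) => //= xQ.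
  by rewrite (disjointFr dY (subsetP QY _ xQ)).
apply: IH => //; apply: disjointWl dY; exact: subsetDl.
Qed.

Lemma waiter_forces_imp (E : finType) q (P1 P2 : {set E} -> Prop) (Y C : {set E}) :
  (forall C' : {set E}, C \subset C' -> C' \subset C :|: Y -> P1 C' -> P2 C') ->
  waiter_forces q P1 Y C -> waiter_forces q P2 Y C.
Proof.
move=> + wf; elim: wf => {Y C} [C pC|Y C Q QY Qq _ IH] H.
  by apply: WF_done; apply: H => //; rewrite setU0.
apply: (WF_offer (Q := Q)) => // e eQ; apply: IH => // C' s1 s2; apply: H.
  by apply: subset_trans s1; rewrite subsetUr.
apply: subset_trans s2 _; apply/subsetP => x; rewrite !inE.
case/orP=> [/orP[/eqP->|->//]|/andP[_ ->]]; last by rewrite orbT.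
by rewrite (subsetP QY _ eQ) orbT.
Qed.

(** A bias only caps the size of offers; strategies offering pairs thus serve every positive
    bias. *)
Lemma waiter_forces_bias (E : finType) q q' (P : {set E} -> Prop) (Y C : {set E}) :
  q <= q' -> waiter_forces q P Y C -> waiter_forces q' P Y C.
Proof.
move=> qq; elim=> {Y C} [C pC|Y C Q QY /andP[Q0 Qq] _ IH]; first exact: WF_done.
apply: (WF_offer (Q := Q)) => //; rewrite Q0 /=; exact: leq_trans Qq _.
Qed.

Lemma waiter_forces_any (E : finType) q (P : {set E} -> Prop) (Y C : {set E}) :
  (forall C' : {set E}, C \subset C' -> C' \subset C :|: Y -> P C') ->
  waiter_forces q P Y C.
Proof.
move Ek : #|Y| => k; elim: k Y C Ek => [|k IH] Y C Ek H.
  move: Ek => /eqP; rewrite cards_eq0 => /eqP Y0.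
  by rewrite Y0; apply: WF_done; apply: H => //; rewrite Y0 setU0.
have [e eY] : exists e, e \in Y by apply/card_gt0P; rewrite Ek.
apply: (WF_offer (Q := [set e])); rewrite ?sub1set ?cards1 //.
move=> x /set1P->{x}; apply: IH.
  by move: Ek; rewrite (cardsD1 e) eY => -[].
move=> C' s1 s2; apply: H; first by apply: subset_trans s1; rewrite subsetUr.
apply: subset_trans s2 _; apply/subsetP => x; rewrite !inE.
by case/orP=> [/orP[/eqP->|->//]|/andP[_ ->]]; rewrite ?eY orbT.
Qed.

(** * Pairing below an intersecting submodular function *)

(* The offered pair lies in a minimal tight set meeting [Y]; by submodularity no tight set separates it. *)
Section Pairing.
Variables (E : finType) (g : {set E} -> nat) (U : {set E}).
Hypothesis gsub : forall X1 X2 : {set E}, X1 \subset U -> X2 \subset U ->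
  X1 :&: X2 != set0 ->
  g (X1 :|: X2) + g (X1 :&: X2) <= g X1 + g X2.

(** A claimed element counts 2 and an unclaimed one 1, as if Client were to get half of what is
    left. A pair inside [X] keeps the sum constant; a pair with one element in [X] raises it by at
    most 1. *)
Let load (C Y X : {set E}) := 2 * #|X :&: C| + #|X :&: Y|.
Let inv (C Y : {set E}) := forall X : {set E}, X != set0 -> X \subset U ->
  load C Y X <= 2 * g X.

Lemma load_modular C Y (X1 X2 : {set E}) :
  load C Y (X1 :|: X2) + load C Y (X1 :&: X2) = load C Y X1 + load C Y X2.
Proof.
have H (Z : {set E}) : #|(X1 :|: X2) :&: Z| + #|(X1 :&: X2) :&: Z| = #|X1 :&: Z| + #|X2 :&: Z|.
  rewrite -[RHS]cardsUI; congr (_ + _); apply: eq_card => x; rewrite !inE.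
    by case: (x \in X1); case: (x \in X2); case: (x \in Z).
  by case: (x \in X1); case: (x \in X2); case: (x \in Z).
rewrite /load; have := H C; have := H Y; lia.
Qed.

Lemma pairing_forces (C Y : {set E}) : Y \subset U -> [disjoint C & Y] ->
  inv C Y ->
  waiter_forces 1 (fun C' => forall X : {set E}, X != set0 -> X \subset U ->
    #|X :&: C'| <= g X) Y C.
Proof.
move Ek : #|Y| => k; elim/ltn_ind: k Y C Ek => k IH Y C Ek YU dCY HI.
have [Y0|Yn0] := eqVneq Y set0.
  rewrite Y0; apply: WF_done => X X0 XU; have := HI X X0 XU.
  by rewrite /load Y0 setI0 cards0; clear; lia.
pose tight (X : {set E}) := [&& X != set0, X \subset U, X :&: Y != set0 & load C Y X == 2 * g X].
have [e [f [eY fY sep]]] : exists e f, [/\ e \in Y, f \in Y &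
    (e != f) && [forall X : {set E}, tight X ==> ((e \in X) == (f \in X))]
    || (e == f) && [forall X : {set E}, ~~ tight X]].
  have [/existsP[X0 tX0]|/existsPn nt] := boolP [exists X, tight X].
    have [X /minsetP[tX minX] _] := minset_exists (P := tight) (C := X0) tX0.
    have /and4P[Xn0 XU XY0 /eqP tl] := tX.
    have /set0Pn[e eXY] := XY0.
    (* The load equals the even number [2 * g X], so [#|X :&: Y|] is even; being positive, it is at
       least 2. *)
    have : 1 < #|X :&: Y| by move: tl (XY0); rewrite -cards_eq0 /load; clear; lia.
    rewrite (cardsD1 e) eXY => /card_gt0P[f]; rewrite !inE in eXY * => /and3P[fe fX fY].
    have /andP[eX eY] := eXY.
    exists e, f; split=> //; rewrite eq_sym fe /=; apply/orP; left.
    (* Uncrossing: loads are modular, [g] is submodular, and the invariant holds for [X :&: X'] and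
       [X :|: X'], so both attain the bound; minimality of [X] gives [X \subset X']. *)
    have key (X' : {set E}) z : tight X' -> z \in X' -> z \in X -> z \in Y -> X \subset X'.
      move=> /and4P[X'n0 X'U X'Y0 /eqP tl'] zX' zX zY.
      have zI : z \in X :&: X' by rewrite inE zX.
      have In0 : X :&: X' != set0 by apply/set0Pn; exists z.
      rewrite -[X](minX (X :&: X')) ?subsetIr ?subsetIl //.
      apply/and4P; split=> //; first by rewrite subIset ?XU.
        by apply/set0Pn; exists z; rewrite !inE zX zX'.
      have := load_modular C Y X X'; have := gsub XU X'U In0.
      have := HI _ In0 _; rewrite subIset ?XU // => /(_ isT).
      have Un0 : X :|: X' != set0 by apply/set0Pn; exists z; rewrite inE zX.
      have := HI _ Un0; rewrite subUset XU X'U => /(_ isT).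
      by rewrite tl tl'; clear; lia.
    apply/forallP => X'; apply/implyP => tX'; apply/eqP; apply/idP/idP => H.
      exact: (subsetP (key X' e tX' H eX eY)).
    exact: (subsetP (key X' f tX' H fX fY)).
  (* Without tight sets any two elements do; a last single element is offered alone, encoded as
     [e = f]. *)
  have /set0Pn[e eY] := Yn0.
  have [Y1|] := eqVneq (Y :\ e) set0.
    by exists e, e; split=> //; rewrite eqxx /=; apply/forallP.
  case/set0Pn=> f; rewrite !inE => /andP[fe fY].
  exists e, f; split=> //; rewrite eq_sym fe /=; apply/orP; left.
  by apply/forallP => X; apply/implyP => tX; case/negP: (nt X).
(* The load of [X] loses [#|X :&: Q|] and gains [2 * (x \in X)]; the premise says that the slack of
   [X] covers the change. *)
have fin (Q : {set E}) x : Q \subset Y -> x \in Q ->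
    (forall X : {set E}, X != set0 -> X \subset U -> 2 * (x \in X) <= #|X :&: Q| + (2 * g X - load C Y X)) ->
    waiter_forces 1 (fun C' => forall X : {set E}, X != set0 -> X \subset U ->
    #|X :&: C'| <= g X) (Y :\: Q) (x |: C).
  move=> QY xQ H.
  have xY := subsetP QY _ xQ.
  apply: (IH #|Y :\: Q|) => //.
  - rewrite -Ek; apply: proper_card; apply/properP; split; first exact: subsetDl.
    by exists x => //; rewrite inE xQ.
  - by apply: subset_trans YU; exact: subsetDl.
  - rewrite -setI_eq0; apply/eqP/setP => z; rewrite !inE.
    case: (eqVneq z x) => [->|_] /=; first by rewrite xQ.
    by apply/negP => /and3P[zC _ zY]; rewrite (disjointFr dCY zC) in zY.
  move=> X X0 XU; have := HI X X0 XU; have := H X X0 XU; rewrite /load.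
  have -> : #|X :&: (x |: C)| = (x \in X) + #|X :&: C|.
    rewrite (cardsD1 x) !inE eqxx /= andbT; congr (_ + _).
    apply: eq_card => z; rewrite !inE; case: eqP => //= ->.
    by rewrite (disjointFl dCY xY) andbF.
  have -> : #|X :&: Y| = #|X :&: Q| + #|X :&: (Y :\: Q)|.
    rewrite -(cardsID Q (X :&: Y)); congr (_ + _).
      apply: eq_card => z; rewrite !inE -andbA; case: (boolP (z \in Q)) => [/(subsetP QY)->|_]; by rewrite ?andbT ?andbF.
    by apply: eq_card => z; rewrite !inE andbCA.
  by clear; lia.
case/orP: sep => [/andP[ef /forallP sep]|/andP[/eqP ef /forallP nt]].
  have nsep (X : {set E}) : X != set0 -> X \subset U -> (e \in X) != (f \in X) -> load C Y X < 2 * g X.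
    move=> X0 XU sX; rewrite ltn_neqAle HI // andbT; apply/negP => lX.
    have XY0 : X :&: Y != set0.
      apply/set0Pn; case: (boolP (e \in X)) sX => [eX _|_ fX].
        by exists e; rewrite inE eX.
      by exists f; rewrite inE fY andbT; move: fX; case: (f \in X).
    by case/negP: sX; apply: (implyP (sep X)); rewrite /tight X0 XU lX XY0.
  apply: (WF_offer (Q := [set e; f])); rewrite ?subUset ?sub1set ?eY ?fY //; first by rewrite cards2 ef.
  move=> x xQ; apply: fin => //; first by rewrite subUset !sub1set eY.
  move=> X X0 XU.
  have cQ : #|X :&: [set e; f]| = (e \in X) + (f \in X).
    rewrite setIC (cardsD1 e) !inE eqxx /=; congr (_ + _).
    rewrite (cardsD1 f) !inE eqxx orbT eq_sym ef /=; rewrite (_ : _ :\ f = set0) ?cards0 ?addn0 //.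
    by apply/setP => z; rewrite !inE; case: (z == e); case: (z == f); rewrite ?andbF.
  have := nsep X X0 XU; rewrite cQ; have := HI X X0 XU.
  by move: xQ; rewrite !inE => /orP[]/eqP->; case: (e \in X); case: (f \in X) => /=; clear; lia.
apply: (WF_offer (Q := [set e])); rewrite ?sub1set ?cards1 //.
move=> x /set1P->; apply: fin; rewrite ?sub1set ?set11 //.
move=> X X0 XU; case: (boolP (e \in X)) => // eX.
have -> : #|X :&: [set e]| = 1.
  by rewrite (_ : X :&: _ = [set e]) ?cards1 //; apply/setP => z; rewrite !inE; case: eqP => [->|]; rewrite ?eX ?andbF.
have := nt X; rewrite /tight X0 XU /= (_ : X :&: Y != set0) /=.
  by have := HI X X0 XU; clear; lia.
by apply/set0Pn; exists e; rewrite inE eX.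
Qed.
End Pairing.

(** * Atoms of a board *)

Section Atoms.
Variables (E : finType) (copy : pred {set E}) (X : {set E}).

(** In the hypergraph of the copies inside [X] these are the unions of connected components; a
    [copy_atom] is the component of a copy. *)
Definition copy_closed (F : {set E}) : Prop :=
  forall A : {set E}, copy A -> A \subset X -> A :&: F != set0 -> A \subset F.

Lemma copy_closedD (F1 F2 : {set E}) :
  copy_closed F1 -> copy_closed F2 -> copy_closed (F1 :\: F2).
Proof.
move=> c1 c2 A cA AX /set0Pn[x]; rewrite !inE => /and3P[xA xF2 xF1].
have AF1 : A \subset F1 by apply: c1 => //; apply/set0Pn; exists x; rewrite inE xA.
apply/subsetP => y yA; rewrite inE (subsetP AF1 _ yA) andbT.
apply: contra xF2 => yF2.
have : A \subset F2 by apply: c2 => //; apply/set0Pn; exists y; rewrite inE yA.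
by move/subsetP; apply.
Qed.

Definition copy_atom (A U : {set E}) : Prop :=
  [/\ A \subset U, U \subset X, copy_closed U &
      forall F : {set E}, copy_closed F -> A \subset F -> U \subset F].

(** No copy meets both an atom and its complement, and the complement is closed again; so the atoms
    can be played one after another. *)
Lemma atoms_forces q (C : {set E}) :
  (forall A : {set E}, copy A -> A != set0) ->
  (forall A : {set E}, copy A -> A \subset X -> exists U, copy_atom A U /\
     forall C : {set E}, [disjoint C & U] ->
     waiter_forces q (fun C' => forall B : {set E}, copy B -> B \subset U -> ~~ (B \subset C')) U C) ->
  [disjoint C & X] ->
  waiter_forces q (fun C' => forall B : {set E}, copy B -> B \subset X -> ~~ (B \subset C')) X C.
Proof.
move=> copy0 HA dCX.
suff H F : copy_closed F -> F \subset X -> forall C : {set E}, [disjoint C & F] ->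
    waiter_forces q (fun C' => forall B : {set E}, copy B -> B \subset F -> ~~ (B \subset C')) F C.
  exact: H.
clear C dCX; move Ek : #|F| => k; elim/ltn_ind: k F Ek => k IH F Ek cF FX C dCF.
have [/existsP[A /andP[cA AF]]|/existsPn nA] := boolP [exists A : {set E}, copy A && (A \subset F)]; last first.
  apply: waiter_forces_any => C' _ _ B cB BF; have := nA B; by rewrite cB BF.
have [U [[AU UX cU minU] HU]] := HA A cA (subset_trans AF FX).
have UF : U \subset F by exact: minU.
have -> : F = U :|: (F :\: U) by rewrite setDE setUIr setUCr setIT; apply/esym/setUidPr.
have dU : [disjoint U & F :\: U].
  by rewrite -setI_eq0; apply/eqP/setP => z; rewrite !inE; case: (z \in U).
apply: waiter_forces_cat => //.
apply: waiter_forces_imp (HU C (disjointWr UF dCF)) => C1 s1 s2 H1.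
have dC1 : [disjoint C1 & F :\: U].
  rewrite disjoint_subset; apply/subsetP => z /(subsetP s2); rewrite !inE.
  by case/orP=> [/(disjointFr dCF)->|->]; rewrite ?andbF.
apply: waiter_forces_imp (IH _ _ (F :\: U) erefl _ _ C1 _) => //; first last.
- by apply: subset_trans FX; exact: subsetDl.
- exact: copy_closedD.
- rewrite -Ek; apply: proper_card; apply/properP; split; first exact: subsetDl.
  have /set0Pn[x xA] := copy0 _ cA.
  by exists x; [exact: (subsetP AF)|rewrite inE (subsetP AU _ xA)].
move=> C2 s3 s4 H2 B cB BF.
have [BU0|BU] := eqVneq (B :&: U) set0.
  apply: H2 => //; apply/subsetP => z zB.
  have zU : z \in U = false by move/setP: BU0 => /(_ z); rewrite !inE zB.
  by move: (subsetP BF _ zB); rewrite !inE zU.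
have BsU : B \subset U by apply: cU => //; apply: subset_trans BF _; rewrite subUset UX (subset_trans (subsetDl _ _) FX).
apply: contra (H1 B cB BsU) => BC2; apply/subsetP => z zB.
have := subsetP s4 _ (subsetP BC2 _ zB); rewrite !inE (subsetP BsU _ zB) /=.
by rewrite orbF.
Qed.

(** By the first hypothesis, attaching a copy never lowers [b * #|Z| - a * s Z]. Attaching copies to
    [Z] inside [U] as long as possible ends in a closed set, which must be [U], where the difference
    is at most 0. *)
Lemma atom_sparse (s : {set E} -> nat) (a b : nat) (A U : {set E}) :
  (forall B Z : {set E}, copy B -> B :&: Z != set0 ->
     b * #|Z| + a * s (B :|: Z) <= b * #|B :|: Z| + a * s Z) ->
  copy_atom A U -> A \subset X -> copy A -> b * #|U| <= a * s U ->
  forall Z : {set E}, Z != set0 -> Z \subset U -> b * #|Z| <= a * s Z.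
Proof.
move=> grow [AU UX cU minU] AX cA spU Z Z0 ZU.
pose P (F : {set E}) := [&& Z \subset F, F \subset U & b * #|Z| + a * s F <= b * #|F| + a * s Z].
have PZ : P Z by rewrite /P subxx ZU leqnn.
have [F /maxsetP[/and3P[ZF FU leF] maxF] _] := maxset_exists (P := P) PZ.
have cF : copy_closed F.
  move=> B cB BX BF.
  have BU : B \subset U.
    apply: cU => //; apply: contraNneq BF => BU0; rewrite -subset0 -BU0.
    exact: setIS.
  rewrite -[F](maxF (B :|: F)) ?subsetUl ?subsetUr // /P.
  rewrite (subset_trans ZF (subsetUr _ _)) subUset BU FU /=.
  have := grow B F cB BF; move: leF; clear; lia.
suff UF : U \subset F.
  have EF : F = U by apply/eqP; rewrite eqEsubset FU UF.
  by move: leF spU; rewrite EF; clear; lia.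
have [AF0|AF] := eqVneq (A :&: F) set0; last by apply: minU => //; exact: cF.
(* If [F] missed [A], the closed set [U :\: F] would contain [A] and hence [U], although [F]
   contains the nonempty [Z]. *)
have : U \subset U :\: F.
  apply: minU; first exact: copy_closedD.
  apply/subsetP => z zA; rewrite inE (subsetP AU _ zA) andbT.
  by move/setP: AF0 => /(_ z); rewrite !inE zA /= => ->.
have /set0Pn[z zZ] := Z0.
by move/subsetP/(_ z (subsetP ZU _ zZ)); rewrite inE (subsetP ZF _ zZ).
Qed.
End Atoms.

(** Client's share of a set on [s] vertices is to be at most [k * (s - 2) + l]. A copy, with [b.+2]
    vertices and [a.+1] edges, must exceed this; twice the bound must dominate every sparse set. For
    the triangle no [k] and [l] exist: a single edge ([s = 2], [x = 1]) and a complete graph on five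
    vertices ([s = 5], [x = 10]) cannot both be dominated. *)
Lemma sparsity_parameters (a b : nat) : b < a -> 0 < b -> ~~ ((b == 1) && (a == 2)) ->
  exists k l, k * b + l < a.+1 /\
    forall s x, 2 <= s -> b * x <= a * s -> 2 * x <= s * s.-1 -> x <= 2 * (k * (s - 2) + l).
Proof.
move=> ba b0 nt.
have [H1|H1] := leqP (2 * a) (3 * b).
  (* From four vertices on, 3/2 edges per vertex are at most [2 * (s - 1)]; for fewer vertices the
     number of pairs decides. *)
  exists 1, 1; split; first by rewrite mul1n addn1.
  move=> s x s2 H2 H3.
  have H4 : 2 * x <= 3 * s by nia.
  have [s4|s4] := leqP 4 s; first by lia.
  have : s = 2 \/ s = 3 by lia.
  by case=> ?; subst s; lia.
have [H2|H2] := leqP a (2 * b).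
  (* The first inequality could fail only for [a = b + 1], and then [2 * a > 3 * b] leaves just the
     excluded triangle. *)
  exists 1, 2; split; first by lia.
  by move=> s x s2 H3 _; have : x <= 2 * s; nia.
exists ((a - 1) %/ b), 1.
set k := _ %/ _.
have k2 : 2 <= k by rewrite /k leq_divRL //; lia.
have k1 : k * b <= a - 1 by exact: leq_trunc_div.
have k3 : a - 1 < k.+1 * b by exact: ltn_ceil.
split; first by lia.
move=> s x s2 H3 H4.
have H5 : x <= k.+1 * s by nia.
(* From [4 * k] vertices on the density bound suffices, below that the number of pairs does. *)
have [s4|s4] := leqP (4 * k) s; first by nia.
have : s * s.-1 <= 4 * (k * (s - 2) + 1).
  have -> : s = (s - 2).+2 by lia.
  have : s - 2 <= 4 * k - 3 by lia.
  move: (s - 2) => t tk /=; rewrite subSS subSS subn0; nia.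
lia.
Qed.

(** * Covered vertices, and Waiter's bound on sparse edge sets *)

Section Cover.
Variable W : finType.
Implicit Types (X Y : {set {set W}}).

Definition pairs_only X := [forall e in X, #|e| == 2].

Lemma cover_setU X Y : cover (X :|: Y) = cover X :|: cover Y.
Proof. by rewrite /cover bigcup_setU. Qed.

Lemma card_cover_modular X Y :
  #|cover (X :|: Y)| + #|cover (X :&: Y)| <= #|cover X| + #|cover Y|.
Proof.
rewrite cover_setU -[leqRHS]cardsUI leq_add2l; apply: subset_leq_card.
apply/subsetP => x /bigcupP[e]; rewrite !inE => /andP[eX eY] xe.
by apply/andP; split; apply/bigcupP; exists e.
Qed.

Lemma card_cover_ge2 X : pairs_only X -> X != set0 -> 2 <= #|cover X|.
Proof.
move=> /forall_inP pX /set0Pn[e eX]; rewrite -(eqP (pX e eX)).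
by apply: subset_leq_card; exact: bigcup_sup.
Qed.

Lemma pairs_card_bound X : pairs_only X -> 2 * #|X| <= #|cover X| * #|cover X|.-1.
Proof.
move=> /forall_inP pX.
have : X \subset [set e : {set W} | e \subset cover X & #|e| == 2].
  by apply/subsetP => e eX; rewrite inE (pX e eX) andbT; exact: bigcup_sup.
move/subset_leq_card; rewrite cards_draws bin2 => H.
have := half_leq (leqnn (#|cover X| * #|cover X|.-1)); have := odd_double_half (#|cover X| * #|cover X|.-1).
move: H; lia.
Qed.
End Cover.

(** The 2 subtracted from the cover size cancels in the submodular inequality only if all four
    covers have at least two vertices. For the intersection this needs a common edge, which is why
    only intersecting submodularity is available. *)
Lemma sparse_pairing_forces (W : finType) (U C : {set {set W}}) (a b : nat) :
  pairs_only U -> b < a -> 0 < b -> ~~ ((b == 1) && (a == 2)) ->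
  (forall Z : {set {set W}}, Z != set0 -> Z \subset U -> b * #|Z| <= a * #|cover Z|) ->
  [disjoint C & U] ->
  waiter_forces 1 (fun C' => forall B : {set {set W}}, #|B| = a.+1 -> #|cover B| = b.+2 ->
    B \subset U -> ~~ (B \subset C')) U C.
Proof.
move=> pU ba b0 nt sp dCU.
have [k [l [kl Hkl]]] := sparsity_parameters ba b0 nt.
have pZ (Z : {set {set W}}) : Z \subset U -> pairs_only Z.
  move=> ZU; apply/forall_inP => e eZ; exact: (forall_inP pU _ (subsetP ZU _ eZ)).
pose g (Z : {set {set W}}) := k * (#|cover Z| - 2) + l.
have H : waiter_forces 1 (fun C' => forall X : {set {set W}}, X != set0 -> X \subset U ->
    #|X :&: C'| <= g X) U C.
  apply: pairing_forces => //.
    move=> X1 X2 X1U X2U X12; rewrite /g.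
    have := card_cover_modular X1 X2.
    have := card_cover_ge2 (pZ _ (subset_trans (subsetIl X1 X2) X1U)) X12.
    have X1n : X1 != set0 by apply: contraNneq X12 => ->; rewrite set0I.
    have X2n : X2 != set0 by apply: contraNneq X12 => ->; rewrite setI0.
    have := card_cover_ge2 (pZ _ X1U) X1n; have := card_cover_ge2 (pZ _ X2U) X2n.
    have X12U : X1 :|: X2 \subset U by rewrite subUset X1U.
    have Un : X1 :|: X2 != set0 by rewrite setU_eq0 negb_and X1n.
    have := card_cover_ge2 (pZ _ X12U) Un.
    move=> g1 g2 g3 g4 g5.
    have : #|cover (X1 :|: X2)| - 2 + (#|cover (X1 :&: X2)| - 2) <=
           #|cover X1| - 2 + (#|cover X2| - 2) by move: g1 g2 g3 g4 g5; clear; lia.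
    by move/(leq_mul (leqnn k)); rewrite !mulnDr; clear; lia.
  move=> X X0 XU.
  have /eqP -> : #|X :&: C| == 0.
    rewrite cards_eq0 setI_eq0 disjoint_sym; exact: disjointWr dCU.
  rewrite (setIidPl XU) muln0 add0n /g; apply: Hkl; last exact: pairs_card_bound (pZ _ XU).
    exact: card_cover_ge2 (pZ _ XU) X0.
  exact: sp.
apply: waiter_forces_imp H => C' _ _ H B cB vB BU; apply/negP => BC'.
have B0 : B != set0 by rewrite -cards_eq0 cB.
have := H B B0 BU; rewrite (setIidPl BC') cB /g vB subSS subSS subn0.
by move: kl; clear; lia.
Qed.

(** Each label class is offered in one turn, so Client owns at most one element per label; a
    strategy is then just a labelling with small classes. *)
Lemma waiter_forces_labels (E : finType) (L : eqType) q (P : {set E} -> Prop)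
    (lab : E -> L) (Y C : {set E}) :
  (forall l, #|[set e in Y | lab e == l]| <= q.+1) ->
  [disjoint C & Y] ->
  (forall C' : {set E}, C \subset C' -> C' \subset C :|: Y ->
     (forall e e', e \in C' -> e' \in C' -> e \in Y -> e' \in Y -> lab e = lab e' -> e = e') -> P C') ->
  waiter_forces q P Y C.
Proof.
move Ek : #|Y| => k; elim/ltn_ind: k Y C Ek => k IH Y C Ek Hl dCY HP.
have [Y0|/set0Pn[e eY]] := eqVneq Y set0.
  rewrite Y0; apply: WF_done; apply: HP => //; first exact: subsetUl.
  by move=> e e' _ _; rewrite Y0 inE.
pose Q := [set e' in Y | lab e' == lab e].
have QY : Q \subset Y by apply/subsetP => x; rewrite inE => /andP[].
have eQ : e \in Q by rewrite inE eY eqxx.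
apply: (WF_offer (Q := Q)) => //.
  by rewrite Hl andbT; apply/card_gt0P; exists e.
move=> x xQ; have xY := subsetP QY _ xQ.
apply: (IH #|Y :\: Q|) => //.
- rewrite -Ek; apply: proper_card; apply/properP; split; first exact: subsetDl.
  by exists e => //; rewrite inE eQ.
- move=> l; apply: leq_trans (Hl l); apply: subset_leq_card.
  by apply/subsetP => z; rewrite !inE => /andP[/andP[_ ->]].
- rewrite disjoint_subset; apply/subsetP => z; rewrite !inE.
  by case/orP=> [/eqP->|/(disjointFr dCY)->]; rewrite ?andbF //; move: xQ; rewrite inE => ->.
move=> C' s1 s2 Hinj; apply: HP.
- by apply: subset_trans s1; exact: subsetUr.
- apply: subset_trans s2 _; apply/subsetP => z; rewrite !inE.
  by case/orP=> [/orP[/eqP->|->//]|/andP[_ ->]]; rewrite ?xY orbT.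
have inQ z : z \in C' -> z \in Q -> z = x.
  move=> /(subsetP s2); rewrite !inE => /orP[/orP[/eqP//|zC]|/andP[/negP nq _] //].
  by rewrite (disjointFr dCY zC).
move=> e1 e2 e1C e2C e1Y e2Y l12.
have [e1Q|e1Q] := boolP (e1 \in Q).
  have e2Q : e2 \in Q by move: e1Q; rewrite !inE -l12 e2Y => /andP[].
  by rewrite (inQ _ e1C e1Q) (inQ _ e2C e2Q).
have e2Q : e2 \notin Q by move: e1Q; rewrite !inE -l12 e2Y e1Y.
by apply: Hinj; rewrite // inE ?e1Q ?e2Q.
Qed.

(** * The triangle, with offers of three edges *)

Section Triangle.
Variable W : finType.
Implicit Types (Y Z J F C : {set {set W}}) (N K : {set W}) (u x y z : W).

Definition triangle_free F : Prop := forall x y z, x != y -> y != z -> x != z ->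
  [set x; y] \in F -> [set y; z] \in F -> [set x; z] \in F -> False.

Lemma handshake Z : pairs_only Z ->
  \sum_(x in cover Z) #|[set e in Z | x \in e]| = 2 * #|Z|.
Proof.
move=> /forall_inP pZ.
rewrite -sum1_card big_distrr /=.
under eq_bigr => x _ do rewrite -sum1dep_card.
rewrite (exchange_big_dep (mem Z)) /=; last by move=> x e _ /andP[].
apply: eq_bigr => e eZ; rewrite muln1 -(eqP (pZ e eZ)) -sum1_card.
apply: eq_bigl => x; rewrite eZ /=; apply/andb_idl => xe.
by apply/bigcupP; exists e.
Qed.

Lemma sum_star_inter Z K : \sum_(x in K) #|[set e in Z | x \in e]| = \sum_(e in Z) #|e :&: K|.
Proof.
under eq_bigr => x _ do rewrite -sum1dep_card.
rewrite (exchange_big_dep (mem Z)) /=; last by move=> x e _ /andP[].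
apply: eq_bigr => e eZ; rewrite -sum1_card; apply: eq_bigl => x.
by rewrite eZ inE /= andbC.
Qed.

(** The labels are the components of the graph [J]. With at most two edges a component is a vertex,
    an edge of [J], or the path formed by both edges; so classes at a vertex joined to [N] have at
    most three edges. *)
Lemma component_labels N J : pairs_only J -> (forall e, e \in J -> e \subset N) -> #|J| <= 2 ->
  exists c : W -> {set W},
    (forall x y, [set x; y] \in J -> c x = c y) /\
    forall r, let K := [set x in N | c x == r] in
      [\/ #|K| <= 1, K \in J | #|J| = 2 /\ #|K| = 3 /\ K = cover J].
Proof.
move=> /forall_inP pJ JN J2.
have [J0|] := eqVneq J set0.
  exists (fun x => [set x]); split=> [x y|r]; first by rewrite J0 inE.
  apply: Or31; rewrite leqNgt; apply/negP => /card_gt1P[x [y [/setIdP[_ /eqP <-] /setIdP[_ /eqP/set1_inj->]]]].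
  by rewrite eqxx.
case/set0Pn=> e1 e1J; have e1N := JN _ e1J; have p1 := eqP (pJ _ e1J).
have [J1|] := eqVneq (J :\ e1) set0.
  have EJ : J = [set e1] by rewrite -(setD1K e1J) J1 setU0.
  exists (fun x => if x \in e1 then e1 else [set x]); split=> [x y|r].
    by rewrite EJ inE => /eqP <-; rewrite !inE !eqxx orbT.
  have [->|re] := eqVneq r e1.
    apply: Or32; rewrite (_ : [set x in N | _] = e1) //; apply/setP => x; rewrite inE.
    case: ifP => xe; first by rewrite (subsetP e1N _ xe) eqxx.
    by apply/andP => -[_ /eqP E]; move: p1; rewrite -E cards1.
  apply: Or31; rewrite leqNgt; apply/negP => /card_gt1P[x [y [/setIdP[_ cx] /setIdP[_ cy]]]].
  move: cx cy; case: ifP => _; first by rewrite eq_sym (negPf re).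
  case: ifP => _ /eqP <-; first by move/eqP=> E; move: p1; rewrite E cards1.
  by move=> /eqP/set1_inj->; rewrite eqxx.
case/set0Pn=> e2; rewrite !inE => /andP[e21 e2J].
have e2N := JN _ e2J; have p2 := eqP (pJ _ e2J).
have EJ : J = [set e1; e2].
  apply/eqP; rewrite eq_sym eqEcard subUset !sub1set e1J e2J /=.
  by rewrite cards2 eq_sym e21.
have [e12|e12] := eqVneq (e1 :&: e2) set0.
  have d12 x : x \in e1 -> x \in e2 -> False.
    by move=> x1 x2; move/setP: e12 => /(_ x); rewrite !inE x1 x2.
  exists (fun x => if x \in e1 then e1 else if x \in e2 then e2 else [set x]); split=> [x y|r].
    rewrite EJ !inE => /orP[]/eqP exy.
      by rewrite -exy !inE !eqxx orbT.
    have x2 : x \in e2 by rewrite -exy !inE eqxx.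
    have y2 : y \in e2 by rewrite -exy !inE eqxx orbT.
    by rewrite x2 y2; case: ifP => [/d12/(_ x2)//|]; case: ifP => [/d12/(_ y2)//|].
  have [->|re1] := eqVneq r e1.
    apply: Or32; rewrite (_ : [set x in N | _] = e1) //; apply/setP => x; rewrite inE.
    case: ifP => xe; first by rewrite (subsetP e1N _ xe) eqxx.
    case: ifP => _; first by rewrite (negPf e21) andbF.
    by apply/andP => -[_ /eqP E]; move: p1; rewrite -E cards1.
  have [->|re2] := eqVneq r e2.
    apply: Or32; rewrite (_ : [set x in N | _] = e2) //; apply/setP => x; rewrite inE.
    case: ifP => xe.
      by rewrite eq_sym (negPf e21) andbF; apply/esym/negP => /(d12 _ xe).
    case: ifP => xe2; first by rewrite (subsetP e2N _ xe2) eqxx.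
    by apply/andP => -[_ /eqP E]; move: p2; rewrite -E cards1.
  apply: Or31; rewrite leqNgt; apply/negP => /card_gt1P[x [y [/setIdP[_ cx] /setIdP[_ cy]]]].
  move: cx cy; case: ifP => _; first by rewrite eq_sym (negPf re1).
  case: ifP => _; first by rewrite eq_sym (negPf re2).
  move=> /eqP <-; case: ifP => _; first by move/eqP=> E; move: p1; rewrite E cards1.
  case: ifP => _; first by move/eqP=> E; move: p2; rewrite E cards1.
  by move=> /eqP/set1_inj->; rewrite eqxx.
have c12 : #|e1 :|: e2| = 3.
  have := cardsUI e1 e2; rewrite p1 p2.
  have : 0 < #|e1 :&: e2| by rewrite card_gt0.
  have : #|e1 :&: e2| < 2.
    rewrite -p1; apply: proper_card; rewrite properEneq subsetIl andbT.
    apply: contraNneq e21 => E; rewrite eq_sym eqEcard p1 p2 leqnn andbT -E; exact: subsetIr.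
  by clear; lia.
have cJ : cover J = e1 :|: e2 by rewrite EJ /cover big_setU1 ?big_set1 // inE eq_sym.
exists (fun x => if x \in e1 :|: e2 then e1 :|: e2 else [set x]); split=> [x y|r].
  rewrite EJ !inE => /orP[]/eqP exy; rewrite -exy !inE !eqxx ?orbT //.
have [->|re] := eqVneq r (e1 :|: e2).
  have EK : [set x in N | (if x \in e1 :|: e2 then e1 :|: e2 else [set x]) == e1 :|: e2] = e1 :|: e2.
    apply/setP => x; rewrite inE; case: ifP => xe.
      by rewrite eqxx andbT; move: xe; rewrite inE => /orP[/(subsetP e1N)|/(subsetP e2N)].
    by apply/andP => -[_ /eqP E]; move: c12; rewrite -E cards1.
  by apply: Or33; rewrite /= EK cJ EJ cards2 eq_sym e21.
apply: Or31; rewrite leqNgt; apply/negP => /card_gt1P[x [y [/setIdP[_ cx] /setIdP[_ cy]]]].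
move: cx cy; case: ifP => _; first by rewrite eq_sym (negPf re).
case: ifP => _ /eqP <-; first by move/eqP=> E; move: c12; rewrite E cards1.
by move=> /eqP/set1_inj->; rewrite eqxx.
Qed.
End Triangle.

Section TriangleGame.
Variable W : finType.
Implicit Types (Y Z J F C S : {set {set W}}) (N K : {set W}) (u x y z : W).

Lemma pair_eq2r (x y z : W) : [set x; y] = [set x; z] -> y = z.
Proof.
move=> E; have : y \in [set x; z] by rewrite -E !inE eqxx orbT.
have : z \in [set x; y] by rewrite E !inE eqxx orbT.
by rewrite !inE => /orP[/eqP->|/eqP->//] /orP[/eqP->|/eqP->].
Qed.

Lemma pair_eq2l (x y z : W) : [set y; x] = [set z; x] -> y = z.
Proof. by rewrite ![ [set _; x] ]setUC; exact: pair_eq2r. Qed.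

(* The endpoint of [e] in [N] labels the edge; edges in the same class are offered together. *)
Definition end_in N (c : W -> {set W}) (e : {set W}) : option {set W} :=
  omap c [pick x in e :&: N].

Lemma end_in_pair N c x y : x \in N -> y \notin N -> end_in N c [set x; y] = Some (c x).
Proof.
move=> xN yN; rewrite /end_in; case: pickP => [z|/(_ x)]; last by rewrite !inE eqxx xN.
by rewrite !inE => /andP[/orP[]/eqP->] //; rewrite (negPf yN).
Qed.

(** Two edges per vertex mean average degree at most 4; if no degree is below 4, all are equal to
    4. *)
Lemma sparse_star_or_regular Y : pairs_only Y ->
  (Y != set0 -> #|Y| <= 2 * #|cover Y|) -> Y != set0 ->
  (exists u, 0 < #|[set e in Y | u \in e]| <= 3) \/
  (exists2 u, u \in cover Y & forall x, x \in cover Y -> #|[set e in Y | x \in e]| = 4).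
Proof.
move=> pY sp Y0.
have [/existsP[u Hu]|/existsPn Hn] := boolP [exists u, 0 < #|[set e in Y | u \in e]| <= 3].
  by left; exists u.
right.
have ge4 x : x \in cover Y -> 4 <= #|[set e in Y | x \in e]|.
  move=> /bigcupP[e eY xe]; have := Hn x.
  have -> /= : 0 < #|[set e in Y | x \in e]| by apply/card_gt0P; exists e; rewrite inE eY.
  by rewrite -ltnNge.
have [u uY] : exists u, u \in cover Y.
  apply/card_gt0P; apply: leq_trans (card_cover_ge2 pY Y0) => //.
exists u => // x xY; apply/eqP; rewrite eqn_leq ge4 // andbT.
have := handshake pY; rewrite (bigD1 x) //=.
have : \sum_(i in cover Y | i != x) 4 <= \sum_(i in cover Y | i != x) #|[set e in Y | i \in e]|.
  by apply: leq_sum => i /andP[iY _]; exact: ge4.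
have : \sum_(i in cover Y | i != x) 4 + 4 = 4 * #|cover Y|.
  by rewrite -[RHS]mulnC -sum_nat_const [RHS](bigD1 x) //= addnC.
have := sp Y0; move: (\sum_(i in cover Y | i != x) 4) => s1.
move: (\sum_(i in cover Y | i != x) #|[set e in Y | i \in e]|) #|_| #|_| #|_| => s2 n1 n2 n3; clear. lia.
Qed.

(** A star of at most three edges is saved for the end and offered at once. In the 4-regular case
    the star of [u] is split along the components of Client's edges among the neighbours of [u]; the
    danger is that the remaining edges at these neighbours then form too large classes. *)
Lemma triangle_forces Y C : pairs_only Y ->
  (forall Z, Z != set0 -> Z \subset Y -> #|Z| <= 2 * #|cover Z|) ->
  [disjoint C & Y] ->
  waiter_forces 2 (fun C' => triangle_free (C' :&: Y)) Y C.
Proof.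
move Ek : #|Y| => k; elim/ltn_ind: k Y C Ek => k IH Y C Ek pY sp dCY.
have [Y0|Yn0] := eqVneq Y set0.
  by rewrite Y0; apply: WF_done => x y z _ _ _; rewrite !inE andbF.
have IHD S : S \subset Y -> S != set0 ->
    waiter_forces 2 (fun C' => triangle_free (C' :&: (Y :\: S))) (Y :\: S) C.
  move=> SY /set0Pn[e eS]; apply: (IH #|Y :\: S|) => //.
  - rewrite -Ek; apply: proper_card; apply/properP; split; first exact: subsetDl.
    by exists e; [exact: (subsetP SY)|rewrite inE eS].
  - by apply/forall_inP => f; rewrite inE => /andP[_ fY]; exact: (forall_inP pY).
  - by move=> Z Z0 ZS; apply: sp => //; apply: subset_trans ZS _; exact: subsetDl.
  - by apply: disjointWr dCY; exact: subsetDl.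
have split_at S : S \subset Y -> Y = (Y :\: S) :|: S.
  move=> SY; apply/setP => e; rewrite !inE.
  by case: (boolP (e \in S)) => [/(subsetP SY)->|_]; rewrite ?orbT ?orbF.
have dsp S : [disjoint Y :\: S & S].
  by rewrite -setI_eq0; apply/eqP/setP => z; rewrite !inE; case: (z \in S); rewrite ?andbF.
have after S C1 : S \subset Y -> C1 \subset C :|: (Y :\: S) -> [disjoint C1 & S].
  move=> SY s; rewrite disjoint_subset; apply/subsetP => z /(subsetP s); rewrite !inE.
  case/orP=> [zC|/andP[]//]; apply/negP => /(subsetP SY) zY.
  by rewrite (disjointFr dCY zC) in zY.
have e2 (e : {set W}) : e \in Y -> #|e| = 2 by move=> /(forall_inP pY)/eqP.
have ne x y : [set x; y] \in Y -> x != y by move/e2; rewrite cards2; case: eqP.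
case: (sparse_star_or_regular pY (fun nz => sp Y nz (subxx _)) Yn0) => [[u /andP[u0 u3]]|[u uY deg4]].
  set S := [set e in Y | u \in e] in u0 u3.
  have SY : S \subset Y by apply/subsetP => e; rewrite inE => /andP[].
  have Sn0 : S != set0 by rewrite -card_gt0.
  rewrite {2}(split_at _ SY); apply: waiter_forces_cat => //.
  apply: waiter_forces_imp (IHD _ SY Sn0) => C1 s1 s2 tf1.
  have dS := after _ _ SY s2.
  (* One label for the whole star: Client gets a single edge at [u]. *)
  apply: (waiter_forces_labels (lab := fun=> tt)) => //.
    by move=> l; apply: leq_trans u3; apply: subset_leq_card; apply/subsetP => z; rewrite inE => /andP[].
  move=> C2 s3 s4 inj2.
  have inS e : e \in C2 :&: Y -> u \in e -> e \in S by rewrite !inE => /andP[_ ->] ->.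
  have noS e f : e \in C2 :&: Y -> f \in C2 :&: Y -> u \in e -> u \in f -> e = f.
    move=> eC fC ue uf; apply: inj2 => //; rewrite ?inS //.
      by move: eC; rewrite inE => /andP[].
    by move: fC; rewrite inE => /andP[].
  have out e : e \in C2 :&: Y -> u \notin e -> e \in C1 :&: (Y :\: S).
    rewrite !inE => /andP[eC eY] ue; rewrite eY (negPf ue) !andbF /= andbT.
    by have := subsetP s4 _ eC; rewrite !inE (negPf ue) andbF orbF.
  have key y z : y != z -> [set u; y] \in C2 :&: Y -> [set u; z] \in C2 :&: Y -> False.
    move=> yz ey ez; case/eqP: yz; apply: (@pair_eq2r u); apply: noS => //; by rewrite !inE eqxx.
  move=> x y z xy yz xz Exy Eyz Exz.
  have [Ex|xu] := eqVneq x u; first by subst x; exact: (key y z).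
  have [Ey|yu] := eqVneq y u.
    by subst y; apply: (key x z) => //; rewrite setUC.
  have [Ez|zu] := eqVneq z u.
    by subst z; apply: (key x y) => //; rewrite setUC.
  by apply: (tf1 x y z) => //; apply: out => //; rewrite !inE negb_or ![u == _]eq_sym ?xu ?yu ?zu.
pose S := [set e in Y | u \in e].
pose N := [set x | (x != u) && ([set u; x] \in Y)].
have uN : u \notin N by rewrite inE eqxx.
have SY : S \subset Y by apply/subsetP => e; rewrite inE => /andP[].
have S4 : #|S| = 4 by exact: deg4.
have Sn0 : S != set0 by rewrite -card_gt0 S4.
have inN x : [set u; x] \in Y -> x \in N.
  by move=> Ex; rewrite inE Ex andbT eq_sym ne.
have NcovY x : x \in N -> x \in cover Y.
  by rewrite inE => /andP[_ Ex]; apply/bigcupP; exists [set u; x] => //; rewrite !inE eqxx orbT.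
have SP (e : {set W}) : e \in S -> exists2 x, x \in N & e = [set u; x].
  rewrite inE => /andP[eY ue]; have /eqP/cards2P[x [y [xy Ee]]] := e2 _ eY.
  move: ue; rewrite Ee !inE => /orP[]/eqP ux.
    by exists y; [apply: inN; rewrite ux -Ee|rewrite ux].
  by exists x; [apply: inN; rewrite ux setUC -Ee|rewrite ux setUC].
have N4 : #|N| = 4.
  rewrite -S4 -(card_in_imset (f := fun x => [set u; x]) (D := mem N)); last first.
    by move=> x y _ _; exact: pair_eq2r.
  apply: eq_card => e; apply/imsetP/idP => [[x xN ->]|/SP[x xN ->]]; last by exists x.
  by move: xN; rewrite !inE => /andP[_ ->]; rewrite eqxx.
pose I := [set e in Y | e \subset N].
have IY : I \subset Y by apply/subsetP => e; rewrite inE => /andP[].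
have IN (e : {set W}) : e \in I -> e \subset N by rewrite inE => /andP[].
have starlab (c : W -> {set W}) r : [set e in S | end_in N c e == Some r] \subset
    (fun x => [set u; x]) @: [set x in N | c x == r].
  apply/subsetP => e; rewrite inE => /andP[/SP[x xN ->]].
  rewrite setUC end_in_pair // => /eqP[cx]; apply/imsetP; exists x; rewrite 1?setUC //.
  by rewrite inE xN cx eqxx.
have lab_some (c : W -> {set W}) (e : {set W}) x : x \in e -> x \in N -> end_in N c e != None.
  by move=> xe xN; rewrite /end_in; case: pickP => // /(_ x); rewrite inE xe xN.
have SN (c : W -> {set W}) (e : {set W}) : e \in S -> end_in N c e != None.
  move=> /SP[x xN ->]; apply: (@lab_some c _ x) => //; by rewrite !inE eqxx orbT.
have pJ J : J \subset I -> pairs_only J.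
  move=> JI; apply/forall_inP => e eJ; apply/eqP/e2/(subsetP IY)/(subsetP JI) => //.
(* A Client triangle through [u] uses two edges of one class at [u]. *)
have at_u (c : W -> {set W}) C2 :
    (forall e e', e \in C2 -> e' \in C2 -> e \in S -> e' \in S -> end_in N c e = end_in N c e' -> e = e') ->
    (forall x y, [set x; y] \in I :&: C2 -> c x = c y) ->
    forall y z, y != z -> [set u; y] \in C2 :&: Y -> [set u; z] \in C2 :&: Y -> [set y; z] \in C2 :&: Y -> False.
  move=> inj cc y z yz; rewrite !inE => /andP[yC yY] /andP[zC zY] /andP[yzC yzY].
  have yN := inN _ yY; have zN := inN _ zY.
  case/eqP: yz; apply: (@pair_eq2r u); apply: inj => //; rewrite ?inE ?yY ?zY ?eqxx //.
  rewrite ![ [set u; _] ]setUC !end_in_pair //; congr Some; apply: cc.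
  by rewrite !inE yzC yzY subUset !sub1set yN zN.
(* With at most two edges inside [N], all of [I] may be treated as if Client owned it. *)
have [t2|t3] := leqP #|I| 2.
  have [c [cJ cK]] := component_labels (pJ _ (subxx I)) IN t2.
  rewrite {2}(split_at _ SY); apply: waiter_forces_cat => //.
  apply: waiter_forces_imp (IHD _ SY Sn0) => C1 s1 s2 tf1.
  apply: (waiter_forces_labels (lab := end_in N c)).
  - case=> [r|]; last by rewrite (_ : [set e in S | _] = set0) ?cards0 //; apply/setP => e; rewrite !inE;
      apply/negP => /andP[eS]; apply/negP; apply: SN; rewrite inE.
    apply: leq_trans (subset_leq_card (starlab c r)) _; apply: leq_trans (leq_imset_card _ _) _.
    case: (cK r) => [|KI|[_ [-> _]]] //; first by move/leq_trans; apply.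
    by rewrite (eqP (forall_inP (pJ _ (subxx I)) _ KI)).
  - exact: after SY s2.
  move=> C2 s3 s4 inj2.
  have key := at_u c C2 inj2.
  have {}key : forall y z, y != z -> [set u; y] \in C2 :&: Y -> [set u; z] \in C2 :&: Y -> [set y; z] \in C2 :&: Y -> False.
    by apply: key => x y; rewrite inE => /andP[/cJ].
  have out e : e \in C2 :&: Y -> u \notin e -> e \in C1 :&: (Y :\: S).
    rewrite !inE => /andP[eC eY] ue; rewrite eY (negPf ue) !andbF /= andbT.
    by have := subsetP s4 _ eC; rewrite !inE (negPf ue) andbF orbF.
  move=> x y z xy yz xz Exy Eyz Exz.
  have [Ex|xu] := eqVneq x u; first by subst x; exact: (key y z).
  have [Ey|yu] := eqVneq y u.
    by subst y; apply: (key x z) => //; rewrite setUC.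
  have [Ez|zu] := eqVneq z u.
    by subst z; apply: (key x y) => //; rewrite setUC.
  by apply: (tf1 x y z) => //; apply: out => //; rewrite !inE negb_or ![u == _]eq_sym ?xu ?yu ?zu.
(* More than two edges inside [N]: play the edges away from [u] and [N], then those inside [N],
   then all edges with one end in [N]. *)
pose O := [set e in Y | (e :&: N != set0) && ~~ (e \subset N)].
have OY : O \subset Y by apply/subsetP => e; rewrite inE => /andP[].
have IOY : I :|: O \subset Y by rewrite subUset IY OY.
have SO : S \subset O.
  apply/subsetP => e eS; have [x xN Ee] := SP _ eS; rewrite inE (subsetP SY) //=; apply/andP; split.
    by apply/set0Pn; exists x; rewrite inE xN andbT Ee !inE eqxx orbT.
  by rewrite Ee subUset sub1set (negPf uN).
have IO0 : [disjoint I & O].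
  by rewrite -setI_eq0; apply/eqP/setP => e; rewrite !inE; case: (e \subset N); rewrite ?andbF.
have IOn0 : I :|: O != set0 by case/set0Pn: Sn0 => e /(subsetP SO) eO; apply/set0Pn; exists e; rewrite inE eO orbT.
have I6 : #|I| <= 6.
  apply: (@leq_trans #|[set e : {set W} | e \subset N & #|e| == 2]|); last by rewrite cards_draws N4.
  by apply: subset_leq_card; apply/subsetP => e eI; rewrite inE (IN _ eI) (e2 _ (subsetP IY _ eI)).
rewrite {2}(split_at _ IOY); apply: waiter_forces_cat => //.
apply: waiter_forces_imp (IHD _ IOY IOn0) => C0 s1 s2 tf0.
have dC0 := after _ _ IOY s2.
apply: waiter_forces_cat => //.
(* At most six edges lie inside [N]; the first three and the rest make two offers, so Client gets at
   most two of them. *)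
apply: (waiter_forces_labels (lab := fun e => index e (enum I) < 3)).
- have cnt (p : pred nat) m : (forall i, i < 6 -> p i -> m <= i < m + 3) ->
      #|[set e in I | p (index e (enum I))]| <= 3.
    move=> Hp.
    have -> : 3 = #|[set: 'I_3]| by rewrite cardsT card_ord.
    pose f e := inord (index e (enum I) - m) : 'I_3.
    rewrite -(card_in_imset (f := f)); first by apply: subset_leq_card; exact: subsetT.
    have bd e : e \in I -> p (index e (enum I)) -> m <= index e (enum I) < m + 3.
      by move=> eI; apply: Hp; apply: leq_trans I6; rewrite cardE index_mem mem_enum.
    move=> e f'; rewrite !inE => /andP[eI pe] /andP[fI pf].
    have eI' : e \in I by rewrite inE. have fI' : f' \in I by rewrite inE.
    have /andP[b1 b2] := bd _ eI' pe; have /andP[b3 b4] := bd _ fI' pf.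
    move=> /(congr1 val); rewrite /= !inordK; last 2 first.
    + by move: b1 b2 b3 b4; move: (index e _) (index f' _) => ? ?; clear; lia.
    + by move: b1 b2 b3 b4; move: (index e _) (index f' _) => ? ?; clear; lia.
    move=> E; have {}E : index e (enum I) = index f' (enum I) by move: E b1 b3; clear; lia.
    by rewrite -(nth_index set0 (s := enum I) (x := e)) ?mem_enum // E nth_index ?mem_enum.
  case.
    rewrite (_ : [set e in I | _] = [set e in I | index e (enum I) < 3]); last by apply/setP=> e; rewrite !inE eqb_id.
    by apply: (cnt (fun i => i < 3) 0) => i _ ->.
  rewrite (_ : [set e in I | _] = [set e in I | ~~ (index e (enum I) < 3)]); last by apply/setP=> e; rewrite !inE eqbF_neg.
  by apply: (cnt (fun i => ~~ (i < 3)) 3) => i i6; rewrite -leqNgt => ->.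
- by apply: disjointWr dC0; exact: subsetUl.
move=> C1 s3 s4 inj1.
pose J := C1 :&: I.
have JI : J \subset I by exact: subsetIr.
have J2 : #|J| <= 2.
  rewrite -card_bool -(card_in_imset (f := fun e => index e (enum I) < 3) (D := mem J)); first exact: max_card.
  by move=> e f /setIP[eC eI] /setIP[fC fI]; apply: inj1.
(* The second offer is empty unless [I] has more than three edges. *)
have J2t : #|J| = 2 -> 4 <= #|I|.
  move=> E; rewrite ltnNge; apply/negP => I3.
  have : #|J| <= 1.
    rewrite leqNgt; apply/negP => /card_gt1P[e [f [/setIP[eC eI] /setIP[fC fI] /eqP[]]]].
    apply: inj1 => //.
    have lt g : g \in I -> index g (enum I) < 3.
      by move=> gI; apply: leq_trans I3; rewrite cardE index_mem mem_enum.
    by rewrite !lt.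
  by rewrite E.
have [c [cJ cK]] := component_labels (pJ _ JI) (fun e eJ => IN e (subsetP JI e eJ)) J2.
(* Edges to [u] and edges leaving [N] elsewhere are offered separately, both sorted by the component
   of their end in [N]. *)
pose lab (e : {set W}) := (u \in e, end_in N c e).
(* Of the four edges at [x] one goes to [u]; the other three stay inside [N] or leave it. *)
have outer x : x \in N -> #|[set e in O :\: S | x \in e]| + #|[set e in I | x \in e]| = 3.
  move=> xN; have := deg4 _ (NcovY _ xN).
  rewrite (cardsD1 [set u; x]) !inE eqxx orbT andbT.
  have -> : [set u; x] \in Y by move: xN; rewrite inE => /andP[].
  move=> /eqP; rewrite add1n eqSS => /eqP <-; rewrite -[RHS](cardsID I) addnC; congr (_ + _).
    apply: eq_card => e; rewrite !inE; case: (boolP (e \in Y)) => //= eY; rewrite ?andbF //.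
    case: (boolP (e \subset N)) => eN; rewrite ?andbF //= andbT.
    suff -> : e != [set u; x] by [].
    by apply: contraTneq eN => ->; rewrite subUset sub1set (negPf uN).
  apply: eq_card => e; rewrite !inE; case: (boolP (e \in Y)) => //= eY; rewrite ?andbF //.
  case: (boolP (x \in e)) => xe; rewrite ?andbF //= ?andbT.
  have -> : e :&: N != set0 by apply/set0Pn; exists x; rewrite inE xe.
  rewrite /= andbC; congr (_ && _).
  apply/idP/idP => [ue|].
    by apply: contra ue => /eqP->; rewrite !inE eqxx.
  apply: contra => ue; have eS : e \in S by rewrite inE eY.
  have [y yN Ee] := SP _ eS; move: xe; rewrite Ee !inE => /orP[/eqP xu|/eqP->//].
  by move: xN; rewrite xu (negPf uN).
have [labb inO] : (forall l, #|[set e in O | lab e == l]| <= 3) /\ (forall e, e \in O -> end_in N c e != None).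
  have inO e : e \in O -> end_in N c e != None.
    rewrite inE => /andP[_ /andP[/set0Pn[x /setIP[xe xN]] _]]; exact: (@lab_some c _ x).
  split=> // -[b [r|]]; last first.
    rewrite (_ : [set e in O | _] = set0) ?cards0 //; apply/setP => e; rewrite [RHS]inE.
    apply/negP => /setIdP[eO /eqP[_ E]]; by move/eqP: (inO _ eO).
  pose K := [set x in N | c x == r].
  case: b.
    apply: (@leq_trans #|[set e in S | end_in N c e == Some r]|).
      apply: subset_leq_card; apply/subsetP => e /setIdP[eO /eqP[ue E]].
      by rewrite inE E eqxx andbT inE (subsetP OY) // ue.
    apply: leq_trans (subset_leq_card (starlab c r)) _; apply: leq_trans (leq_imset_card _ _) _.
    case: (cK r) => [|KI|[_ [-> _]]] //; first by move/leq_trans; apply.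
    by rewrite (eqP (forall_inP (pJ _ JI) _ KI)).
  (* The class has at most [3 * #|K|] edges minus the degrees of [K] used up inside [N]; what
     remains is to find enough edges of [I] at [K]. *)
  apply: (@leq_trans (\sum_(x in K) #|[set e in O :\: S | x \in e]|)).
    rewrite sum_star_inter.
    apply: (@leq_trans (\sum_(e in [set e in O | lab e == (false, Some r)]) #|e :&: K|)).
      rewrite -sum1_card; apply: leq_sum => e /setIdP[eO /eqP[_ E]].
      move: E; rewrite /end_in; case: pickP => //= x /setIP[xe xN] [cx].
      by apply/card_gt0P; exists x; rewrite !inE xe cx eqxx andbT; rewrite inE in xN.
    rewrite [leqRHS](bigID (mem [set e in O | lab e == (false, Some r)])) /=.
    rewrite (eq_bigl (fun e => (e \in O :\: S) && (e \in [set e in O | lab e == (false, Some r)]))).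
      exact: leq_addr.
    move=> e; apply/idP/andP => [H|[]//]; split=> //.
    move: H => /setIdP[eO /eqP[ue _]]; rewrite inE eO andbT inE ue andbF //.
  have KN : K \subset N by apply/subsetP => x; rewrite inE => /andP[].
  have sumK : \sum_(x in K) #|[set e in O :\: S | x \in e]| + \sum_(e in I) #|e :&: K| = 3 * #|K|.
    rewrite -sum_star_inter -big_split /= mulnC -sum_nat_const; apply: eq_bigr => x xK.
    exact: outer (subsetP KN _ xK).
  move: sumK; case: (cK r) => [|KI|[J22 [K3 KJ]]]; rewrite -/K.
  - by clear; lia.
  (* The edge [K] counts 2, and among the other edges of [I] only [N :\: K] avoids [K]; since [I]
     has three edges, one more meets [K]. *)
  - have cKK : #|K| = 2 by exact: eqP (forall_inP (pJ _ JI) _ KI).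
    suff : 3 <= \sum_(e in I) #|e :&: K| by rewrite cKK; clear; lia.
    rewrite (bigD1 K) ?(subsetP JI) //= setIid cKK.
    have : \sum_(e in I | (e != K) && (e != N :\: K)) 1 <= \sum_(e in I | e != K) #|e :&: K|.
      rewrite [leqRHS](bigID (fun e => e != N :\: K)) /= -[leqLHS]addn0 leq_add //.
      rewrite (eq_bigl (fun i => (i \in I) && (i != K) && (i != N :\: K))); last by move=> i; rewrite andbA.
      apply: leq_sum => e /andP[/andP[eI eK] eNK]; rewrite card_gt0; apply: contra eNK => /eqP/setP eK0.
      rewrite eqEcard (e2 _ (subsetP IY _ eI)) cardsD (setIidPr KN) N4 cKK andbT.
      apply/subsetP => x xe; have := eK0 x; rewrite !inE xe /= => ->.
      by have := subsetP (IN _ eI) _ xe; rewrite inE.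
    have : #|I| <= \sum_(e in I | (e != K) && (e != N :\: K)) 1 + 2.
      rewrite -[#|I|]sum1_card (bigD1 K) ?(subsetP JI) //= add1n addn2 ltnS.
      have [NKI|NKI] := boolP (N :\: K \in I).
        rewrite (bigD1 (N :\: K)) /= ?NKI //=; last first.
          apply/eqP => E.
          have [z zK] : exists z, z \in K by apply/card_gt0P; rewrite cKK.
          by have := zK; rewrite -E inE zK.
        rewrite add1n ltnS; apply: eq_leq; apply: eq_bigl => e; by rewrite andbA.
      apply: leq_trans (leqnSn _); apply: eq_leq; apply: eq_bigl => e.
      by apply/andP/and3P => [[eI eK]|[eI eK _]]; split=> //; apply: contraNneq NKI => <-.
    move: t3; move: (\sum_(e in I | (e != K) && (e != N :\: K)) 1) (\sum_(e in I | e != K) #|e :&: K|) => s1' s2'.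
    by clear; lia.
  (* Only one vertex of [N] lies off the path [K], so all edges of [I], at least four, meet [K]; the
     two edges of [J] count twice. *)
  - suff : 6 <= \sum_(e in I) #|e :&: K| by rewrite K3; clear; lia.
    have H4 := J2t J22.
    have H5 : \sum_(e in I) (1 + (e \in J)) <= \sum_(e in I) #|e :&: K|.
      apply: leq_sum => e eI; have ee2 := e2 _ (subsetP IY _ eI).
      case: (boolP (e \in J)) => eJ.
        by rewrite (setIidPl _) ?ee2 // (KJ : K = cover J); exact: bigcup_sup.
      rewrite addn0 card_gt0; apply/eqP => /setP eK0.
      have : #|e| <= #|N :\: K|.
        apply: subset_leq_card; apply/subsetP => x xe; have := eK0 x; rewrite !inE xe /= => ->.
        by have := subsetP (IN _ eI) _ xe; rewrite inE.
      by rewrite cardsD (setIidPr KN) N4 K3 ee2.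
    apply: leq_trans H5; rewrite big_split /= sum1_card.
    rewrite (_ : \sum_(e in I) (e \in J : nat) = #|J|); first by rewrite J22; move: H4; move: #|I| => n; clear; lia.
    rewrite -sum1_card big_mkcond [RHS]big_mkcond /=; apply: eq_bigr => e _.
    case: ifP => [_|/negP eI]; first by case: (e \in J).
    by rewrite ifN //; apply/negP => /(subsetP JI).
have dC1 : [disjoint C1 & O].
  rewrite disjoint_subset; apply/subsetP => z /(subsetP s4); rewrite in_setU => zz.
  rewrite inE; apply/negP => zO; case/orP: zz => [zC|zI]; last by rewrite (disjointFr IO0 zI) in zO.
  by have := disjointFr dC0 zC; rewrite in_setU zO orbT.
apply: (waiter_forces_labels (lab := lab)) => // C2 s5 s6 inj2.
have C2I e : e \in C2 -> e \in I -> e \in J.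
  by move=> eC eI; rewrite inE eI andbT; have := subsetP s6 _ eC; rewrite inE (disjointFr IO0 eI) orbF.
have key : forall y z, y != z -> [set u; y] \in C2 :&: Y -> [set u; z] \in C2 :&: Y -> [set y; z] \in C2 :&: Y -> False.
  apply: (at_u c) => [e f eC fC eS fS E|x y /setIP[eI eC]]; last by apply: cJ; exact: C2I.
  apply: inj2; rewrite ?(subsetP SO) // /lab E.
  by move: eS fS; rewrite !inE => /andP[_ ->] /andP[_ ->].
move=> x y z xy yz xz Exy Eyz Exz.
have [Ex|xu] := eqVneq x u; first by subst x; exact: (key y z).
have [Ey|yu] := eqVneq y u.
  by subst y; apply: (key x z) => //; rewrite setUC.
have [Ez|zu] := eqVneq z u.
  by subst z; apply: (key x y) => //; rewrite setUC.
(* If [b] is in [N], the edge of [J] from [a] to [b] gives the two edges at [d] the same label;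
   otherwise the two edges at [a] share a label. *)
have mixed a b d : a != u -> b != u -> d != u -> b != d -> a \in N -> d \notin N ->
    [set a; b] \in C2 :&: Y -> [set a; d] \in C2 :&: Y -> [set b; d] \in C2 :&: Y -> False.
  move=> au bu du bd aN dN /setIP[abC abY] /setIP[adC adY] /setIP[bdC bdY].
  have inOO p : p \in N -> [set p; d] \in Y -> [set p; d] \in O.
    move=> pN pdY; rewrite inE pdY /=; apply/andP; split.
      by apply/set0Pn; exists p; rewrite inE pN !inE eqxx.
    by rewrite subUset !sub1set (negPf dN) andbF.
  have un p : p != u -> u \in [set p; d] = false.
    by move=> pu; rewrite !inE ![u == _]eq_sym (negPf pu) (negPf du).
  have [bN|bN] := boolP (b \in N).
    have cab : c a = c b.
      by apply: cJ; apply: C2I => //; rewrite inE abY subUset !sub1set aN bN.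
    have : [set a; d] = [set b; d].
      by apply: inj2; rewrite ?inOO // /lab !un // !end_in_pair // cab.
    by move/pair_eq2l => E; have := ne _ _ abY; rewrite E eqxx.
  have : [set a; d] = [set a; b].
    apply: inj2; rewrite ?inOO //.
      rewrite inE abY /=; apply/andP; split.
        by apply/set0Pn; exists a; rewrite inE aN !inE eqxx.
      by rewrite subUset !sub1set (negPf bN) andbF.
    rewrite /lab un // !end_in_pair // !inE ![u == _]eq_sym (negPf au) (negPf bu) //.
  by move/pair_eq2r => E; rewrite E eqxx in bd.
have [xN|xN] := boolP (x \in N); have [yN|yN] := boolP (y \in N); have [zN|zN] := boolP (z \in N).
(* A triangle inside [N] would take three edges of [J]. *)
- have inJ p r : [set p; r] \in C2 :&: Y -> p \in N -> r \in N -> [set p; r] \in J.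
    by move=> /setIP[pC pYY] pN rN; apply: C2I => //; rewrite inE pYY subUset !sub1set pN rN.
  have : #|[set [set x; y]; [set y; z]; [set x; z]]| <= #|J|.
    by apply: subset_leq_card; rewrite !subUset !sub1set !inJ.
  rewrite -setUA cardsU1 cards2 !inE.
  have -> : [set y; z] != [set x; z] by apply: contra xy => /eqP/pair_eq2l->.
  have -> : ([set x; y] == [set y; z]) = false.
    by apply/negP => /eqP E; move: xz; rewrite setUC in E; rewrite (pair_eq2r E) eqxx.
  have -> : ([set x; y] == [set x; z]) = false.
    by apply/negP => /eqP/pair_eq2r E; rewrite E eqxx in yz.
  by move=> /leq_trans/(_ J2).
- by apply: (mixed x y z).
- by apply: (mixed x z y) => //; rewrite 1?eq_sym // setUC.
- by apply: (mixed x y z).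
- by apply: (mixed y z x) => //; rewrite 1?eq_sym // setUC.
- by apply: (mixed y x z) => //; rewrite setUC.
- by apply: (mixed z x y) => //; rewrite setUC // [in X in X -> _]setUC.
have far p r : p \notin N -> r \notin N -> [set p; r] \in C2 :&: Y ->
    [set p; r] \in C0 :&: (Y :\: (I :|: O)).
  move=> pN rN /setIP[pC pYY].
  have nI : [set p; r] \notin I by apply/negP => /IN; rewrite subUset !sub1set (negPf pN).
  have nO : [set p; r] \notin O.
    rewrite inE pYY /= negb_and negbK; apply/orP; left; rewrite -subset0.
    apply/subsetP => w; rewrite in_setI in_set2 => /andP[/orP[]/eqP->].
      by rewrite (negPf pN).
    by rewrite (negPf rN).
  rewrite in_setI in_setD in_setU (negPf nI) (negPf nO) pYY /= andbT.
  have := subsetP s6 _ pC; rewrite in_setU (negPf nO) orbF => /(subsetP s4).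
  by rewrite in_setU (negPf nI) orbF.
by apply: (tf0 x y z) => //; apply: far.
Qed.
End TriangleGame.

(** * 2-densities of a graph and its subgraphs *)

Section GraphFacts.
Variable T : finType.
Implicit Types (G H : graph T).

Lemma edge_card2 H e : e \in eset H -> #|e| = 2.
Proof. by move=> eH; have := forallP (graph_wf H) e; rewrite eH /= => /andP[/eqP]. Qed.

Lemma edge_sub_vset H e : e \in eset H -> e \subset vset H.
Proof. by move=> eH; have := forallP (graph_wf H) e; rewrite eH /= => /andP[]. Qed.

Lemma pairs_only_eset H : pairs_only (eset H).
Proof. by apply/forall_inP => e /edge_card2->. Qed.

Lemma cover_eset_sub H : cover (eset H) \subset vset H.
Proof. by apply/bigcupsP => e; exact: edge_sub_vset. Qed.

Lemma graph_eq G H : vset G = vset H -> eset G = eset H -> G = H.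
Proof.
by move=> vE eE; apply/val_inj/eqP; rewrite /= -pair_eqE /=; apply/andP; split; apply/eqP.
Qed.

Lemma subgraph_refl G : subgraph G G. Proof. by rewrite /subgraph !subxx. Qed.

Lemma subgraph_trans G1 G2 G3 : subgraph G1 G2 -> subgraph G2 G3 -> subgraph G1 G3.
Proof.
by move=> /andP[v1 e1] /andP[v2 e2]; rewrite /subgraph (subset_trans v1 v2) (subset_trans e1 e2).
Qed.

Lemma d2_le_m2 G H : subgraph G H -> (d2 G <= m2 H)%R.
Proof. by move=> s; rewrite /m2; exact: (@le_bigmax_cond _ _ _ _ G (fun G0 => subgraph G0 H) (@d2 T)). Qed.

Lemma m2_sub G H : subgraph G H -> (m2 G <= m2 H)%R.
Proof.
move=> s; rewrite {1}/m2; apply: bigmax_le => [|G' s'].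
  apply: le_trans (d2_le_m2 (G := Graph (_ : wf_graph (set0, set0))) _).
  - by apply/forallP => e; rewrite inE.
  - by move=> pf; rewrite /d2 /vset /= cards0.
  by move=> pf; rewrite /subgraph !sub0set.
by apply: d2_le_m2; exact: subgraph_trans s' s.
Qed.

(** Among the subgraphs of maximal 2-density take one with the fewest vertices and edges
    together. *)
Lemma strictly_2_balanced_subgraph H : (0 < m2 H)%R ->
  exists G, [/\ subgraph G H, d2 G = m2 H & strictly_2_balanced G].
Proof.
move=> m0.
have [G0 [s0 E0]] : exists G, subgraph G H /\ d2 G = m2 H.
  suff [E|//] : m2 H = 0%R \/ exists G, subgraph G H /\ d2 G = m2 H.
    by rewrite E ltxx in m0.
  pose P y := y = 0%R \/ exists G, subgraph G H /\ d2 G = y.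
  apply: (big_ind P); first by left.
    by move=> x y Px Py; rewrite maxEle; case: ifP.
  by move=> G s; right; exists G.
pose P G := subgraph G H && (d2 G == m2 H).
have P0 : P G0 by rewrite /P s0 E0 eqxx.
case: (arg_minnP (fun G => #|vset G| + #|eset G|) P0) => G /andP[s /eqP E] mn.
exists G; split=> // G' /andP[s' ne].
have EG : m2 G = m2 H.
  by apply/eqP; rewrite eq_le m2_sub //= -E d2_le_m2 // subgraph_refl.
rewrite EG lt_neqAle d2_le_m2 ?andbT; last exact: subgraph_trans s' s.
apply: contra ne => /eqP E'.
have := mn G'; rewrite /P E' eqxx (subgraph_trans s' s) => /(_ isT).
case/andP: (s') => sv se; have := subset_leq_card sv; have := subset_leq_card se.
move=> c1 c2 /= c3; apply/eqP/graph_eq; apply/eqP.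
  rewrite eqEcard sv /= -(leq_add2r #|eset G'|); apply: leq_trans c3; exact: leq_add.
rewrite eqEcard se /= -(leq_add2l #|vset G'|); apply: leq_trans c3; exact: leq_add.
Qed.

Lemma next_next_neq (s : seq T) x : uniq s -> 2 < size s -> x \in s -> next s (next s x) != x.
Proof.
move=> Us s3 xs; have [i s' Es] := rot_to xs.
have Us' : uniq (rot i s) by rewrite rot_uniq.
rewrite -!(next_rot i Us) Es; move: Us' s3; rewrite Es -(size_rot i) Es.
case: s' {Es} => [|y [|z t]] //= /andP[]; rewrite !inE !negb_or => /and3P[xy xz _] _ _.
by rewrite eqxx [y == x]eq_sym (negPf xy) eqxx eq_sym.
Qed.

(** A cycle on k vertices has 2-density (k - 1) / (k - 2). *)
Lemma m2_gt1 H : ~ forest H -> (1 < m2 H)%R.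
Proof.
move=> nf.
have [s [us ss]] : exists s, ucycle (adj H) s /\ 2 < size s.
  apply: contrapT => H1; apply: nf => s us; rewrite leqNgt; apply/negP => s3.
  by apply: H1; exists s.
have cyc := ucycle_cycle us; have Us := ucycle_uniq us.
pose E := [set [set x; next s x] | x in s].
have EH : E \subset eset H.
  by apply/subsetP => e /imsetP[x xs ->]; exact: next_cycle cyc xs.
have wfE : wf_graph ([set x in s], E).
  apply/forallP => e; apply/implyP => eE; rewrite (edge_card2 (subsetP EH _ eE)) /=.
  case/imsetP: eE => x xs ->; rewrite subUset !sub1set !inE mem_next xs //.
have sE : subgraph (Graph wfE) H.
  rewrite /subgraph EH andbT /=; apply/subsetP => x; rewrite inE => xs.
  have := next_cycle cyc xs => /edge_sub_vset; rewrite subUset sub1set => /andP[] //.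
have cE : #|E| = size s.
  rewrite card_in_imset; first by have /card_uniqP := Us.
  move=> x y xs ys E1; apply/eqP; apply: contraT => xy.
  have : x \in [set y; next s y] by rewrite -E1 !inE eqxx.
  rewrite !inE (negPf xy) /= => /eqP xn.
  have : y \in [set x; next s x] by rewrite E1 !inE eqxx.
  rewrite !inE eq_sym (negPf xy) /= => /eqP yn.
  by have := next_next_neq Us ss xs; rewrite -yn -xn eqxx.
have cV : #|[set x in s]| = size s.
  by rewrite cardsE; have /card_uniqP := Us.
apply: lt_le_trans (d2_le_m2 sE).
rewrite /d2 /vset /eset /= cV ss cE ltr_pdivlMr.
  by rewrite mul1r ltrD2l ltrN2.
by rewrite subr_gt0 ltr_nat.
Qed.

(** The fraction stays unreduced, so [a] and [b] also carry the numbers of edges and vertices of a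
    copy. *)
Lemma m2_ratio H : (1 < d2 H)%R -> d2 H = m2 H -> exists a b : nat,
  [/\ #|eset H| = a.+1, #|vset H| = b.+2, 0 < b, b < a & m2 H = (a%:R / b%:R)%R].
Proof.
move=> d1 <-; move: d1; rewrite /d2; case: ifP => // v3.
have -> : #|vset H| = (#|vset H| - 2).+2 by lia.
set b := _ - 2; have b0 : 0 < b by rewrite subn_gt0.
have -> : (b.+2%:R - 2 = b%:R :> rat)%R by rewrite -addn2 natrD addrK.
case: #|eset H| => [|a].
  rewrite sub0r mulN1r => H1; have : (1 < 0 :> rat)%R.
    by apply: lt_le_trans H1 _; rewrite oppr_le0 invr_ge0.
  by rewrite ltr10.
rewrite -natr1 addrK ltr_pdivlMr ?ltr0n // mul1r ltr_nat => ba.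
by exists a, b.
Qed.

(** Deleting an isolated vertex would raise the 2-density. *)
Lemma cover_strictly_2_balanced H : (1 < m2 H)%R -> d2 H = m2 H -> strictly_2_balanced H ->
  cover (eset H) = vset H.
Proof.
move=> m1 dm sb; apply/eqP; rewrite eqEsubset cover_eset_sub /=.
apply/subsetP => x xH; apply: contraT => xc.
have wfJ : wf_graph (vset H :\ x, eset H).
  apply/forallP => e; apply/implyP => eH; rewrite (edge_card2 eH) subsetD1 edge_sub_vset //=.
  by apply: contra xc => xe; apply/bigcupP; exists e.
have := sb (Graph wfJ); rewrite /proper_subgraph /subgraph /= subsetDl subxx /=.
have ne : Graph wfJ != H.
  apply/eqP => /(congr1 (@vset T))/setP/(_ x); rewrite /vset /= !inE eqxx /=.
  by rewrite -/(vset H) xH.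
move=> /(_ ne); rewrite -dm.
have [a [b [ha vb b0 ba mE]]] := m2_ratio (etrans (f_equal (fun z => (1 < z)%R) dm) m1) dm.
have vJ : #|vset (Graph wfJ)| = b.+1.
  by move: (cardsD1 x (vset H)); rewrite xH vb add1n => -[].
have eJ : #|eset (Graph wfJ)| = a.+1 by [].
rewrite dm mE /d2 vJ eJ; case: ifP => [b2|b2].
  rewrite -natr1 addrK -[b.+1]addn1 natrD.
  have -> : (b%:R + 1%:R - 2 = b%:R - 1 :> rat)%R by ring.
  have b1 : (0 < b%:R - 1 :> rat)%R by rewrite subr_gt0 ltr1n; lia.
  rewrite ltr_pdivrMr // mulrAC ltr_pdivlMr ?ltr0n // ltr_pM2l; last by rewrite ltr0n; lia.
  by rewrite ltrDl oppr_gt0 ltr10.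
(* Here the 2-density after deletion is 0 by convention; instead, two remaining vertices cannot
   carry [a.+1] edges. *)
have b1 : b = 1 by lia.
have := subset_leq_card (_ : eset H \subset [set e : {set T} | e \subset vset H :\ x & #|e| == 2]).
have -> : #|[set e : {set T} | e \subset vset H :\ x & #|e| == 2]| = 1.
  by rewrite cards_draws (_ : #|vset H :\ x| = 2) // -b1 -vJ.
rewrite ha => H1 _; suff : a.+1 <= 1 by lia.
apply: H1; apply/subsetP => e eH; rewrite inE (edge_card2 eH) andbT.
by have := forallP wfJ e; rewrite /= eH => /andP[].
Qed.
End GraphFacts.

(** * Copies as edge sets and their overlaps *)

Section Copies.
Variables (T W : finType).
Implicit Types (H : graph T) (f : T -> W) (A Z : {set {set W}}).

Definition edge_image H f : {set {set W}} := [set f @: (e : {set T}) | e in eset H].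

Definition is_copy H A : bool :=
  [exists f : {ffun T -> W}, dinjectiveb f (vset H) && (A == edge_image H f)].

Lemma is_copyP H A :
  reflect (exists2 f : {ffun T -> W}, {in vset H &, injective f} & A = edge_image H f) (is_copy H A).
Proof.
apply: (iffP existsP) => [[f /andP[/dinjectiveP inj /eqP]]|[f inj ->]]; first by exists f.
by exists f; rewrite eqxx andbT; apply/dinjectiveP.
Qed.

Lemma imset_inj_sub H f (B1 B2 : {set T}) : {in vset H &, injective f} ->
  B1 \subset vset H -> B2 \subset vset H -> f @: B1 = f @: B2 -> B1 = B2.
Proof.
move=> inj s1 s2 E; apply/eqP; rewrite eqEsubset; apply/andP; split; apply/subsetP => x xB.
  have : f x \in f @: B2 by rewrite -E imset_f.
  by case/imsetP=> y yB /(inj _ _ (subsetP s1 _ xB) (subsetP s2 _ yB))->.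
have : f x \in f @: B1 by rewrite E imset_f.
by case/imsetP=> y yB /(inj _ _ (subsetP s2 _ xB) (subsetP s1 _ yB))->.
Qed.

Lemma card_edge_image H f : {in vset H &, injective f} -> #|edge_image H f| = #|eset H|.
Proof.
move=> inj; apply: card_in_imset => e1 e2 e1H e2H.
by apply: imset_inj_sub inj _ _; exact: edge_sub_vset.
Qed.

Lemma cover_edge_image H f : cover (edge_image H f) = f @: cover (eset H).
Proof.
apply/setP => y; apply/bigcupP/imsetP => [[B /imsetP[e eH ->] /imsetP[x xe ->]]|[x /bigcupP[e eH xe] ->]].
  by exists x => //; apply/bigcupP; exists e.
by exists (f @: e); rewrite ?imset_f.
Qed.

Lemma pairs_only_edge_image H f : {in vset H &, injective f} -> pairs_only (edge_image H f).
Proof.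
move=> inj; apply/forall_inP => B /imsetP[e eH ->].
rewrite card_in_imset ?(edge_card2 eH) //; move=> x y xe ye.
by apply: inj; exact: (subsetP (edge_sub_vset eH)).
Qed.

Lemma contains_copyP H (G : graph W) : vset G = [set: W] ->
  contains_copy G H <-> exists2 A, is_copy H A & A \subset eset G.
Proof.
move=> vG; split=> [[f [inj _ Hf]]|[A /is_copyP[f inj ->] Hf]].
  exists (edge_image H [ffun x => f x]).
    by apply/is_copyP; exists [ffun x => f x] => // x y; rewrite !ffunE; exact: inj.
  apply/subsetP => _ /imsetP[e eH ->].
  rewrite (eq_imset (g := f)) ?Hf // => x; by rewrite ffunE.
exists f; split=> //; first by rewrite vG subsetT.
by move=> e eH; apply: (subsetP Hf); exact: imset_f.
Qed.

Lemma contains_copy_sub H H' (G : graph W) : subgraph H' H -> contains_copy G H -> contains_copy G H'.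
Proof.
move=> /andP[sv se] [f [inj sf Hf]]; exists f; split.
- by move=> x y xH yH; apply: inj; exact: (subsetP sv).
- by apply: subset_trans sf; exact: imsetS.
- by move=> e /(subsetP se)/Hf.
Qed.

Section Balanced.
Variables (H : graph T) (a b : nat).
Hypotheses (sb : strictly_2_balanced H) (cH : cover (eset H) = vset H).
Hypotheses (ha : #|eset H| = a.+1) (vb : #|vset H| = b.+2) (b0 : 0 < b).
Hypothesis mE : m2 H = (a%:R / b%:R)%R.

Lemma card_copy A : is_copy H A -> #|A| = a.+1.
Proof. by move=> /is_copyP[f inj ->]; rewrite card_edge_image. Qed.

Lemma pairs_only_copy A : is_copy H A -> pairs_only A.
Proof. by move=> /is_copyP[f inj ->]; exact: pairs_only_edge_image. Qed.

Lemma card_cover_copy A : is_copy H A -> #|cover A| = b.+2.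
Proof. by move=> /is_copyP[f inj ->]; rewrite cover_edge_image cH card_in_imset. Qed.

(** The shared i vertices and j edges form a proper subgraph of [H], so (j - 1) / (i - 2) < a / b;
    clearing denominators turns strictness into the summand 1. On two shared vertices there is only
    one edge. *)
Lemma copy_intersection A Z : is_copy H A -> A :&: Z != set0 -> ~~ (A \subset Z) ->
  (#|A :&: Z| = 1 /\ #|cover A :&: cover Z| = 2) \/
  b * #|A :&: Z| + 2 * a + 1 <= a * #|cover A :&: cover Z| + b.
Proof.
move=> cA AZ0 nAZ; have /is_copyP[f inj EA] := cA.
pose VJ := [set x in vset H | f x \in cover Z].
pose EJ := [set e in eset H | f @: e \in Z].
have wfJ : wf_graph (VJ, EJ).
  apply/forallP => e; apply/implyP; rewrite inE => /andP[eH eZ].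
  rewrite (edge_card2 eH) /=; apply/subsetP => x xe; rewrite inE (subsetP (edge_sub_vset eH)) //=.
  by apply/bigcupP; exists (f @: e); rewrite ?imset_f.
have pJ : proper_subgraph (Graph wfJ) H.
  apply/andP; split.
    by apply/andP; split; apply/subsetP => x; rewrite inE => /andP[].
  apply: contra nAZ => /eqP E; apply/subsetP => B; rewrite EA => /imsetP[e eH ->].
  by have : e \in EJ; [rewrite -[EJ]/(eset (Graph wfJ)) E|rewrite inE => /andP[]].
have EAZ : A :&: Z = [set f @: (e : {set T}) | e in EJ].
  apply/setP => B; rewrite inE EA; apply/andP/imsetP => [[/imsetP[e eH ->] BZ]|[e]].
    by exists e; rewrite // inE eH.
  by rewrite inE => /andP[eH eZ] ->; rewrite imset_f.
have EVZ : cover A :&: cover Z = f @: VJ.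
  rewrite EA cover_edge_image cH; apply/setP => y; rewrite inE; apply/andP/imsetP => [[/imsetP[x xH ->] xZ]|[x]].
    by exists x; rewrite // inE xH.
  by rewrite inE => /andP[xH xZ] ->; rewrite imset_f.
have cEJ : #|A :&: Z| = #|EJ|.
  rewrite EAZ; apply: card_in_imset => e1 e2; rewrite !inE => /andP[e1H _] /andP[e2H _].
  by apply: imset_inj_sub inj _ _; exact: edge_sub_vset.
have cVJ : #|cover A :&: cover Z| = #|VJ|.
  by rewrite EVZ; apply: card_in_imset => x y; rewrite !inE => /andP[xH _] /andP[yH _]; exact: inj.
have j0 : 0 < #|EJ| by rewrite -cEJ card_gt0.
have := sb pJ; rewrite mE /d2 {1 2}/vset /eset /= cVJ.
have pEJ : pairs_only EJ := pairs_only_eset (Graph wfJ).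
have EJ0 : EJ != set0 by rewrite -card_gt0.
have i2 : 2 <= #|VJ|.
  apply: leq_trans (card_cover_ge2 pEJ EJ0) _; apply: subset_leq_card.
  exact: (cover_eset_sub (Graph wfJ)).
have bnd := pairs_card_bound pEJ.
have lec : #|cover EJ| <= #|VJ| by apply: subset_leq_card; exact: (cover_eset_sub (Graph wfJ)).
rewrite -/VJ -/EJ cEJ; case: ifP => [i3|/negbT i3 _].
  have [i Ei] : exists i, #|VJ| = i.+3 by exists (#|VJ| - 3); lia.
  have [j Ej] : exists j, #|EJ| = j.+1 by exists (#|EJ| - 1); lia.
  rewrite Ei Ej -natr1 addrK -[i.+3]addn2 natrD addrK => H1; right.
  have : (j * b < a * i.+1)%N.
    by move: H1; rewrite ltr_pdivrMr ?ltr0n // mulrAC ltr_pdivlMr ?ltr0n // -!natrM ltr_nat.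
  by move: Ei Ej; clear; nia.
left; have EV : #|VJ| = 2 by move: i2 i3; clear; lia.
split=> //; move: bnd; have -> : #|cover EJ| = 2.
  by have := card_cover_ge2 pEJ EJ0; move: lec; rewrite EV; clear; lia.
by move: j0; clear; lia.
Qed.

(** Overlap in one edge adds [a] edges and [b] vertices, which balance exactly; every larger proper
    overlap is a gain. *)
Lemma copy_growth A Z : is_copy H A -> A :&: Z != set0 ->
  b * #|Z| + a * #|cover (A :|: Z)| <= b * #|A :|: Z| + a * #|cover Z|.
Proof.
move=> cA AZ; have [AsZ|nAZ] := boolP (A \subset Z).
  by rewrite (setUidPr AsZ).
have := cardsUI A Z; have := cardsUI (cover A) (cover Z).
rewrite cover_setU (card_copy cA) (card_cover_copy cA).
have := copy_intersection cA AZ nAZ.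
move: #|A :&: Z| #|cover A :&: cover Z| #|A :|: Z| #|cover A :|: cover Z| #|Z| #|cover Z|.
by clear => j i u cu z cz H1 H2 H3; case: H1 => [[? ?]|H1]; subst; nia.
Qed.
End Balanced.
End Copies.

Lemma triangle_of_card (T : finType) (H : graph T) :
  #|vset H| = 3 -> #|eset H| = 3 -> triangle H.
Proof.
move=> v3 e3.
have [x xV] : exists x, x \in vset H by apply/card_gt0P; rewrite v3.
have : #|vset H :\ x| == 2 by have := cardsD1 x (vset H); rewrite xV v3 add1n => -[<-].
case/cards2P=> y [z [yz Eyz]].
have [xy xz] : x != y /\ x != z.
  have : y \in vset H :\ x by rewrite Eyz !inE eqxx.
  have : z \in vset H :\ x by rewrite Eyz !inE eqxx orbT.
  by rewrite !inE ![_ == x]eq_sym => /andP[-> _] /andP[-> _].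
have EV : vset H = [set x; y; z] by rewrite -(setD1K xV) Eyz setUA.
exists x, y, z; split=> //=; first by rewrite !inE negb_or xy xz yz.
apply/eqP; rewrite eqEcard; apply/andP; split.
  apply/subsetP => e eH; have := edge_sub_vset eH; have /eqP/cards2P[u [w [uw ->]]] := edge_card2 eH.
  rewrite EV subUset !sub1set !inE => /andP[/orP[/orP[]|]/eqP uE /orP[/orP[]|]/eqP wE]; subst u w;
    move: uw; rewrite ?eqxx //= => _; rewrite ?eqxx ?orbT //.
  - by rewrite [ [set y; x] ]setUC eqxx.
  - by rewrite [ [set z; x] ]setUC eqxx ?orbT.
  - by rewrite [ [set z; y] ]setUC eqxx ?orbT.
rewrite e3 -setUA cardsU1 cards2; clear; by case: (_ \notin _); case: (_ != _).
Qed.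

(** * Waiter's win on boards with sparse atoms *)

Section WaiterWins.
Variables (T W : finType) (H : graph T) (a b q : nat).
Hypotheses (sb : strictly_2_balanced H) (cH : cover (eset H) = vset H).
Hypotheses (ha : #|eset H| = a.+1) (vb : #|vset H| = b.+2) (b0 : 0 < b) (ba : b < a).
Hypothesis mE : m2 H = (a%:R / b%:R)%R.
Hypotheses (q0 : 0 < q) (tri : triangle H -> 2 <= q).
Implicit Types (A U X C : {set {set W}}).

Lemma waiter_forces_sparse U C : pairs_only U ->
  (forall Z, Z != set0 -> Z \subset U -> b * #|Z| <= a * #|cover Z|) ->
  [disjoint C & U] ->
  waiter_forces q (fun C' => forall B, is_copy H B -> B \subset U -> ~~ (B \subset C')) U C.
Proof.
move=> pU sp dCU.
(* These values are those of the triangle, the only case calling for a bias of 2. *)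
have [/andP[/eqP b1 /eqP a2]|nt] := boolP ((b == 1) && (a == 2)).
  have q2 : 2 <= q by apply: tri; apply: triangle_of_card; rewrite ?ha ?vb ?a2 ?b1.
  apply: (waiter_forces_bias q2).
  apply: waiter_forces_imp (triangle_forces pU _ dCU); last first.
    by move=> Z Z0 ZU; have := sp Z Z0 ZU; rewrite b1 a2 mul1n.
  move=> C' _ _ tf B cB BU; apply/negP => BC'.
  have /is_copyP[f inj EB] := cB.
  have [x [y [z [Uxyz EV EE]]]] : triangle H by apply: triangle_of_card; rewrite ?ha ?vb ?a2 ?b1.
  move: Uxyz; rewrite /= !inE negb_or andbT => /andP[/andP[xy xz] yz].
  have inV w : w \in [:: x; y; z] -> w \in vset H by rewrite EV !inE -!orbA.
  have fn u w : u \in [:: x; y; z] -> w \in [:: x; y; z] -> u != w -> f u != f w.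
    by move=> uV wV; apply: contra => /eqP/(inj _ _ (inV _ uV) (inV _ wV))->.
  have fe u w : [set u; w] \in eset H -> [set f u; f w] \in C' :&: U.
    move=> uw; have := imset_f (fun e : {set T} => f @: e) uw.
    rewrite -/(edge_image H f) -EB imsetU1 imset_set1 => uwB.
    by rewrite inE (subsetP BC' _ uwB) (subsetP BU _ uwB).
  by apply: (tf (f x) (f y) (f z)); rewrite ?fn ?fe ?EE // !inE eqxx ?orbT.
apply: (waiter_forces_bias q0).
apply: waiter_forces_imp (sparse_pairing_forces pU ba b0 nt sp dCU).
move=> C' _ _ Hf B cB BU; apply: Hf => //; first exact: card_copy cB.
exact: card_cover_copy cB.
Qed.

Lemma waiter_wins_of_sparse_atoms X : pairs_only X ->
  (forall A, is_copy H A -> A \subset X ->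
     exists2 U, copy_atom (is_copy H) X A U & b * #|U| <= a * #|cover U|) ->
  waiter_forces q (fun C' => forall B, is_copy H B -> B \subset X -> ~~ (B \subset C')) X set0.
Proof.
move=> pX HA; apply: atoms_forces; last by rewrite -setI_eq0 set0I.
  by move=> A cA; rewrite -card_gt0 (card_copy ha cA).
move=> A cA AX; have [U aU spU] := HA A cA AX.
exists U; split=> // C dCU; have [_ UX _ _] := aU.
apply: waiter_forces_sparse => //.
  by apply/forall_inP => e /(subsetP UX)/(forall_inP pX).
apply: (atom_sparse (copy := is_copy H) (s := fun Z : {set {set W}} => #|cover Z|) _ aU) => //.
by move=> B Z cB BZ; apply: (copy_growth sb cH).
Qed.
End WaiterWins.

Section Exploration.
Variables (E : finType) (copy bad : pred {set E}).
Implicit Types (A B U P F : {set E}).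

(* [U] is the part of an atom discovered so far, [P] its edges not yet searched for further copies. *)
Fixpoint explore_bad (l : nat) U P F : bool :=
  bad U ||
  if l is l'.+1 then
    if [pick e in P] is Some e then
      explore_bad l' U (P :\ e) F ||
      [exists A, [&& copy A, A \subset F, e \in A, ~~ (A \subset U) &
                     explore_bad l' (U :|: A) (P :|: (A :\: U)) F]]
    else false
  else false.

(** [explore_bad] may drop [e] even while copies through [e] remain, so its failure covers every
    history, in particular the true one followed here. The fuel decreases since a copy takes its new
    edges out of [~: U], counted twice, and puts them into [P], counted once. *)
Lemma explore_atom l U P F A0 :
  ~~ explore_bad l U P F -> U \subset F -> P \subset U -> A0 \subset U ->
  (forall B, copy B -> B \subset F -> B :&: (U :\: P) != set0 -> B \subset U) ->
  (forall F', copy_closed copy F F' -> A0 \subset F' -> U \subset F') ->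
  2 * #|~: U| + #|P| <= l ->
  exists2 U', copy_atom copy F A0 U' & ~~ bad U'.
Proof.
elim: l U P => [|l IH] U P nb UF PU AU clo mn le.
  have P0 : P = set0 by apply/eqP; rewrite -cards_eq0; move: le; clear; lia.
  exists U; last by move: nb; rewrite /= orbF.
  by split=> // B cB BF BU; apply: clo => //; rewrite P0 setD0.
move: nb; rewrite /= negb_or => /andP[nbU].
case: pickP => [e eP|P0] nb; last first.
  exists U => //; split=> // B cB BF BU; apply: clo => //.
  by rewrite (_ : P = set0) ?setD0 //; apply/setP => x; rewrite inE P0.
move: nb; rewrite negb_or => /andP[nb1 /existsPn nb2].
have [/existsP[A /and4P[cA AF eA nAU]]|/existsPn nA] :=
    boolP [exists A, [&& copy A, A \subset F, e \in A & ~~ (A \subset U)]].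
  have := nb2 A; rewrite cA AF eA nAU /= => nb3.
  apply: (IH (U :|: A) (P :|: (A :\: U))) => //.
  - by rewrite subUset UF.
  - by rewrite subUset (subset_trans PU (subsetUl _ _)) /= setDE subIset // subsetUr.
  - exact: subset_trans AU (subsetUl _ _).
  - move=> B cB BF /set0Pn[x]; rewrite !inE negb_or negb_and negbK.
    move=> /andP[xB /andP[/andP[xP /orP[xU|xA]] xUA]].
      apply: subset_trans (subsetUl _ _); apply: clo => //; apply/set0Pn; exists x.
      by rewrite !inE xB xP xU.
    rewrite (negPf xA) orbF in xUA.
    apply: subset_trans (subsetUl _ _); apply: clo => //; apply/set0Pn; exists x.
    by rewrite !inE xB xP xUA.
  - move=> F' cF' AF'; have UF' := mn _ cF' AF'; rewrite subUset UF' /=.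
    apply: cF' => //; apply/set0Pn; exists e; rewrite inE eA (subsetP UF') // (subsetP PU) //.
  have k0 : 0 < #|A :\: U| by rewrite card_gt0 setD_eq0.
  have : #|P :|: (A :\: U)| <= #|P| + #|A :\: U| by rewrite cardsU leq_subr.
  have : #|~: (U :|: A)| + #|A :\: U| = #|~: U|.
    rewrite -(cardsID A (~: U)) addnC; congr (_ + _); apply: eq_card => x; rewrite !inE.
      by rewrite andbC.
    by rewrite negb_or andbC.
  by move: le k0; clear; lia.
apply: (IH U (P :\ e)) => //.
- by apply: subset_trans PU; exact: subsetDl.
- move=> B cB BF /set0Pn[x]; rewrite !inE negb_and negbK => /andP[xB /andP[/orP[/eqP xe|xP] xU]].
    by have := nA B; rewrite cB BF -xe xB /= negbK.
  by apply: clo => //; apply/set0Pn; exists x; rewrite !inE xB xP xU.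
by move: le; rewrite (cardsD1 e P) eP; clear; lia.
Qed.
End Exploration.

(** * Client's side *)

Inductive client_forces (E : finType) (q : nat) (Post : {set E} -> Prop) :
    {set E} -> {set E} -> Prop :=
  | CF_turn (Y C : {set E}) : (Y = set0 -> Post C) ->
      (forall Q : {set E}, Q \subset Y -> 0 < #|Q| <= q.+1 ->
         exists e, e \in Q /\ client_forces q Post (Y :\: Q) (e |: C)) ->
      client_forces q Post Y C.

(** Claimed and unclaimed elements are recomputed from the past offers by folding Client's answers;
    [e0] is returned where no good answer exists. *)
Lemma client_forces_wins (E : finType) (e0 : E) q (X : {set E}) (win : {set E} -> Prop) :
  client_forces q win X set0 -> client_wins q X win.
Proof.
move=> cf.
pose good (Y C Q : {set E}) e := e \in Q /\ client_forces q win (Y :\: Q) (e |: C).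
pose pick (Y C Q : {set E}) : E :=
  if pselect (exists e, good Y C Q e) is left ex then projT1 (cid ex) else e0.
have pickP (Y C Q : {set E}) : (exists e, good Y C Q e) -> good Y C Q (pick Y C Q).
  by move=> ex; rewrite /pick; case: pselect => // ex'; exact: projT2 (cid ex').
pose next (s : {set E} * {set E}) (Q : {set E}) := (s.1 :\: Q, pick s.1 s.2 Q |: s.2).
pose state := foldl next (X, set0).
pose sigma : client_strategy E := fun past Q => pick (state past).1 (state past).2 Q.
exists sigma => os.
suff H past : client_forces q win (state past).1 (state past).2 ->
    legal_offers q (state past).1 os ->
    all2 (fun (e : E) (Q : {set E}) => e \in Q) (picks sigma past os) os /\
    win ((state past).2 :|: [set e in picks sigma past os]).
  by move=> lo; have [] := H [::] cf lo; rewrite /= set0U.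
elim: os past => [|Q os IH] past cf'.
  move=> /= /eqP Y0; split=> //.
  have -> : [set e in (Nil E)] = set0 by apply/setP => x; rewrite !inE.
  by rewrite setU0; case: cf' Y0 => Y C H _ /H.
move=> /= /and3P[QY Qq lo].
have ex : exists e, good (state past).1 (state past).2 Q e.
  by case: cf' QY => Y C _ H QY; exact: H.
have [sQ cfn] := pickP _ _ _ ex.
have Est : state (rcons past Q) = next (state past) Q by rewrite /state -cats1 foldl_cat.
have [] := IH (rcons past Q); rewrite ?Est //= => al wn.
rewrite {1}/sigma sQ al; split=> //; move: wn; congr (win _).
by apply/setP => x; rewrite !inE /sigma orbCA orbA.
Qed.

Lemma client_wins_imp (E : finType) q (X : {set E}) (w1 w2 : {set E} -> Prop) :
  (forall F, w1 F -> w2 F) -> client_wins q X w1 -> client_wins q X w2.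
Proof.
by move=> imp [sigma Hs]; exists sigma => os los; have [? /imp] := Hs os los.
Qed.

(** * Client's potential *)

Section Potential.
Variables (R : realFieldType) (E I : finType) (A : I -> {set E}) (J : {set I}) (q h : nat).
Variables (E' : {set E}) (t : R).
Hypothesis Ah : forall i, i \in J -> #|A i| <= h.
Hypothesis AE' : forall i, i \in J -> A i \subset E'.
Hypothesis t0 : (0 <= t)%R.
Implicit Types (X Y C Q : {set E}) (e f : E).

Definition potential Y C : nat :=
  \sum_(i in J | A i \subset C :|: Y) q.+1 ^ #|A i :&: C|.

Definition spoiled Q : nat := #|[set i in J | 1 < #|A i :&: Q|]|.

Lemma potential_step Y C Q : Q \subset Y -> 0 < #|Q| <= q.+1 -> [disjoint C & Y] ->
  exists e, e \in Q /\ potential Y C <= potential (Y :\: Q) (e |: C) + q.+1 ^ h * spoiled Q.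
Proof.
move=> QY /andP[Q0 Qq] dCY.
have key i : i \in J -> A i \subset C :|: Y ->
   #|Q| * q.+1 ^ #|A i :&: C| <=
   \sum_(e in Q) (if A i \subset (e |: C) :|: (Y :\: Q) then q.+1 ^ #|A i :&: (e |: C)| else 0) +
   #|Q| * (q.+1 ^ h * (1 < #|A i :&: Q|)).
  move=> iJ AY.
  (* A copy meeting [Q] twice may be lost; its whole weight, at most [q.+1 ^ h], is charged to
     [spoiled]. *)
  have [AQ2|AQ1] := ltnP 1 #|A i :&: Q|.
    apply: leq_trans (leq_addl _ _); rewrite muln1 leq_mul2l leq_pexp2l ?orbT //.
    exact: leq_trans (subset_leq_card (subsetIl _ _)) (Ah iJ).
  (* A copy meeting [Q] once survives one pick out of [#|Q|], but with weight multiplied by [q.+1];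
     a copy disjoint from [Q] survives every pick. *)
  rewrite /= !muln0 addn0; move: AQ1; rewrite leq_eqVlt ltnS leqn0 => /orP[/cards1P[e1 E1]|].
    have : e1 \in A i :&: Q by rewrite E1 inE.
    rewrite inE => /andP[e1A e1Q].
    rewrite (bigD1 e1) //= ifT.
      apply: leq_trans (leq_addr _ _).
      have -> : #|A i :&: (e1 |: C)| = #|A i :&: C|.+1.
        rewrite (cardsD1 e1) !inE eqxx e1A /= add1n; congr _.+1; apply: eq_card => z; rewrite !inE.
        case: (eqVneq z e1) => [->|] //=.
        by rewrite (disjointFl dCY (subsetP QY _ e1Q)) andbF.
      by rewrite expnS leq_mul2r Qq orbT.
    apply/subsetP => z zA; rewrite !inE; case: (boolP (z \in Q)) => zQ /=.
      have : z \in A i :&: Q by rewrite inE zA.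
      by rewrite E1 inE => ->.
    by have := subsetP AY _ zA; rewrite inE => /orP[]->; rewrite ?orbT.
  rewrite cards_eq0 => /eqP AQ0.
  rewrite -sum_nat_const; apply: leq_sum => e eQ; rewrite ifT.
    by rewrite leq_pexp2l //; apply: subset_leq_card; apply: setIS; exact: subsetUr.
  apply/subsetP => z zA; have := subsetP AY _ zA; rewrite !inE => /orP[->|->]; rewrite ?orbT //=.
  by move/setP: AQ0 => /(_ z); rewrite !inE zA /= => ->; rewrite orbT.
have tot : #|Q| * potential Y C <=
    \sum_(e in Q) (potential (Y :\: Q) (e |: C) + q.+1 ^ h * spoiled Q).
  rewrite big_split /= sum_nat_const /potential big_distrr /=.
  rewrite (eq_bigr (fun e => \sum_(i in J) (if A i \subset (e |: C) :|: (Y :\: Q) then q.+1 ^ #|A i :&: (e |: C)| else 0))); last first.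
    by move=> e _; rewrite big_mkcondr.
  have -> : #|Q| * (q.+1 ^ h * spoiled Q) = \sum_(i in J) #|Q| * (q.+1 ^ h * (1 < #|A i :&: Q|)).
    rewrite -!big_distrr /=; congr (_ * (_ * _)); rewrite /spoiled -sum1dep_card big_mkcondr.
    by apply: eq_bigr => i _; case: ifP.
  rewrite exchange_big -big_split /= big_mkcondr; apply: leq_sum => i iJ.
  by case: ifP => // AY; exact: key.
have [/existsP[e /andP[eQ He]]|/existsPn Hn] :=
  boolP [exists e, (e \in Q) && (potential Y C <= potential (Y :\: Q) (e |: C) + q.+1 ^ h * spoiled Q)].
  by exists e.
have : \sum_(e in Q) (potential (Y :\: Q) (e |: C) + q.+1 ^ h * spoiled Q).+1 <= \sum_(e in Q) potential Y C.
  by apply: leq_sum => e eQ; have := Hn e; rewrite eQ /= -ltnNge.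
rewrite sum_nat_const; under eq_bigr => e _ do rewrite -addn1.
rewrite big_split /= sum1_card => H1.
by have := leq_trans H1 tot; rewrite -{2}[\sum_(e in Q) _]addn0 leq_add2l leqNgt Q0.
Qed.

Definition codegree e f : nat := #|[set i in J | (e \in A i) && (f \in A i)]|.

Local Open Scope ring_scope.

(** Bounds [t] times the number of copies Waiter can still spoil. An edge shares its offer with at
    most [q] others, and a codegree d satisfies t d <= t^2 + d^2; the squares are summed over all
    pairs because the pairs offered together are Waiter's choice. The value of [t] is optimized
    later. *)
Definition budget Y : R :=
  \sum_(e in Y) (t ^+ 2 * q%:R * (e \in E')%:R + \sum_(f in Y | f != e) (codegree e f)%:R ^+ 2).

Lemma spoiled_le Q : (spoiled Q <= \sum_(e in Q) \sum_(f in Q | f != e) codegree e f)%N.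
Proof.
rewrite /spoiled -sum1_card.
under [leqRHS]eq_bigr => e eQ do under eq_bigr => f fQ do rewrite /codegree -sum1_card big_mkcond.
under [leqRHS]eq_bigr => e eQ do rewrite exchange_big.
rewrite exchange_big /= [leqLHS]big_mkcond; apply: leq_sum => i _.
case: ifP => //; rewrite inE => /andP[iJ /card_gt1P[e [f [/setIP[eA eQ] /setIP[fA fQ] ef]]]].
rewrite (bigD1 e) //= (bigD1 f) /=; last by rewrite fQ eq_sym.
by rewrite inE iJ eA fA.
Qed.

Lemma budget_step Y Q : Q \subset Y -> (#|Q| <= q.+1)%N ->
  t * (spoiled Q)%:R + budget (Y :\: Q) <= budget Y.
Proof.
move=> QY Qq.
have pos e f : 0 <= (codegree e f)%:R ^+ 2 :> R by rewrite exprn_ge0.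
have sub (Z1 Z2 : {set E}) e : Z1 \subset Z2 -> \sum_(f in Z1 | f != e) (codegree e f)%:R ^+ 2 <= \sum_(f in Z2 | f != e) (codegree e f)%:R ^+ 2 :> R.
  move=> ZZ; rewrite [leRHS](bigID (mem Z1)) /= -[leLHS]addr0; apply: lerD; last by apply: sumr_ge0.
  rewrite le_eqVlt; apply/orP; left; apply/eqP/eq_bigl => f.
  by case: (boolP (f \in Z1)) => [/(subsetP ZZ)->|]; rewrite ?andbF ?andbT.
rewrite {2}/budget (bigID (mem Q)) /=; apply: lerD; last first.
  rewrite {1}/budget [leLHS](eq_bigl (fun e => (e \in Y) && (e \notin Q))); last by move=> e; rewrite /= in_setD andbC.
  by apply: ler_sum => e _; rewrite lerD2l; apply: sub; exact: subsetDl.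
rewrite [leRHS](eq_bigl (fun e => e \in Q)) /=; last by move=> e /=; apply: andb_idl => /(subsetP QY).
apply: le_trans (_ : _ <= \sum_(e in Q) \sum_(f in Q | f != e) t * (codegree e f)%:R) _.
  apply: le_trans (_ : _ <= t * (\sum_(e in Q) \sum_(f in Q | f != e) codegree e f)%N%:R) _.
    by rewrite ler_wpM2l // ler_nat spoiled_le.
  rewrite natr_sum big_distrr /=; apply: ler_sum => e _; rewrite natr_sum big_distrr //.
apply: ler_sum => e eQ; have [eE|eE] := boolP (e \in E'); last first.
  rewrite big1 => [|f _]; first by rewrite mulr0 add0r sumr_ge0.
  rewrite /codegree (_ : [set i in J | _] = set0) ?cards0 ?mulr0 //; apply/setP => i; rewrite !inE.
  by apply/negP => /and3P[iJ eA _]; case/negP: eE; exact: (subsetP (AE' iJ)).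
apply: le_trans (_ : _ <= \sum_(f in Q | f != e) (t ^+ 2 + (codegree e f)%:R ^+ 2)) _.
  by apply: ler_sum => f _; nra.
rewrite big_split /=; apply: lerD; last exact: sub.
rewrite mulr1 sumr_const -[_ *+ _]mulr_natr ler_wpM2l ?exprn_ge0 // ler_nat -ltnS.
apply: leq_trans Qq; rewrite (cardD1 e Q) eQ add1n ltnS; apply: eq_leq.
by apply: eq_card => f; rewrite !inE andbC.
Qed.

(** The strict inequality is an invariant. On the empty board the budget is 0, so some copy is alive
    and therefore fully claimed. *)
Lemma potential_client_forces Y C : [disjoint C & Y] ->
  q.+1%:R ^+ h * budget Y < t * (potential Y C)%:R ->
  client_forces q (fun C' => exists2 i, i \in J & A i \subset C') Y C.
Proof.
move Ek : #|Y| => k; elim/ltn_ind: k Y C Ek => k IH Y C Ek dCY Hlt.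
apply: CF_turn => [Y0|Q QY Qq].
  have : (0 < potential Y C)%N.
    rewrite lt0n; apply: contraTneq Hlt => ->; rewrite mulr0 -leNgt.
    by rewrite mulr_ge0 ?exprn_ge0 // /budget Y0 big_set0.
  rewrite lt0n sum_nat_eq0 => /forallPn[i]; rewrite negb_imply => /andP[/andP[iJ Ai] _].
  by exists i => //; rewrite Y0 setU0 in Ai.
have [e [eQ He]] := potential_step QY Qq dCY; exists e; split=> //.
apply: (IH #|Y :\: Q|) => //.
- rewrite -Ek; apply: proper_card; apply/properP; split; first exact: subsetDl.
  by exists e; [exact: (subsetP QY)|rewrite inE eQ].
- rewrite disjoint_subset; apply/subsetP => z; rewrite !inE.
  by case/orP=> [/eqP->|/(disjointFr dCY)->]; rewrite ?eQ ?andbF.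
case/andP: Qq => _ Qq; have B := budget_step QY Qq.
have q0 : 0 <= q.+1%:R ^+ h :> R by rewrite exprn_ge0.
have : t * (potential Y C)%:R <= t * (potential (Y :\: Q) (e |: C))%:R + q.+1%:R ^+ h * (t * (spoiled Q)%:R).
  rewrite [_ * (t * _)]mulrCA -mulrDr ler_wpM2l // -natrX -natrM -natrD ler_nat //.
have := ler_wpM2l q0 B; rewrite mulrDr => B1 B2.
lra.
Qed.
End Potential.

(** * Random boards *)

Local Open Scope ring_scope.

Section RandomSubset.
Variables (R : realFieldType) (E : finType) (D : {set E}).
Implicit Types (p : R) (F S : {set E}) (phi psi : {set E} -> R).

Definition subset_weight p F : R := \prod_(e in D) (if e \in F then p else 1 - p).

Definition expect p phi : R := \sum_(F : {set E} | F \subset D) subset_weight p F * phi F.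

Lemma subset_weight_ge0 p F : 0 <= p <= 1 -> 0 <= subset_weight p F.
Proof.
by move=> /andP[p0 p1]; apply: prodr_ge0 => e _; case: ifP => // _; rewrite subr_ge0.
Qed.

Lemma expect_subset p S : S \subset D -> expect p (fun F => (S \subset F)%:R) = p ^+ #|S|.
Proof.
move=> SD.
(* Expanding the product of [A e + B e] enumerates the sets [F]; the factors are [p] on [S] and 1
   elsewhere. *)
pose A e : R := if e \in D then p else 0.
pose B e : R := if e \in D then (if e \in S then 0 else 1 - p) else 1.
transitivity (\prod_e (A e + B e)); last first.
  rewrite (bigID (mem S)) /= (eq_bigr (fun=> p)); last first.
    by move=> e eS; rewrite /A /B (subsetP SD _ eS) eS addr0.
  rewrite prodr_const big1 ?mulr1 // => e eS; rewrite /A /B (negPf eS).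
  by case: ifP => _; rewrite ?add0r // addrC subrK.
rewrite bigA_distr /expect big_mkcond; apply: eq_bigr => F _.
have [FD|/subsetPn[e eF eD]] := boolP (F \subset D); last first.
  by rewrite (bigD1 e) //= eF /A (negPf eD) mul0r.
have [SF|/subsetPn[e eS eF]] := boolP (S \subset F); last first.
  by rewrite mulr0 (bigD1 e) //= (negPf eF) /B (subsetP SD _ eS) eS mul0r.
rewrite mulr1 /subset_weight big_mkcond; apply: eq_bigr => e _; rewrite /A /B.
case: ifP => eD; case: ifP => eF //; last by rewrite (subsetP FD _ eF) in eD.
by case: ifP => // /(subsetP SF); rewrite eF.
Qed.

Lemma expect1 p : expect p (fun=> 1) = 1.
Proof.
have := expect_subset p (sub0set D); rewrite cards0 expr0 => {2}<-.
by apply: eq_bigr => F _; rewrite sub0set.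
Qed.

Lemma expect_le p phi psi : 0 <= p <= 1 ->
  (forall F, F \subset D -> phi F <= psi F) -> expect p phi <= expect p psi.
Proof.
move=> p01 le; apply: ler_sum => F FD; rewrite ler_wpM2l ?subset_weight_ge0 //; exact: le.
Qed.

Lemma expect_ge0 p phi : 0 <= p <= 1 ->
  (forall F, F \subset D -> 0 <= phi F) -> 0 <= expect p phi.
Proof. by move=> p01 le; apply: sumr_ge0 => F FD; rewrite mulr_ge0 ?subset_weight_ge0 ?le. Qed.

Lemma eq_expect p phi psi :
  (forall F, F \subset D -> phi F = psi F) -> expect p phi = expect p psi.
Proof. by move=> e; apply: eq_bigr => F FD; rewrite e. Qed.

Lemma expectD p phi psi : expect p (fun F => phi F + psi F) = expect p phi + expect p psi.
Proof. by rewrite /expect -big_split; apply: eq_bigr => F _; rewrite mulrDr. Qed.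

Lemma expectZ p c phi : expect p (fun F => c * phi F) = c * expect p phi.
Proof. by rewrite /expect big_distrr; apply: eq_bigr => F _; rewrite mulrCA. Qed.

Lemma expect_sum p (I : finType) (P : pred I) (phi : I -> {set E} -> R) :
  expect p (fun F => \sum_(i | P i) phi i F) = \sum_(i | P i) expect p (phi i).
Proof.
by rewrite /expect exchange_big; apply: eq_bigr => F _; rewrite big_distrr.
Qed.

Lemma expect_markov p (phi : {set E} -> R) (c : R) : 0 <= p <= 1 -> 0 < c ->
  (forall F, F \subset D -> 0 <= phi F) ->
  expect p (fun F => (c <= phi F)%R%:R) <= expect p phi / c.
Proof.
move=> p01 c0 ge; rewrite ler_pdivlMr // mulrC -expectZ; apply: expect_le => // F FD.
by case: (leP c (phi F)) => H; rewrite ?mulr1 // mulr0 ge.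
Qed.

(* Thinning: keeping every element of a [p']-random set with probability [p / p'] gives a [p]-random set. *)
Lemma expect_monotone p p' (A : pred {set E}) : 0 <= p <= p' -> p' <= 1 ->
  (forall F F', F \subset F' -> A F -> A F') ->
  expect p (fun F => (A F)%:R) <= expect p' (fun F => (A F)%:R).
Proof.
move=> /andP[p0 pp'] p'1 up.
have [p'0|p'n0] := eqVneq p' 0.
  by rewrite p'0 in pp' *; have -> : p = 0 by apply: le_anti; rewrite pp' p0.
have p'gt0 : 0 < p' by rewrite lt_def p'n0 (le_trans p0 pp').
have p'01 : 0 <= p' <= 1 by rewrite ltW.
pose r := p / p'.
have r01 : 0 <= r <= 1 by rewrite /r divr_ge0 ?(ltW p'gt0) // ler_pdivrMr // mul1r.
(* The probability that thinning [F'] gives [F]: [sumF'] identifies the resulting distribution,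
   [sumF] is total mass 1. *)
pose th F F' : R := \prod_(e in D) (if e \in F' then (if e \in F then r else 1 - r) else (e \notin F)%:R).
have th0 F F' : 0 <= th F F'.
  apply: prodr_ge0 => e _; case: ifP => _ //; case: ifP => _; first by case/andP: r01.
  by rewrite subr_ge0; case/andP: r01.
have thsub F F' : F \subset D -> ~~ (F \subset F') -> th F F' = 0.
  move=> FD /subsetPn[e eF eF']; rewrite /th (bigD1 e) ?(subsetP FD) //= (negPf eF') eF.
  by rewrite mul0r.
have sumF' F : F \subset D -> \sum_(F' : {set E} | F' \subset D) subset_weight p' F' * th F F' = subset_weight p F.
  move=> FD.
  pose a e : R := if e \in D then p' * (if e \in F then r else 1 - r) else 0.
  pose b e : R := if e \in D then (1 - p') * (e \notin F)%:R else 1.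
  transitivity (\prod_e (a e + b e)).
    rewrite bigA_distr big_mkcond; apply: eq_bigr => F' _.
    have [F'D|/subsetPn[e eF eD]] := boolP (F' \subset D); last first.
      by rewrite (bigD1 e) //= eF /a (negPf eD) mul0r.
    rewrite -big_split big_mkcond /=; apply: eq_bigr => e _; rewrite /a /b.
    case: ifP => eD; case: ifP => eF' //; by rewrite (subsetP F'D _ eF') in eD.
  rewrite /subset_weight [RHS]big_mkcond; apply: eq_bigr => e _; rewrite /a /b.
  case: ifP => eD; last by rewrite add0r.
  have pr : p' * r = p by rewrite /r mulrC divfK.
  case: ifP => eF; first by rewrite pr mulr0 addr0.
  by rewrite mulrBr pr !mulr1; ring.
have sumF F' : F' \subset D -> \sum_(F : {set E} | F \subset D) th F F' = 1.
  move=> F'D.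
  pose a e : R := if e \in D then (if e \in F' then r else 0) else 0.
  pose b e : R := if e \in D then (if e \in F' then 1 - r else 1) else 1.
  transitivity (\prod_e (a e + b e)).
    rewrite bigA_distr big_mkcond; apply: eq_bigr => F _.
    have [FD|/subsetPn[e eF eD]] := boolP (F \subset D); last first.
      by rewrite (bigD1 e) //= eF /a (negPf eD) mul0r.
    rewrite /th big_mkcond /=; apply: eq_bigr => e _; rewrite /a /b.
    case: (boolP (e \in D)) => eD; case: (boolP (e \in F)) => eF //=.
    by rewrite (subsetP FD _ eF) in eD.
  rewrite big1 // => e _; rewrite /a /b; case: ifP => _; last by rewrite add0r.
  by case: ifP => _; rewrite ?add0r // addrC subrK.
have -> : expect p (fun F => (A F)%:R) = \sum_(F' : {set E} | F' \subset D) subset_weight p' F' *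
    \sum_(F : {set E} | F \subset D) th F F' * (A F)%:R.
  rewrite /expect; under [RHS]eq_bigr => F' _ do rewrite big_distrr.
  rewrite exchange_big; apply: eq_bigr => F FD; rewrite -sumF' // big_distrl.
  by apply: eq_bigr => F' _; rewrite /= mulrA.
apply: ler_sum => F' F'D; rewrite ler_wpM2l ?subset_weight_ge0 //.
rewrite -[leRHS]mul1r -[X in _ <= X * _](sumF F' F'D) big_distrl; apply: ler_sum => F FD.
have [FF'|nFF'] := boolP (F \subset F'); last by rewrite thsub // /= !mul0r.
rewrite ler_wpM2l // ler_nat; case: (boolP (A F)) => //= AF.
by rewrite (up F F' FF' AF).
Qed.
End RandomSubset.

Definition all_pairs (W : finType) : {set {set W}} := [set e : {set W} | #|e| == 2%N].

Lemma graph_of_edges_wf (W : finType) (F : {set {set W}}) :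
  wf_graph ([set: W], F :&: all_pairs W).
Proof.
by apply/forallP => e; apply/implyP; rewrite !inE subsetT andbT => /andP[].
Qed.

Definition graph_of_edges (W : finType) (F : {set {set W}}) : graph W := Graph (graph_of_edges_wf F).

Lemma Gnp_prob_expect (R : realType) n (p : R) (A : graph 'I_n -> Prop) :
  Gnp_prob p A = expect (all_pairs 'I_n) p (fun F => `[< A (graph_of_edges F) >]%:R).
Proof.
rewrite /Gnp_prob /expect.
rewrite [RHS](eq_bigr (fun F : {set {set 'I_n}} => if `[< A (graph_of_edges F) >] then subset_weight (all_pairs 'I_n) p F else 0)); last first.
  by move=> F _; case: asbool; rewrite ?mulr1 ?mulr0.
rewrite -big_mkcondr (reindex_onto (fun F => graph_of_edges F) (@eset 'I_n)) /=; last first.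
  move=> G /andP[/eqP vG _]; apply: graph_eq; first by rewrite vG.
  by apply/setIidPl; apply/subsetP => e /edge_card2 c2; rewrite inE c2.
have pE F : (eset (graph_of_edges F) == F) = (F \subset all_pairs 'I_n).
  by rewrite /eset /=; apply/eqP/idP => [/setIidPl//|/setIidPl].
apply: eq_big => [F|F]; first by rewrite pE /vset /= eqxx /= andbC.
move=> /andP[_]; rewrite pE => FD; rewrite /Gnp_weight /subset_weight.
apply: eq_big => [e|e e2]; first by rewrite inE.
by rewrite /eset /= inE [e \in all_pairs _]inE e2 andbT.
Qed.

(** * Weighted sums over the copies in a complete graph *)

Section CountCopies.
Variables (R : realFieldType) (T : finType) (H : graph T) (n : nat).
Notation W := 'I_n.+1.
Let x : R := n.+1%:R^-1.
Implicit Types (A : {set {set W}}) (V : {set W}).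

(** Copies are replaced by maps because sums of products over maps factor over the vertices of
    [H]. *)
Lemma sum_copies_le (Q : pred {set {set W}}) (phi : {set {set W}} -> R) (psi : {ffun T -> W} -> R) :
  (forall f, 0 <= psi f) ->
  (forall A, is_copy H A -> Q A -> exists2 f : {ffun T -> W}, edge_image H f = A & phi A <= psi f) ->
  \sum_(A | is_copy H A && Q A) phi A <= \sum_f psi f.
Proof.
move=> psi0 HA.
rewrite [leRHS](partition_big (fun f : {ffun T -> W} => edge_image H f) predT) //=.
rewrite [leRHS](bigID (fun A => is_copy H A && Q A)) /= -[leLHS]addr0.
apply: lerD; last by apply: sumr_ge0 => A _; exact: sumr_ge0.
apply: ler_sum => A /andP[cA QA]; have [f fA le] := HA A cA QA.
by rewrite (bigD1 f) ?fA ?eqxx //= (le_trans le) // lerDl sumr_ge0.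
Qed.

(** Pinning the values off [vset H] makes those coordinates contribute a factor 1 instead of the
    number of vertices. *)
Definition fill (f : T -> W) : {ffun T -> W} :=
  [ffun t => if t \in vset H then f t else ord0].

Lemma edge_image_fill f : edge_image H (fill f) = edge_image H f.
Proof.
apply: eq_in_imset => e eH; apply: eq_in_imset => t te.
by rewrite ffunE (subsetP (edge_sub_vset eH)).
Qed.

Lemma x_ge0 : 0 <= x. Proof. by rewrite invr_ge0. Qed.

Lemma sum_x_le1 : \sum_(y : W) x = 1.
Proof. by rewrite sumr_const card_ord /x -[_ *+ _]mulr_natr mulVf ?pnatr_eq0. Qed.

Lemma sum_pred1 (z : W) : \sum_(y : W) (y == z)%:R = 1 :> R.
Proof.
rewrite (bigD1 z) //= eqxx big1 ?addr0 // => y yz.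
by rewrite (negPf yz).
Qed.

(** A vertex goes into [V] in [#|V|] ways of weight 1, or outside with total weight at most 1. *)
Lemma sum_copies_outside V : cover (eset H) = vset H ->
  \sum_(A | is_copy H A) x ^+ #|cover A :\: V| <= (#|V|.+1)%:R ^+ #|vset H|.
Proof.
move=> cH.
pose G t (y : W) : R := if t \in vset H then (if y \in V then 1 else x) else (y == ord0)%:R.
have G0 t y : 0 <= G t y.
  by rewrite /G; case: ifP => _; [case: ifP => _; rewrite ?x_ge0|rewrite ler0n].
apply: (@le_trans _ _ (\sum_(f : {ffun T -> W}) \prod_t G t (f t))).
  rewrite (eq_bigl (fun A => is_copy H A && predT A)); last by move=> A; rewrite andbT.
  apply: sum_copies_le => [f|A /is_copyP[f inj ->] _]; first exact: prodr_ge0.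
  exists (fill f); first exact: edge_image_fill.
  rewrite cover_edge_image cH.
  rewrite (bigID (mem (vset H))) /= [X in _ * X]big1 ?mulr1; last first.
    by move=> t tH; rewrite /G (negPf tH) ffunE (negPf tH) eqxx.
  rewrite (bigID (fun t => f t \in V)) /= big1 ?mul1r; last first.
    by move=> t /andP[tH tV]; rewrite /G tH ffunE tH tV.
  rewrite (eq_bigr (fun=> x)); last first.
    by move=> t /andP[tH tV]; rewrite /G tH ffunE tH (negPf tV).
  rewrite prodr_const (_ : #|_ :\: V| = #|[set t in vset H | f t \notin V]|).
    by rewrite (eq_card (B := [set t in vset H | f t \notin V])) // => t; rewrite !inE.
  rewrite -(card_in_imset (f := f) (D := mem [set t in vset H | f t \notin V])); last first.
    by move=> s t; rewrite !inE => /andP[sH _] /andP[tH _]; exact: inj.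
  apply: eq_card => y; rewrite inE; apply/andP/imsetP => [[yV /imsetP[t tH Ey]]|[t]].
    by exists t => //; rewrite inE tH -Ey.
  by rewrite inE => /andP[tH tV] ->; rewrite tV imset_f.
rewrite -(bigA_distr_bigA G) (bigID (mem (vset H))) /= [X in _ * X]big1 ?mulr1; last first.
  by move=> t tH; rewrite /G (negPf tH) sum_pred1.
rewrite -prodr_const; apply: ler_prod => t tH; rewrite sumr_ge0 //= /G tH.
rewrite (bigID (mem V)) /= -natr1; apply: lerD.
  rewrite (eq_bigr (fun=> 1)) ?sumr_const //; last by move=> y ->.
rewrite -sum_x_le1 [leRHS](bigID (mem V)) /= -[leLHS]add0r; apply: lerD.
  by apply: sumr_ge0 => y _; exact: x_ge0.
by apply: ler_sum => y /negPf->.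
Qed.

(** The ends of [e] are the images of some [s] and [t], at most [#|T| ^ 2] choices; each of the
    other [b] vertices sums to weight 1. *)
Lemma sum_copies_through (e : {set W}) (b : nat) : cover (eset H) = vset H ->
  #|vset H| = b.+2 ->
  \sum_(A | is_copy H A && (e \in A)) x ^+ b <= (#|T| ^ 2)%:R.
Proof.
move=> cH vb.
have [/cards2P[y1 [y2 [y12 Ee]]]|ne2] := boolP (#|e| == 2%N); last first.
  rewrite big_pred0 ?ler0n // => A; apply/negP => /andP[/is_copyP[f inj ->] eA].
  by case/negP: ne2; exact: (forall_inP (pairs_only_edge_image inj) _ eA).
pose G (st : T * T) u (y : W) : R := if u == st.1 then (y == y1)%:R else
  if u == st.2 then (y == y2)%:R else if u \in vset H then x else (y == ord0)%:R.
have G0 st t y : 0 <= G st t y.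
  by rewrite /G; do !case: ifP => _; rewrite ?ler0n ?x_ge0.
apply: (@le_trans _ _ (\sum_(f : {ffun T -> W}) \sum_(st : T * T) \prod_t G st t (f t))).
  apply: sum_copies_le => [f|A /is_copyP[f inj ->] eA].
    by apply: sumr_ge0 => st _; exact: prodr_ge0.
  exists (fill f); first exact: edge_image_fill.
  have [s [t [sH tH Es Et]]] : exists s t, [/\ s \in vset H, t \in vset H, f s = y1 & f t = y2].
    case/imsetP: eA => e' e'H Ee'.
    have : y1 \in f @: e' by rewrite -Ee' Ee !inE eqxx.
    have : y2 \in f @: e' by rewrite -Ee' Ee !inE eqxx orbT.
    case/imsetP=> t te' ->; case/imsetP=> s se' ->; exists s, t.
    by split=> //; exact: (subsetP (edge_sub_vset e'H)).
  have st : t != s by apply: contraNneq y12 => E; rewrite -Es -Et E.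
  rewrite (bigD1 (s, t)) //= -[leLHS]addr0; apply: lerD; last first.
    by apply: sumr_ge0 => ? _; exact: prodr_ge0.
  rewrite (bigD1 s) //= {1}/G /= eqxx ffunE sH Es eqxx mul1r.
  rewrite (bigD1 t) //= {1}/G /= (negPf st) eqxx ffunE tH Et eqxx mul1r.
  rewrite (bigID (mem (vset H))) /= [X in _ * X]big1 ?mulr1; last first.
    move=> u /andP[/andP[us ut] uH]; rewrite /G /= (negPf us) (negPf ut) (negPf uH).
    by rewrite ffunE (negPf uH) eqxx.
  rewrite (eq_bigr (fun=> x)); last first.
    by move=> u /andP[/andP[us ut] uH]; rewrite /G /= (negPf us) (negPf ut) uH.
  rewrite prodr_const (_ : #|_| = b) //.
  have : #|vset H :\ s :\ t| = b.
    have := cardsD1 s (vset H); have := cardsD1 t (vset H :\ s).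
    by rewrite sH vb !inE st tH /=; clear; lia.
  by move=> <-; apply: eq_card => u; rewrite !inE unfold_in /=; case: (u == s); case: (u == t); rewrite /= ?andbF ?andbT.
rewrite exchange_big /= (_ : (#|T| ^ 2)%:R = \sum_(st : T * T) 1 :> R); last first.
  by rewrite sumr_const card_prod mulnn.
apply: ler_sum => st _; rewrite -(bigA_distr_bigA (G st)).
rewrite [leRHS](_ : 1 = \prod_(t : T) 1 :> R); last by rewrite big1.
apply: ler_prod => t _; rewrite sumr_ge0 //= /G.
case: (t == st.1); first by rewrite sum_pred1.
case: (t == st.2); first by rewrite sum_pred1.
case: (t \in vset H); first by rewrite sum_x_le1.
by rewrite sum_pred1.
Qed.
End CountCopies.

(** Lets a factor [2 ^ #|cover U|] absorb the polynomially many copies attached to [U] in more than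
    one edge. *)
Lemma expn_le_exp2 (v s : nat) : (s ^ v <= v ^ v * 2 ^ s)%N.
Proof.
case: v => [|v]; first by rewrite !expn0 mul1n expn_gt0.
have H : (s <= v.+1 * 2 ^ (s %/ v.+1))%N.
  rewrite {1}(divn_eq s v.+1); have := ltn_pmod s (ltn0Sn v).
  have := ltn_expl (s %/ v.+1) (ltnSn 1); nia.
apply: leq_trans (_ : (v.+1 * 2 ^ (s %/ v.+1)) ^ v.+1 <= _)%N.
  by rewrite leq_exp2r.
rewrite expnMn leq_mul2l -expnM leq_exp2l //; apply/orP; right; exact: leq_trunc_div.
Qed.

Section StepIdentities.
Variable R : realFieldType.
Implicit Types (C P X Q y z u w k l : R).

Lemma regular_step_lhs C P X Q y z u w :
  C * y * (P * z) * (X * u) * (Q * w) = C * P * X * Q * (z * y * u) * w.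
Proof. by ring. Qed.

Lemma regular_step_rhs C P X Q y z u w :
  C * P * X * Q * (z * y * w * u) = C * P * X * Q * (z * y * u) * w.
Proof. by ring. Qed.

Lemma degenerate_step_lhs C P X y z u w :
  C * y * (P * z) * (X * u) * w = C * P * X * u * (z * y * w).
Proof. by ring. Qed.

Lemma degenerate_step_rhs C P X Q k l u w : l != 0 -> k != 0 ->
  C * P * X * (l * k * Q) * (w / l * (k^-1 * u)) = C * P * X * u * (Q * w).
Proof. by move=> l0 k0; field; rewrite l0 k0. Qed.

Lemma half_step C P X Q : C * P * X * Q = C * (2 * P) * X * Q / 2.
Proof. by field. Qed.

Lemma quarters X : X = X / 2 + X * (4^-1 + 4^-1).
Proof. by field. Qed.
End StepIdentities.

(** * Probability that some atom is dense *)

Section ExplorationProbability.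
Variables (R : realFieldType) (T : finType) (H : graph T) (a b n : nat).
Notation W := 'I_n.+1.
Let x : R := n.+1%:R^-1.
Hypotheses (sb : strictly_2_balanced H) (cH : cover (eset H) = vset H).
Hypotheses (ha : #|eset H| = a.+1) (vb : #|vset H| = b.+2) (b0 : (0 < b)%N) (ba : (b < a)%N).
Hypothesis mE : m2 H = a%:R / b%:R.
Variables (p c lam tau : R).
(** A single copy has room [2 * a + 1 - b], and room never grows along the exploration. *)
Let R0 := (2 * a + 1)%N.
Hypotheses (p01 : 0 <= p <= 1) (c0 : 0 < c) (c2 : 2 * c <= 1) (lam1 : 1 <= lam) (tau0 : 0 <= tau).
(** Attachments in one edge may use a quarter of the weight here, all others a quarter by [Hlam].
    The factor [2 ^+ (b * R0)] pays for [b] new vertices in the base [lam * 2 ^+ #|cover U|]. *)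
Hypothesis Hc : (2 * c) ^+ a * 2 ^+ (b * R0) * (#|T| ^ 2)%:R <= 4^-1.
Hypothesis Hlam : 2 ^+ (b.+2 * R0) * (2 * b.+2 ^ b.+2)%:R <= lam / 4.
Implicit Types (A U P F : {set {set W}}).

Definition overdense U : bool := (a * #|cover U| < b * #|U|)%N.

Hypothesis Hbad : forall U, U \subset all_pairs W -> overdense U ->
  p ^+ #|U| <= tau * (c ^+ #|U| * x ^+ #|cover U|).

(* The number of further degenerate attachments before [U] must be overdense, plus one. *)
Definition room U : nat := (a * #|cover U| + 1 - b * #|U|)%N.

(* A supermartingale along the exploration: dropping an edge of [P] saves a factor 2; a copy meeting [U] in
   one edge brings [b] vertices, whose factor [x ^+ b] pays for the choice of the copy; any other copy
   decreases [room], which saves a factor [lam]. *)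
Definition state_weight U P : R :=
  c ^+ #|U| * 2 ^+ #|P| * x ^+ #|cover U| * (lam * 2 ^+ #|cover U|) ^+ room U.

Let x0 : 0 <= x. Proof. exact: x_ge0. Qed.

Lemma base_ge1 k : 1 <= lam * 2 ^+ k.
Proof.
apply: le_trans lam1 _; rewrite ler_peMr ?(le_trans ler01 lam1) //.
by rewrite exprn_ege1 // ?ler1n.
Qed.

Lemma state_weight_ge0 U P : 0 <= state_weight U P.
Proof.
rewrite /state_weight !mulr_ge0 ?exprn_ge0 ?(ltW c0) ?ler0n //.
exact: le_trans ler01 (base_ge1 _).
Qed.

Lemma state_weight_ge U P : c ^+ #|U| * x ^+ #|cover U| <= state_weight U P.
Proof.
rewrite /state_weight [_ * 2 ^+ _ * _]mulrAC -[leRHS]mulrA.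
rewrite ler_peMr ?mulr_ge0 ?exprn_ge0 ?(ltW c0) //.
rewrite -[leLHS](mulr1 1); apply: ler_pM; rewrite ?ler01 //.
  by rewrite exprn_ege1 // ?ler1n.
by rewrite exprn_ege1 // base_ge1.
Qed.

Lemma step_degenerate_arith U A (i j : nat) : ~~ overdense U ->
  (b * j + 2 * a + 1 <= a * i + b)%N -> #|U :|: A| = (#|U| + (a.+1 - j))%N -> (j <= a.+1)%N -> (i <= b.+2)%N ->
  #|cover (U :|: A)| = (#|cover U| + (b.+2 - i))%N ->
  (room (U :|: A) <= (room U).-1)%N.
Proof.
rewrite /overdense /room -leqNgt => nb H1 -> H2 H3 ->.
move: #|U| #|cover U| nb => u cu' nb.
have [j' Ej] : exists j', (j + j' = a.+1)%N by exists (a.+1 - j)%N; lia.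
have [i' Ei] : exists i', (i + i' = b.+2)%N by exists (b.+2 - i)%N; lia.
have -> : (a.+1 - j = j')%N by lia.
have -> : (b.+2 - i = i')%N by lia.
have : (a * i' + 1 <= b * j')%N by nia.
rewrite !mulnDr; lia.
Qed.

Lemma card_unionE (E : finType) (X Y : {set E}) m : #|Y| = m ->
  #|X :|: Y| = (#|X| + (m - #|Y :&: X|))%N.
Proof. by move=> <-; rewrite cardsU setIC; have := subset_leq_card (subsetIl Y X); clear; lia. Qed.

(** A loss of room saves a factor [lam * 2 ^+ #|cover U|]; its power of 2 is kept explicit, since it
    has to pay for the number of such copies. *)
Lemma step_copy U P A e : U \subset all_pairs W -> P \subset U -> ~~ overdense U ->
  (room U <= R0)%N -> is_copy H A -> e \in A -> e \in U -> ~~ (A \subset U) ->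
  [/\ (room (U :|: A) <= room U)%N &
   state_weight (U :|: A) (P :|: (A :\: U)) <= state_weight U P *
     ((2 * c) ^+ a * 2 ^+ (b * R0) * x ^+ b +
      2 ^+ (b.+2 * R0) / lam * (2 ^- #|cover U| * x ^+ #|cover A :\: cover U|))].
Proof.
move=> UD PU nb rR cA eA eU nAU.
have AU0 : A :&: U != set0 by apply/set0Pn; exists e; rewrite inE eA.
have cU := card_unionE U (card_copy ha cA).
have cV := card_unionE (cover U) (card_cover_copy cH vb cA).
rewrite -cover_setU in cV.
have jA : (#|A :&: U| <= a.+1)%N by rewrite -(card_copy ha cA); apply/subset_leq_card/subsetIl.
have iA : (#|cover A :&: cover U| <= b.+2)%N.
  by rewrite -(card_cover_copy cH vb cA); apply/subset_leq_card/subsetIl.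
have cP : #|P :|: (A :\: U)| = (#|P| + (a.+1 - #|A :&: U|))%N.
  rewrite cardsU (_ : P :&: _ = set0) ?cards0 ?subn0 ?cardsD ?(card_copy ha cA) //.
  by apply/setP => z; rewrite !inE; case: (boolP (z \in P)) => // /(subsetP PU)->.
have cD : #|cover A :\: cover U| = (b.+2 - #|cover A :&: cover U|)%N.
  by rewrite cardsD (card_cover_copy cH vb cA).
have lam0 : 0 < lam by exact: lt_le_trans ltr01 lam1.
have w0 := state_weight_ge0 U P.
have two0 k : 0 < 2 ^+ k :> R by rewrite exprn_gt0 // ltr0n.
have [[j1 i2]|deg] := copy_intersection sb cH ha vb b0 mE cA AU0 nAU.
  have rE : room (U :|: A) = room U.
    rewrite /room cU cV j1 i2 !subSS !subn0; move: #|U| #|cover U| => u cu.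
    rewrite !mulnDr [(a * b)%N]mulnC; clear; lia.
  rewrite rE; split=> //.
  rewrite mulrDr -[leLHS]addr0; apply: lerD; last first.
    by apply: (mulr_ge0 w0); rewrite !mulr_ge0 ?exprn_ge0 ?invr_ge0 ?(ltW lam0) ?(ltW (two0 _)) ?ler0n.
  rewrite /state_weight rE cU cV cP j1 i2 !subSS !subn0 !exprD.
  set Cu := c ^+ #|U|; set Pu := 2 ^+ #|P|; set Xu := x ^+ #|cover U|; set L := 2 ^+ #|cover U|.
  rewrite [(lam * (L * _)) ^+ _](_ : _ = (lam * L) ^+ room U * 2 ^+ (b * room U)); last first.
    by rewrite mulrA [LHS]exprMn -exprM.
  have le1 : (2 : R) ^+ (b * room U) <= 2 ^+ (b * R0).
    by rewrite ler_eXn2l ?ltr1n // leq_mul2l rR orbT.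
  set Q := (lam * L) ^+ _.
  rewrite regular_step_lhs [(2 * c) ^+ a]exprMn regular_step_rhs.
  apply: ler_wpM2l => //; apply: mulr_ge0; last by rewrite !mulr_ge0 ?exprn_ge0 ?ler0n ?(ltW c0).
  rewrite /Cu /Pu /Xu !mulr_ge0 ?exprn_ge0 ?ler0n ?(ltW c0) //; exact: le_trans ler01 (base_ge1 _).
have rr := step_degenerate_arith nb deg cU jA iA cV.
have rle : (room (U :|: A) <= room U)%N by apply: leq_trans rr (leq_pred _).
have r1 : (0 < room U)%N by move: nb; rewrite /overdense /room -leqNgt; clear; lia.
split=> //.
rewrite mulrDr -[leLHS]add0r; apply: lerD.
  by apply: (mulr_ge0 w0); rewrite !mulr_ge0 ?exprn_ge0 ?mulr_ge0 ?ler0n ?(ltW c0).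
rewrite /state_weight cD cU cP cV -[room U]prednK //.
set k := (a.+1 - _)%N; set nu := (b.+2 - _)%N.
rewrite [c ^+ (_ + _)]exprD [2 ^+ (#|P| + _)]exprD [x ^+ (_ + _)]exprD [2 ^+ (#|cover U| + _)]exprD.
rewrite [_ ^+ _.-1.+1]exprS.
set Cu := c ^+ #|U|; set Pu := 2 ^+ #|P|; set Xu := x ^+ #|cover U|; set L := 2 ^+ #|cover U|.
have L0 : 0 < L by exact: two0.
set r' := room (U :|: A); set r := (room U).-1.
rewrite degenerate_step_rhs ?(lt0r_neq0 lam0) ?(lt0r_neq0 L0) // degenerate_step_lhs -exprMn.
apply: ler_wpM2l; first by rewrite /Cu /Pu /Xu !mulr_ge0 ?exprn_ge0 ?ler0n ?(ltW c0).
rewrite -[leRHS]mul1r; apply: ler_pM.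
- by rewrite exprn_ge0 // mulr_ge0 // ltW.
- by rewrite exprn_ge0 // !mulr_ge0 ?(ltW lam0) ?(ltW L0) // ltW.
- by rewrite exprn_ile1 ?mulr_ge0 ?ler0n // ltW.
rewrite mulrA exprMn -exprM; apply: ler_pM.
- by rewrite exprn_ge0 // mulr_ge0 ?(ltW lam0) ?(ltW L0).
- by rewrite ltW.
- by apply: ler_weXn2l => //; exact: base_ge1.
rewrite ler_eXn2l ?ltr1n //; apply: leq_mul; first exact: leq_subr.
exact: leq_trans rle rR.
Qed.

(** Half of the weight goes to dropping [e], a quarter to each kind of attachment. *)
Lemma step_weight U P e : U \subset all_pairs W -> P \subset U -> ~~ overdense U ->
  (room U <= R0)%N -> e \in P ->
  state_weight U (P :\ e) + \sum_(A | [&& is_copy H A, e \in A & ~~ (A \subset U)])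
     state_weight (U :|: A) (P :|: (A :\: U)) <= state_weight U P.
Proof.
move=> UD PU nb rR eP.
have lam0 : 0 < lam by exact: lt_le_trans ltr01 lam1.
have two0 k : 0 < 2 ^+ k :> R by rewrite exprn_gt0 // ltr0n.
have w0 := state_weight_ge0 U P.
have half : state_weight U (P :\ e) = state_weight U P / 2.
  by rewrite /state_weight [in RHS](cardsD1 e P) eP add1n exprS half_step.
set t1 := (2 * c) ^+ a * 2 ^+ (b * R0).
set t2 := 2 ^+ (b.+2 * R0) / lam.
have t1ge : 0 <= t1 by rewrite mulr_ge0 ?exprn_ge0 ?mulr_ge0 ?ler0n ?(ltW c0).
have t2ge : 0 <= t2 by rewrite divr_ge0 ?(ltW lam0) ?exprn_ge0 ?ler0n.
have S1 : t1 * \sum_(A | is_copy H A && (e \in A)) x ^+ b <= 4^-1.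
  apply: le_trans Hc; apply: ler_wpM2l => //; exact: sum_copies_through.
(* All copies are counted, through [e] or not; the sum is polynomial in [#|cover U|]. *)
have S2 : t2 * (2 ^- #|cover U| * \sum_(A | is_copy H A) x ^+ #|cover A :\: cover U|) <= 4^-1.
  have le1 := sum_copies_outside R (cover U) cH; rewrite vb in le1.
  have le2 : (#|cover U|.+1%:R ^+ b.+2 : R) <= (2 * b.+2 ^ b.+2)%:R * 2 ^+ #|cover U|.
    rewrite -!natrX -natrM ler_nat; apply: leq_trans (expn_le_exp2 _ _) _.
    by rewrite [(2 ^ #|cover U|.+1)%N]expnS mulnCA mulnA.
  have : 2 ^- #|cover U| * \sum_(A | is_copy H A) x ^+ #|cover A :\: cover U| <= (2 * b.+2 ^ b.+2)%:R.
    by rewrite mulrC ler_pdivrMr ?two0 //; exact: le_trans le1 le2.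
  move/(ler_wpM2l t2ge)/le_trans; apply.
  by rewrite /t2 mulrAC ler_pdivrMr // [leRHS]mulrC.
rewrite half [leRHS]quarters lerD2l.
apply: le_trans (_ : _ <= state_weight U P * (t1 * (\sum_(A | is_copy H A && (e \in A)) x ^+ b) +
   t2 * (2 ^- #|cover U| * \sum_(A | is_copy H A) x ^+ #|cover A :\: cover U|))) _; last first.
  by rewrite ler_wpM2l // lerD.
apply: le_trans (_ : _ <= \sum_(A | is_copy H A && (e \in A)) state_weight U P *
     (t1 * x ^+ b + t2 * (2 ^- #|cover U| * x ^+ #|cover A :\: cover U|))) _.
  rewrite [leRHS](bigID (fun A => A \subset U)) /= -[leLHS]add0r; apply: lerD.
    apply: sumr_ge0 => A _; apply: (mulr_ge0 w0); apply: addr_ge0.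
      by apply: mulr_ge0 => //; exact: exprn_ge0.
    apply: mulr_ge0 => //; apply: mulr_ge0; last exact: exprn_ge0.
    by rewrite invr_ge0 ltW.
  rewrite (eq_bigl (fun A => is_copy H A && (e \in A) && ~~ (A \subset U))); last by move=> A; rewrite andbA.
  apply: ler_sum => A /andP[/andP[cA eA] nA].
  by have [] := step_copy UD PU nb rR cA eA (subsetP PU _ eP) nA.
rewrite -big_distrr /= ler_wpM2l // big_split /= -!big_distrr /= lerD2l.
rewrite ler_wpM2l // ler_wpM2l ?invr_ge0 ?(ltW (two0 _)) //.
rewrite [leRHS](bigID (fun A => e \in A)) /= lerDl; apply: sumr_ge0 => A _; exact: exprn_ge0.
Qed.

(** A union bound over histories. At an overdense [U] the search stops, and [Hbad] bounds the chance
    that [U] is present. *)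
Lemma explore_bad_prob l U P : U \subset all_pairs W -> P \subset U -> (room U <= R0)%N ->
  expect (all_pairs W) p (fun F => ((U \subset F) && explore_bad (is_copy H) overdense l U P F)%:R)
    <= tau * state_weight U P.
Proof.
elim: l U P => [|l IH] U P UD PU rR.
  have [bU|nbU] := boolP (overdense U); last first.
    rewrite (@eq_expect R _ (all_pairs W) p _ (fun=> 0)); last by move=> F _; rewrite /= (negPf nbU) andbF.
    rewrite /expect big1; first by rewrite mulr_ge0 // state_weight_ge0.
    by move=> F _; rewrite mulr0.
  rewrite (@eq_expect R _ (all_pairs W) p _ (fun F => (U \subset F)%:R)); last by move=> F _; rewrite /= bU andbT.
  by rewrite expect_subset //; apply: le_trans (Hbad UD bU) _; rewrite ler_wpM2l // state_weight_ge.
have [bU|nbU] := boolP (overdense U).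
  rewrite (@eq_expect R _ (all_pairs W) p _ (fun F => (U \subset F)%:R)); last by move=> F _; rewrite /= bU andbT.
  by rewrite expect_subset //; apply: le_trans (Hbad UD bU) _; rewrite ler_wpM2l // state_weight_ge.
case Ep: [pick e in P] => [e|]; last first.
  rewrite (@eq_expect R _ (all_pairs W) p _ (fun=> 0)); last by move=> F _; rewrite /= (negPf nbU) Ep andbF.
  rewrite /expect big1; first by rewrite mulr_ge0 // state_weight_ge0.
  by move=> F _; rewrite mulr0.
have eP : e \in P by move: Ep; case: pickP => // z zP [<-].
pose ind U' P' F : R := ((U' \subset F) && explore_bad (is_copy H) overdense l U' P' F)%:R.
apply: le_trans (_ : _ <= expect (all_pairs W) p (fun F => ind U (P :\ e) F +
   \sum_(A | [&& is_copy H A, e \in A & ~~ (A \subset U)]) ind (U :|: A) (P :|: (A :\: U)) F)) _.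
  apply: expect_le => // F FD; rewrite /= (negPf nbU) Ep /=.
  have s0 : 0 <= \sum_(A | [&& is_copy H A, e \in A & ~~ (A \subset U)]) ind (U :|: A) (P :|: (A :\: U)) F.
    by apply: sumr_ge0 => A _; rewrite ler0n.
  rewrite {1}/ind; case: (boolP (U \subset F)) => UF /=; last by rewrite add0r.
  case: (boolP (explore_bad _ _ l U (P :\ e) F)) => /= _; first by rewrite lerDl.
  rewrite add0r; case: (boolP [exists A, _]) => [/existsP[A /and5P[cA AF eA nAU ex]]|_] //.
  rewrite (bigD1 A) /=; last by rewrite cA eA nAU.
  by rewrite {1}/ind subUset UF AF ex lerDl; apply: sumr_ge0 => B _; rewrite ler0n.
rewrite expectD expect_sum; apply: le_trans (_ : _ <= tau * state_weight U (P :\ e) +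
   \sum_(A | [&& is_copy H A, e \in A & ~~ (A \subset U)]) tau * state_weight (U :|: A) (P :|: (A :\: U))) _.
  apply: lerD; first by apply: IH => //; apply: subset_trans PU; exact: subsetDl.
  apply: ler_sum => A /and3P[cA eA nAU].
  have [rA _] := step_copy UD PU nbU rR cA eA (subsetP PU _ eP) nAU.
  apply: IH; last exact: leq_trans rA rR.
    rewrite subUset UD /=; apply/subsetP => f fA; rewrite inE.
    exact: (forall_inP (pairs_only_copy cA) _ fA).
  by rewrite subUset (subset_trans PU (subsetUl _ _)) /= setDE subIset // subsetUr.
rewrite -big_distrr -mulrDr ler_wpM2l //; exact: step_weight.
Qed.

Lemma dense_atom_prob :
  expect (all_pairs W) p (fun F => [exists A0, [&& is_copy H A0, A0 \subset F &
      explore_bad (is_copy H) overdense (2 * #|~: A0| + #|A0|) A0 A0 F]]%:R)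
  <= tau * (lam * 2 ^+ b.+2) ^+ R0.
Proof.
have lam0 : 0 < lam by exact: lt_le_trans ltr01 lam1.
pose ind A F : R := ((A \subset F) && explore_bad (is_copy H) overdense (2 * #|~: A| + #|A|) A A F)%:R.
apply: le_trans (_ : _ <= expect (all_pairs W) p (fun F => \sum_(A | is_copy H A) ind A F)) _.
  apply: expect_le => // F FD; case: (boolP [exists A0, _]) => [/existsP[A /and3P[cA AF ex]]|_].
    rewrite (bigD1 A) //= {1}/ind AF ex lerDl; apply: sumr_ge0 => B _; exact: ler0n.
  by apply: sumr_ge0 => B _; exact: ler0n.
(* A starting copy weighs at most a constant times [x ^+ b.+2], which cancels the number of
   copies. *)
rewrite expect_sum; apply: le_trans (_ : _ <= \sum_(A | is_copy H A) tau * (x ^+ #|cover A :\: set0| * (lam * 2 ^+ b.+2) ^+ R0)) _.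
  apply: ler_sum => A cA.
  have AD : A \subset all_pairs W.
    by apply/subsetP => f fA; rewrite inE; exact: (forall_inP (pairs_only_copy cA) _ fA).
  have rA : (room A <= R0)%N.
    rewrite /room (card_copy ha cA) (card_cover_copy cH vb cA) /R0; clear; nia.
  apply: le_trans (explore_bad_prob _ AD (subxx _) rA) _.
  rewrite ler_wpM2l // /state_weight setD0 (card_copy ha cA) (card_cover_copy cH vb cA).
  rewrite -exprMn -[c * 2]mulrC -mulrA -[leRHS]mul1r; apply: ler_pM.
  - by rewrite exprn_ge0 // mulr_ge0 ?ler0n // ltW.
  - by rewrite mulr_ge0 ?exprn_ge0 // (le_trans ler01) // base_ge1.
  - by rewrite exprn_ile1 ?mulr_ge0 ?ler0n // ltW.
  rewrite ler_wpM2l ?exprn_ge0 //; apply: ler_weXn2l => //; exact: base_ge1.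
rewrite -big_distrr -big_distrl /= ler_wpM2l // -[leRHS]mul1r ler_wpM2r //.
  by rewrite exprn_ge0 // (le_trans ler01) // base_ge1.
by apply: le_trans (sum_copies_outside R set0 cH) _; rewrite cards0 expr1n.
Qed.
End ExplorationProbability.

(** * Second moments and deletion *)

Section Moments.
Variables (R : realFieldType) (E : finType) (D : {set E}) (p : R).
Variables (I : finType) (P : pred I) (S : I -> {set E}).
Hypotheses (p01 : 0 <= p <= 1) (SD : forall i, P i -> S i \subset D).
Implicit Types (F Z : {set E}).

Definition count_in F : R := \sum_(i | P i) (S i \subset F)%:R.

Definition mean_count : R := \sum_(i | P i) p ^+ #|S i|.

Lemma expect_count_in : expect D p count_in = mean_count.
Proof. by rewrite /count_in expect_sum; apply: eq_bigr => i Pi; rewrite expect_subset ?SD. Qed.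

(** Disjoint members are independent and cancel against the square of the mean. *)
Lemma second_moment :
  expect D p (fun F => (count_in F - mean_count) ^+ 2) <=
  \sum_(i | P i) \sum_(j | P j && (S i :&: S j != set0)) p ^+ #|S i :|: S j|.
Proof.
have p0 : 0 <= p by case/andP: p01.
have sq : expect D p (fun F => count_in F ^+ 2) = \sum_(i | P i) \sum_(j | P j) p ^+ #|S i :|: S j|.
  rewrite (@eq_expect R _ D p _ (fun F => \sum_(i | P i) \sum_(j | P j) (S i :|: S j \subset F)%:R)).
    rewrite expect_sum; apply: eq_bigr => i Pi; rewrite expect_sum; apply: eq_bigr => j Pj.
    by rewrite expect_subset // subUset !SD.
  move=> F _; rewrite expr2 /count_in big_distrl; apply: eq_bigr => i _.
  by rewrite big_distrr; apply: eq_bigr => j _; rewrite /= subUset; case: (S i \subset F); case: (S j \subset F); rewrite /= ?mulr1 ?mul0r ?mulr0.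
have -> : expect D p (fun F => (count_in F - mean_count) ^+ 2) =
    expect D p (fun F => count_in F ^+ 2) - mean_count ^+ 2.
  rewrite (@eq_expect R _ D p _ (fun F => (count_in F ^+ 2 + (- 2 * mean_count) * count_in F) + mean_count ^+ 2 * 1)).
    by rewrite expectD expectD !expectZ expect_count_in expect1; ring.
  by move=> F _; ring.
rewrite sq lerBlDr.
have -> : mean_count ^+ 2 = \sum_(i | P i) \sum_(j | P j) p ^+ (#|S i| + #|S j|).
  rewrite expr2 {1}/mean_count big_distrl; apply: eq_bigr => i _.
  by rewrite big_distrr; apply: eq_bigr => j _; rewrite /= exprD.
rewrite -big_split; apply: ler_sum => i Pi /=.
rewrite (bigID (fun j => S i :&: S j != set0)) /= lerD2l.
rewrite [leRHS](bigID (fun j => S i :&: S j != set0)) /= -[leLHS]add0r; apply: lerD.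
  by apply: sumr_ge0 => j _; exact: exprn_ge0.
by apply: ler_sum => j /andP[_]; rewrite negbK => /eqP d; rewrite cardsU d cards0 subn0.
Qed.

Lemma chebyshev_count (c : R) : 0 < c ->
  expect D p (fun F => (c <= `|count_in F - mean_count|)%R%:R) <=
  (\sum_(i | P i) \sum_(j | P j && (S i :&: S j != set0)) p ^+ #|S i :|: S j|) / c ^+ 2.
Proof.
move=> c0; have c20 : 0 < c ^+ 2 by rewrite exprn_gt0.
rewrite ler_pdivlMr //; apply: le_trans second_moment; rewrite -ler_pdivlMr //.
apply: le_trans (expect_markov p01 c20 (phi := fun F => (count_in F - mean_count) ^+ 2) _); last first.
  by move=> F _; exact: sqr_ge0.
apply: expect_le => // F _; rewrite ler_nat /=; case: (boolP (c <= _)) => // cF.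
have -> // : c ^+ 2 <= (count_in F - mean_count) ^+ 2.
by rewrite -[leRHS]real_normK ?num_real // ler_sqr ?nnegrE ?(ltW c0).
Qed.

Section Deletion.
Variables (mu : R) (s : nat).
Hypotheses (mu0 : 0 < mu) (mean_le : mean_count <= mu) (Ss : forall i, P i -> (#|S i| <= s)%N).

(* If no small [Z] destroys enough members of the family, a greedy choice yields many [z]-tuples of
   disjoint members; their expected number is small. *)
Fixpoint disjoint_tuples (z : nat) F Z : R :=
  if z is z'.+1 then
    \sum_(i | P i && ((S i \subset F) && [disjoint S i & Z])) disjoint_tuples z' F (Z :|: S i)
  else 1.

Lemma disjoint_tuples_ge0 z F Z : 0 <= disjoint_tuples z F Z.
Proof. by elim: z Z => [|z IH] Z //=; apply: sumr_ge0. Qed.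

Lemma expect_disjoint_tuples z Z : Z \subset D ->
  expect D p (fun F => (Z \subset F)%:R * disjoint_tuples z F Z) <= p ^+ #|Z| * mu ^+ z.
Proof.
have p0 : 0 <= p by case/andP: p01.
elim: z Z => [|z IH] Z ZD /=.
  rewrite (@eq_expect R _ D p _ (fun F => (Z \subset F)%:R)) ?expect_subset ?expr0 ?mulr1 //.
  by move=> F _; rewrite mulr1.
rewrite (@eq_expect R _ D p _ (fun F => \sum_(i | P i && [disjoint S i & Z])
    ((Z :|: S i \subset F)%:R * disjoint_tuples z F (Z :|: S i)))); last first.
  move=> F _; rewrite big_distrr big_mkcond [RHS]big_mkcond /=; apply: eq_bigr => i _.
  rewrite subUset; case: (P i) => //=; case: [disjoint S i & Z]; rewrite ?andbF // andbT.
  by case: (S i \subset F); rewrite ?andbF ?andbT // !mul0r.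
rewrite expect_sum; apply: le_trans (_ : _ <= \sum_(i | P i && [disjoint S i & Z]) p ^+ #|Z| * mu ^+ z * p ^+ #|S i|) _.
  apply: ler_sum => i /andP[Pi d]; apply: le_trans (IH _ _) _; first by rewrite subUset ZD SD.
  have -> : #|Z :|: S i| = (#|Z| + #|S i|)%N.
    have /eqP d0 : Z :&: S i == set0 by rewrite setIC setI_eq0.
    by rewrite cardsU d0 cards0 subn0.
  by rewrite exprD mulrAC.
rewrite -big_distrr /= exprSr mulrA; apply: ler_wpM2l.
  by rewrite mulr_ge0 ?exprn_ge0 // ltW.
apply: le_trans mean_le; rewrite /mean_count [leRHS](bigID (fun i => [disjoint S i & Z])) /= lerDl.
by apply: sumr_ge0 => i _; exact: exprn_ge0.
Qed.

Lemma disjoint_tuples_ge z F Z k : (#|Z| + s * z <= k)%N ->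
  (forall Z', (#|Z'| <= k)%N -> 2 * mu <= count_in (F :\: Z')) ->
  (2 * mu) ^+ z <= disjoint_tuples z F Z.
Proof.
move=> + H; elim: z Z => [|z IH] Z le //=.
rewrite exprS.
apply: le_trans (_ : _ <= \sum_(i | P i && ((S i \subset F) && [disjoint S i & Z])) (2 * mu) ^+ z) _; last first.
  apply: ler_sum => i /andP[Pi _]; apply: IH.
  have := Ss Pi; have : (#|Z :|: S i| <= #|Z| + #|S i|)%N by rewrite cardsU leq_subr.
  by move: le; rewrite mulnS; clear; lia.
rewrite sumr_const -[X in _ <= X]mulr_natl ler_wpM2r ?exprn_ge0 ?mulr_ge0 ?(ltW mu0) //.
have leZ : (#|Z| <= k)%N by apply: leq_trans le; exact: leq_addr.
apply: le_trans (H Z leZ) _; rewrite /count_in -natr_sum ler_nat -sum1_card big_mkcond [leqRHS]big_mkcond.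
apply: leq_sum => i _; rewrite unfold_in; case: (P i) => //=; rewrite subsetD.
by case: (S i \subset F) => //=; case: [disjoint S i & Z].
Qed.

(** The deletion method of Roedl and Rucinski: disjoint members are independent, so the expected
    number of tuples is at most [mu ^+ z], while the event forces [(2 * mu) ^+ z] of them. *)
Lemma deletion_prob z :
  expect D p (fun F => [forall Z : {set E}, (#|Z| <= s * z)%N ==> (2 * mu <= count_in (F :\: Z))%R]%:R)
    <= 2^-1 ^+ z.
Proof.
have m20 : 0 < (2 * mu) ^+ z by rewrite exprn_gt0 // mulr_gt0.
have := expect_disjoint_tuples z (sub0set D); rewrite cards0 expr0 mul1r => H.
have -> : 2^-1 ^+ z = mu ^+ z / (2 * mu) ^+ z.
  rewrite exprMn invfM mulrCA divff ?mulr1 ?exprVn // expf_neq0 // lt0r_neq0 //.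
rewrite ler_pdivlMr //; apply: le_trans H; rewrite mulrC -expectZ.
apply: expect_le => // F _; rewrite sub0set mul1r.
case: (boolP [forall Z, _]) => [/forallP HF|_]; last by rewrite mulr0 disjoint_tuples_ge0.
rewrite mulr1; apply: (@disjoint_tuples_ge z F set0 (s * z)); first by rewrite cards0.
by move=> Z' le; have := HF Z'; rewrite le.
Qed.
End Deletion.
End Moments.

(** * Pairs of embeddings with common edges *)

Section Overlaps.
Variables (R : realFieldType) (T : finType) (H : graph T) (n : nat).
Notation W := 'I_n.+1.
Notation nn := (n.+1%:R : R).
Notation v := #|T|.
Notation h := #|eset H|.
Implicit Types (f g : {ffun T -> W}) (D : {set {set T}}) (F : {set {set W}}).

(** Choose the preimage [S] of [U], map it into [U], and map the rest freely. *)
Lemma sum_injections_covering (U : {set W}) : (#|U| <= v)%N ->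
  \sum_(g : {ffun T -> W} | injectiveb g && (U \subset g @: [set: T])) 1 <= (2 ^ v * v ^ v)%:R * nn ^+ (v - #|U|).
Proof.
move=> Uv.
pose G (S : {set T}) y (w : W) : R := if y \in S then (w \in U)%:R else 1.
have G0 S y w : 0 <= G S y w by rewrite /G; case: ifP.
apply: (@le_trans _ _ (\sum_(g : {ffun T -> W}) \sum_(S : {set T} | #|S| == #|U|) \prod_y G S y (g y))).
  rewrite big_mkcond; apply: ler_sum => g _; case: ifP => [/andP[/injectiveP inj Ug]|_]; last first.
    by apply: sumr_ge0 => S _; exact: prodr_ge0.
  pose S := [set y | g y \in U].
  have SU : #|S| == #|U|.
    rewrite -(card_imset _ inj); apply/eqP/eq_card => w; apply/imsetP/idP => [[y]|wU].
      by rewrite inE => yU ->.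
    have /imsetP[y _ Ew] := subsetP Ug _ wU; exists y => //; by rewrite inE -Ew.
  rewrite (bigD1 S) //= big1 => [|y _].
    by rewrite lerDl; apply: sumr_ge0 => ? _; exact: prodr_ge0.
  by rewrite /G; case: ifP => //; rewrite inE => ->.
rewrite exchange_big /=.
apply: (@le_trans _ _ (\sum_(S : {set T} | #|S| == #|U|) (v ^ v)%:R * nn ^+ (v - #|U|))); last first.
  rewrite sumr_const -[X in X <= _]mulr_natl natrM -mulrA ler_wpM2r ?mulr_ge0 ?exprn_ge0 //.
  rewrite ler_nat -cardsT -card_powerset; apply: subset_leq_card.
  by apply/subsetP => S _; rewrite inE subsetT.
apply: ler_sum => S /eqP SU; rewrite -(bigA_distr_bigA (G S)) (bigID (mem S)) /=.
apply: ler_pM; [by apply: prodr_ge0 => y _; exact: sumr_ge0|by apply: prodr_ge0 => y _; exact: sumr_ge0| |].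
  rewrite (eq_bigr (fun=> #|U|%:R)) => [|y yS]; last first.
    rewrite /G yS -sum1_card natr_sum [RHS]big_mkcond; apply: eq_bigr => w _; by case: (w \in U).
  rewrite prodr_const SU -natrX ler_nat; apply: (@leq_trans (v ^ #|U|)).
    by case: #|U| Uv => // k kv; rewrite leq_exp2r.
  by case: (posnP v) Uv => [->|v0] Uv; [move: Uv; rewrite leqn0 => /eqP->|rewrite leq_pexp2l].
rewrite (eq_bigr (fun=> nn)) => [|y yS]; last by rewrite /G (negPf yS) sumr_const card_ord.
rewrite prodr_const -SU -[X in (X - _)%N](cardC (mem S)) /= addKn.
by rewrite le_eqVlt; apply/orP; left; apply/eqP; congr (_ ^+ _); apply: eq_card => y; rewrite !inE.
Qed.

Variables (p C : R).
Hypotheses (p0 : 0 < p) (C1 : 1 <= C).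
(** The form in which the maximal 2-density enters at p = C t: each edge of [D] after the first
    gains a factor [C]. *)
Hypothesis key : forall D, D \subset eset H -> D != set0 ->
  C ^+ (#|D|.-1) * (nn ^+ 2 * p) <= nn ^+ #|cover D| * p ^+ #|D|.

Definition overlap_constant : R := (2 ^ h * (2 ^ v * v ^ v))%:R.

(** Sort the pairs by the set [D] of edges that [f] maps into the image of [g]: then [g] hits all of
    [f @: cover D], the union has [2 * h - #|D|] edges, and [key] applies to [D]. *)
Lemma overlap_sum k : (0 < k)%N ->
  \sum_(f : {ffun T -> W} | injectiveb f) \sum_(g : {ffun T -> W} | injectiveb g && (k <= #|edge_image H f :&: edge_image H g|)%N)
     p ^+ #|edge_image H f :|: edge_image H g|
  <= overlap_constant * (nn ^+ v * p ^+ h) ^+ 2 / (C ^+ k.-1 * (nn ^+ 2 * p)).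
Proof.
move=> k0.
have nn0 : 0 < nn by rewrite ltr0n.
have C0 : 0 < C by exact: lt_le_trans ltr01 C1.
have N0 : 0 < nn ^+ 2 * p by rewrite mulr_gt0 // exprn_gt0.
have CN0 : 0 < C ^+ k.-1 * (nn ^+ 2 * p) by rewrite mulr_gt0 // exprn_gt0.
apply: (@le_trans _ _ (\sum_(f : {ffun T -> W} | injectiveb f)
    overlap_constant * (nn ^+ v * p ^+ (2 * h)) / (C ^+ k.-1 * (nn ^+ 2 * p)))); last first.
  rewrite sumr_const -[X in X <= _]mulr_natl.
  have -> : overlap_constant * (nn ^+ v * p ^+ h) ^+ 2 / (C ^+ k.-1 * (nn ^+ 2 * p)) =
    nn ^+ v * (overlap_constant * (nn ^+ v * p ^+ (2 * h)) / (C ^+ k.-1 * (nn ^+ 2 * p))).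
    rewrite exprMn -[p ^+ h ^+ 2]exprM [(h * 2)%N]mulnC expr2.
    have E (o y z i : R) : o * (y * y * z) * i = y * (o * (y * z) * i) by ring.
    by rewrite E.
  rewrite ler_wpM2r //.
    by rewrite divr_ge0 ?(ltW CN0) // mulr_ge0 ?ler0n // mulr_ge0 // exprn_ge0 // ltW.
  rewrite -natrX ler_nat -[X in (_ <= X ^ _)%N](card_ord n.+1) -card_ffun; exact: max_card.
apply: ler_sum => f /injectiveP finj.
have fin (V : {set T}) : {in V &, injective f} by move=> x y _ _; exact: finj.
pose Dg g := [set e in eset H | f @: (e : {set T}) \in edge_image H g].
have cDg g : #|edge_image H f :&: edge_image H g| = #|Dg g|.
  rewrite -(card_in_imset (f := fun e : {set T} => f @: e) (D := mem (Dg g))).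
    apply: eq_card => B; rewrite inE; apply/andP/imsetP => [[/imsetP[e eH ->] Bg]|[e]].
      by exists e; rewrite // inE eH.
    by rewrite inE => /andP[eH eg] ->; rewrite imset_f.
  by move=> e1 e2 _ _; exact: imset_inj.
rewrite (partition_big Dg (fun D => (D \subset eset H) && (k <= #|D|)%N)) /=; last first.
  move=> g /andP[_ kg]; rewrite -cDg kg andbT; apply/subsetP => e; rewrite inE => /andP[] //.
apply: (@le_trans _ _ (\sum_(D : {set {set T}} | (D \subset eset H) && (k <= #|D|)%N)
   (2 ^ v * v ^ v)%:R * (nn ^+ v * p ^+ (2 * h)) / (C ^+ k.-1 * (nn ^+ 2 * p)))); last first.
  have -> : overlap_constant = (2 ^ h)%:R * (2 ^ v * v ^ v)%:R by rewrite -natrM.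
  rewrite sumr_const -[X in X <= _]mulr_natl -!mulrA; apply: ler_wpM2r.
    rewrite !mulr_ge0 ?ler0n ?exprn_ge0 ?(ltW p0) ?invr_ge0 //.
    by rewrite !mulr_ge0 ?ler0n ?exprn_ge0 ?(ltW p0) ?(ltW C0).
  rewrite ler_nat -card_powerset; apply: subset_leq_card; apply/subsetP => D.
  by rewrite unfold_in inE => /andP[].
apply: ler_sum => D /andP[DH kD].
have D0 : D != set0 by rewrite -card_gt0; exact: leq_trans kD.
have cov : (#|f @: cover D| <= v)%N by apply: leq_trans (leq_imset_card _ _) (max_card _).
apply: (@le_trans _ _ (\sum_(g : {ffun T -> W} | injectiveb g && (f @: cover D \subset g @: [set: T]))
    p ^+ (2 * h - #|D|))).
  rewrite big_mkcond [leRHS]big_mkcond; apply: ler_sum => g _.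
  case: ifP => [/andP[/andP[gi kg] /eqP Eg]|_]; last by case: ifP => _ //; rewrite exprn_ge0 // ltW.
  rewrite gi ifT /=.
    rewrite cardsU cDg Eg !card_edge_image ?addnn ?mul2n //.
    by move=> x y _ _; apply/injectiveP.
  apply/subsetP => w /imsetP[x /bigcupP[e eD xe] ->].
  move: eD; rewrite -Eg inE => /andP[eH /imsetP[e' e'H Ee]].
  have : f x \in f @: e by exact: imset_f.
  by rewrite Ee => /imsetP[y ye ->]; rewrite imset_f // inE.
rewrite (eq_bigr (fun=> 1 * p ^+ (2 * h - #|D|))) => [|g _]; last by rewrite mul1r.
rewrite -big_distrl /=.
apply: le_trans (ler_wpM2r _ (sum_injections_covering cov)) _; first by rewrite exprn_ge0 // ltW.
rewrite -[leLHS]mulrA -[leRHS]mulrA ler_wpM2l ?ler0n // ler_pdivlMr //.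
have Dh : (#|D| <= 2 * h)%N.
  by apply: leq_trans (subset_leq_card DH) _; rewrite mul2n -addnn leq_addr.
rewrite [#|f @: _|](card_in_imset (fin _)) in cov *.
have -> : nn ^+ v * p ^+ (2 * h) = nn ^+ (v - #|cover D|) * p ^+ (2 * h - #|D|) * (nn ^+ #|cover D| * p ^+ #|D|).
  by rewrite mulrACA -!exprD !subnK.
rewrite ler_wpM2l ?mulr_ge0 ?exprn_ge0 // ?(ltW p0) //.
apply: le_trans (key DH D0); rewrite ler_wpM2r ?(ltW N0) //.
apply: ler_weXn2l => //; by move: kD; case: k k0 {CN0} => // k _; case: #|D|.
Qed.
End Overlaps.

Lemma expn_le_ffact m v : (2 * v <= m)%N -> (m ^ v <= 2 ^ v * m ^_ v)%N.
Proof.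
elim: v => [|v IH] le; first by rewrite !expn0 ffactn0.
have {}IH : (m ^ v <= 2 ^ v * m ^_ v)%N by apply: IH; lia.
rewrite ffactnSr !expnSr; have : (m <= 2 * (m - v))%N by lia.
by move/(leq_mul IH)/leq_trans; apply; rewrite mulnACA.
Qed.

(** * Boards rich in copies *)

Section Rich.
Variables (R : realFieldType) (T : finType) (H : graph T) (n q : nat).
Notation W := 'I_n.+1.
Notation nn := (n.+1%:R : R).
Notation v := #|T|.
Notation h := #|eset H|.
Notation img := (fun f : {ffun T -> W} => edge_image H f).
Implicit Types (f g : {ffun T -> W}) (F : {set {set W}}).

(** Injective on all of [T], so the expected number is of order [nn ^+ v * p ^+ h]. *)
Definition embeddings F : {set {ffun T -> W}} := [set f : {ffun T -> W} | injectiveb f & img f \subset F].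

Definition overlapping_pairs F : {set {ffun T -> W} * {ffun T -> W}} :=
  [set fg : {ffun T -> W} * {ffun T -> W} | [&& injectiveb fg.1, injectiveb fg.2, (1 < #|img fg.1 :&: img fg.2|)%N &
             img fg.1 :|: img fg.2 \subset F]].

(** The starting inequality of the potential strategy, with the budget expressed by counts. Copies
    need only lie in [F'] while the game is played on all of [F]; hence the property passes to
    larger boards. *)
Definition client_rich F : Prop := exists (F' : {set {set W}}) (t : R),
  [/\ F' \subset F, 0 < t &
   q.+1%:R ^+ h * (t ^+ 2 * q%:R * #|F'|%:R + (h ^ 2)%:R * #|overlapping_pairs F'|%:R) <
   t * #|embeddings F'|%:R].

Lemma card_img f : injectiveb f -> #|img f| = h.
Proof. by move/injectiveP => inj; apply: card_edge_image => x y _ _; exact: inj. Qed.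

(** A squared codegree counts pairs of embeddings using both edges; each pair arises from at most
    [h ^ 2] choices of the two edges. *)
Lemma codegree_square_sum F (X : {set {set W}}) :
  (\sum_(e in X) \sum_(e' in X | e' != e) codegree img (embeddings F) e e' ^ 2 <=
   h ^ 2 * #|overlapping_pairs F|)%N.
Proof.
pose through e e' (fg : {ffun T -> W} * {ffun T -> W}) :=
  [&& fg.1 \in embeddings F, fg.2 \in embeddings F, e \in img fg.1 :&: img fg.2 & e' \in img fg.1 :&: img fg.2].
have sq e e' : (codegree img (embeddings F) e e' ^ 2 = \sum_fg through e e' fg)%N.
  rewrite /codegree expnS expn1 -cardsX -sum1_card big_mkcond; apply: eq_bigr => -[f g] _.
  rewrite in_setX /through /= !in_set; case: (injectiveb f) => //=; case: (injectiveb g); rewrite ?andbF //=.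
  case: (img f \subset F); rewrite ?andbF //=; case: (img g \subset F); rewrite ?andbF //=.
  by case: (e \in img f); case: (e \in img g); case: (e' \in img f); case: (e' \in img g).
under eq_bigr => e _ do under eq_bigr => e' _ do rewrite sq.
under eq_bigr => e _ do rewrite exchange_big.
rewrite exchange_big /= mulnC -sum_nat_const [leqRHS]big_mkcond; apply: leq_sum => -[f g] _.
case: ifP => [|nover].
  rewrite inE /= => /and4P[fi gi _ _].
  apply: (@leq_trans (\sum_(e in img f) \sum_(e' in img f) 1)); last first.
    by rewrite sum_nat_const sum1_card card_img // expnS expn1.
  rewrite big_mkcond [leqRHS]big_mkcond; apply: leq_sum => e _.
  rewrite big_mkcond [X in (_ <= if _ then X else _)%N]big_mkcond.
  case: ifP => eX //; rewrite /through !inE /=; case: (e \in img f); last first.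
    by rewrite leqn0 sum_nat_eq0; apply/forallP => e'; rewrite /= ?andbF; case: ifP.
  apply: leq_sum => e' _; case: ifP => // _; rewrite !inE; case: (e' \in img f); last by rewrite !andbF.
  by case: (_ && _).
rewrite leqn0 sum_nat_eq0; apply/forallP => e; apply/implyP => eX.
rewrite sum_nat_eq0; apply/forallP => e'; apply/implyP => /andP[e'X e'e].
rewrite eqb0 /through /=; apply: contraFN nover => /and4P[].
rewrite !in_set => /andP[fi fF] /andP[gi gF] /andP[ef eg] /andP[e'f e'g] /=.
rewrite fi gi subUset fF gF /= andbT; apply/card_gt1P; exists e, e'.
by rewrite !inE ef eg e'f e'g eq_sym.
Qed.

Lemma client_rich_wins (G : graph W) : vset G = [set: W] -> client_rich (eset G) ->
  client_wins_CW G H q.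
Proof.
move=> vG [F' [t [F'G t0 Ht]]].
apply: (client_wins_imp (w1 := fun C => exists2 f, f \in embeddings F' & img f \subset C)).
  move=> C [f]; rewrite inE => /andP[/injectiveP inj fF'] fC.
  apply/contains_copyP; first by rewrite -vG.
  exists (img f); first by apply/is_copyP; exists f => // x y _ _; exact: inj.
  by rewrite subsetI (subset_trans fF' F'G) fC.
apply: (client_forces_wins (set0 : {set W})).
apply: (potential_client_forces (R := R) (h := h) (E' := F') (t := t)) => //.
- by move=> f; rewrite inE => /andP[fi _]; rewrite card_img.
- by move=> f; rewrite inE => /andP[].
- exact: ltW.
- by rewrite -setI_eq0 set0I.
have -> : potential img (embeddings F') q (eset G) set0 = #|embeddings F'|.
  rewrite /potential -sum1_card (eq_bigl (fun f => f \in embeddings F')).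
    by apply: eq_bigr => f _; rewrite setI0 cards0.
  move=> f /=; apply: andb_idr; rewrite inE => /andP[_ fF'].
  by rewrite set0U (subset_trans fF' F'G).
apply: le_lt_trans Ht; rewrite ler_wpM2l ?exprn_ge0 // /budget big_split /=; apply: lerD.
  rewrite -big_distrr /= ler_wpM2l ?mulr_ge0 ?exprn_ge0 ?(ltW t0) //.
  rewrite -natr_sum ler_nat -sum1_card big_mkcond [leqRHS]big_mkcond.
  by apply: leq_sum => e _; case: (e \in eset G); case: (e \in F').
rewrite -natrM; apply: le_trans (_ : _ <= (\sum_(e in eset G) \sum_(e' in eset G | e' != e)
  codegree img (embeddings F') e e' ^ 2)%N%:R) _; last by rewrite ler_nat codegree_square_sum.
rewrite natr_sum; apply: ler_sum => e _; rewrite natr_sum; apply: ler_sum => e' _.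
by rewrite natrX.
Qed.

Lemma client_rich_up F F' : F \subset F' -> client_rich F -> client_rich F'.
Proof.
move=> FF' [F0 [t [sub t0 Ht]]]; exists F0, t; split=> //; exact: subset_trans sub FF'.
Qed.

Variables (p C : R) (z : nat).
Hypotheses (p0 : 0 < p) (p1 : p <= 1) (C1 : 1 <= C) (q0 : (0 < q)%N).
Hypothesis key : forall D : {set {set T}}, D \subset eset H -> D != set0 ->
  C ^+ (#|D|.-1) * (nn ^+ 2 * p) <= nn ^+ #|cover D| * p ^+ #|D|.
Hypothesis vn : (2 * v <= n.+1)%N.

Notation c1 := (overlap_constant R H).
Let K : R := q.+1%:R ^+ h.
(** The mean number of embeddings is at least [4 * alpha * M]; half of it survives fluctuations, and
    deleting [2 * h * z] edges, each in at most [eps * M] embeddings, costs another [alpha * M]. *)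
Let alpha : R := 2^-1 ^+ v / 4.
Let eps : R := alpha / (2 * h * z).+1%:R.
Let N : R := nn ^+ 2 * p.
Let M : R := nn ^+ v * p ^+ h.
Hypothesis HC : 8 * K ^+ 2 * q%:R * (h ^ 2)%:R * c1 < C * alpha ^+ 2.

Lemma rich_numeric (m y e : R) : 0 < N -> 0 < M -> alpha * M <= m -> e <= N ->
  y <= 2 * (c1 * M ^+ 2 / (C * N)) ->
  exists t : R, 0 < t /\ K * (t ^+ 2 * q%:R * e + (h ^ 2)%:R * y) < t * m.
Proof.
move=> N0 M0 Hm He Hy.
have a0 : 0 < alpha by rewrite divr_gt0 ?exprn_gt0 ?invr_gt0 ?ltr0n.
have K0 : 0 < K by rewrite exprn_gt0 // ltr0n.
have qr0 : 0 < q%:R :> R by rewrite ltr0n.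
have C0 : 0 < C by exact: lt_le_trans ltr01 C1.
have hr0 : 0 <= (h ^ 2)%:R :> R by rewrite ler0n.
have c10 : 0 <= c1 by rewrite ler0n.
move: HC hr0; move: (h ^ 2)%:R c1 c10 (q%:R : R) qr0 Hy => hh cc cc0 qq qr0 Hy HC' hr0.
(* Minimizes [K * t ^+ 2 * q * N - t * alpha * M]; that the minimum outweighs the overlapping pairs
   is [HC]. *)
exists (alpha / (2 * K * qq) * (M / N)).
set eta := alpha / (2 * K * qq).
have eta0 : 0 < eta by rewrite divr_gt0 // !mulr_gt0.
have MN0 : 0 < M / N by rewrite divr_gt0.
split; first by rewrite mulr_gt0.
apply: (@le_lt_trans _ _ (K * ((eta * (M / N)) ^+ 2 * qq * N + hh * (2 * (cc * M ^+ 2 / (C * N)))))).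
  rewrite ler_wpM2l ?(ltW K0) //; apply: lerD; last by rewrite ler_wpM2l.
  by rewrite ler_wpM2l // mulr_ge0 ?(ltW qr0) // exprn_ge0 // mulr_ge0 ?ltW.
apply: (@lt_le_trans _ _ (eta * (M / N) * (alpha * M))); last first.
  by rewrite ler_wpM2l // mulr_ge0 ?ltW.
have M2N : 0 < M ^+ 2 / N by rewrite divr_gt0 ?exprn_gt0.
have -> : K * ((eta * (M / N)) ^+ 2 * qq * N + hh * (2 * (cc * M ^+ 2 / (C * N)))) =
   (M ^+ 2 / N) * (K * (eta ^+ 2 * qq + 2 * hh * cc / C)).
  by field; rewrite !lt0r_neq0.
have -> : eta * (M / N) * (alpha * M) = (M ^+ 2 / N) * (eta * alpha).
  by field; rewrite !lt0r_neq0.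
rewrite ltr_pM2l //.
have -> : eta * alpha = alpha ^+ 2 / (2 * K * qq) by rewrite /eta; field; rewrite !lt0r_neq0.
have -> : K * (eta ^+ 2 * qq + 2 * hh * cc / C) = alpha ^+ 2 / (4 * K * qq) + 2 * K * hh * cc / C.
  by rewrite /eta; field; rewrite !lt0r_neq0.
have -> : alpha ^+ 2 / (2 * K * qq) = alpha ^+ 2 / (4 * K * qq) + alpha ^+ 2 / (4 * K * qq).
  by field; rewrite !lt0r_neq0.
rewrite ltrD2l ltr_pdivrMr // [X in _ < X]mulrAC ltr_pdivlMr ?mulr_gt0 //.
have -> : 2 * K * hh * cc * (4 * K * qq) = 8 * K ^+ 2 * qq * hh * cc by ring.
by rewrite [alpha ^+ 2 * C]mulrC.
Qed.

Let D := all_pairs W.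
Let P1 f := injectiveb f.
Let over (k : nat) (fg : {ffun T -> W} * {ffun T -> W}) :=
  [&& injectiveb fg.1, injectiveb fg.2 & (k <= #|img fg.1 :&: img fg.2|)%N].
Let S2 (fg : {ffun T -> W} * {ffun T -> W}) := img fg.1 :|: img fg.2.
Let X1 F : R := count_in R P1 img F.
Let Y F : R := count_in R (over 2) S2 F.
Let V F : R := count_in R (over 1) S2 F.
Let mean := mean_count p P1 img.
Let edges F : R := count_in R (mem D) (fun e => [set e]) F.
Let emean := mean_count p (mem D) (fun e : {set W} => [set e]).
Let mu := c1 * M ^+ 2 / (C * N).

Let nn0 : 0 < nn. Proof. by rewrite ltr0n. Qed.
Let C0 : 0 < C. Proof. exact: lt_le_trans ltr01 C1. Qed.
Let N0 : 0 < N. Proof. by rewrite mulr_gt0 // exprn_gt0. Qed.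
Let M0 : 0 < M. Proof. by rewrite mulr_gt0 // exprn_gt0. Qed.
Let c10 : 0 < c1. Proof.
rewrite ltr0n !muln_gt0 !expn_gt0 /=; by case: #|T|.
Qed.
Let p01 : 0 <= p <= 1. Proof. by rewrite ltW. Qed.
Let alpha0 : 0 < alpha. Proof. by rewrite divr_gt0 ?exprn_gt0 ?invr_gt0 ?ltr0n. Qed.
Let eps0 : 0 < eps. Proof. by rewrite divr_gt0 // ltr0n. Qed.
Let mu0 : 0 < mu. Proof. by rewrite divr_gt0 // mulr_gt0 // exprn_gt0. Qed.

Let imgD f : injectiveb f -> img f \subset D.
Proof.
move/injectiveP => inj; apply/subsetP => e eI; rewrite inE.
by apply: (forall_inP (pairs_only_edge_image _) _ eI) => x y _ _; exact: inj.
Qed.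

Let overD k fg : over k fg -> S2 fg \subset D.
Proof. by move=> /and3P[f1 f2 _]; rewrite subUset !imgD. Qed.

Lemma mean_ge : 2^-1 ^+ v * M <= mean.
Proof.
rewrite /mean /mean_count (eq_bigr (fun=> p ^+ h)) => [|f fi]; last by rewrite card_img.
rewrite sumr_const -[X in _ <= X]mulr_natl /M mulrA ler_wpM2r ?exprn_ge0 ?(ltW p0) //.
have -> : #|(fun i => P1 i)| = (n.+1 ^_ v)%N.
  by rewrite -[in RHS](card_ord n.+1) -card_inj_ffuns; apply: eq_card => f; rewrite !inE.
rewrite exprVn mulrC ler_pdivrMr ?exprn_gt0 ?ltr0n // mulrC -!natrX -natrM ler_nat.
exact: expn_le_ffact.
Qed.

Lemma over_mean k : (0 < k)%N -> mean_count p (over k) S2 <= c1 * M ^+ 2 / (C ^+ k.-1 * N).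
Proof.
move=> k0; apply: le_trans (overlap_sum p0 C1 key k0).
rewrite /mean_count pair_big_dep /= le_eqVlt; apply/orP; left; apply/eqP.
by apply: eq_bigl => fg; rewrite /over.
Qed.

Lemma emean_le : emean <= N / 2.
Proof.
rewrite /emean /mean_count (eq_bigr (fun=> p)) => [|e _]; last by rewrite cards1 expr1.
rewrite sumr_const -[X in X <= _]mulr_natl /N mulrAC ler_wpM2r ?(ltW p0) //.
rewrite ler_pdivlMr ?ltr0n // -natrX -natrM ler_nat.
rewrite (_ : #|(fun i => mem D i)| = 'C(n.+1, 2)); last first.
  rewrite -[in RHS](card_ord n.+1) -cardsT -cards_draws; apply: eq_card => e.
  by rewrite !inE subsetT.
rewrite bin2 muln2 /=; apply: (@leq_trans (n.+1 * n)%N).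
  by rewrite -[leqRHS]odd_double_half leq_addl.
by rewrite -mulnn leq_mul2l leqnSn orbT.
Qed.

Lemma typical_rich F : F \subset D ->
  `|X1 F - mean| < mean / 2 -> `|edges F - emean| < N / 2 -> V F < (eps * M) ^+ 2 ->
  (exists2 Z : {set {set W}}, (#|Z| <= 2 * h * z)%N & Y (F :\: Z) < 2 * mu) ->
  client_rich F.
Proof.
move=> FD HX He HV [Z Zz HY].
have HX' : mean / 2 < X1 F by move: HX; rewrite ltr_distl => /andP[+ _]; lra.
have eF : edges F = #|F|%:R.
  rewrite /edges /count_in -natr_sum -sum1_card; congr _%:R; rewrite big_mkcond [RHS]big_mkcond.
  by apply: eq_bigr => e _; rewrite sub1set /=; case: (boolP (e \in F)) => [/(subsetP FD)->|_]; rewrite ?if_same.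
have FN : #|F|%:R <= N.
  by rewrite -eF; move: He emean_le; rewrite ltr_distl => /andP[_]; lra.
pose F' := F :\: Z.
(* The square of the degree of [e] counts pairs of embeddings sharing [e], so the bound on [V]
   controls all degrees. *)
have deg e : \sum_(f | P1 f) ((e \in img f) && (img f \subset F))%:R <= eps * M.
  rewrite -ler_sqr ?nnegrE ?(ltW (mulr_gt0 _ _)) //; last by apply: sumr_ge0 => f _; exact: ler0n.
  apply: le_trans (ltW HV); rewrite expr2 big_distrl /=.
  under eq_bigr => f _ do rewrite big_distrr /=.
  rewrite pair_big /= /V /count_in big_mkcond [leRHS]big_mkcond; apply: ler_sum => -[f g] _ /=.
  rewrite /over /P1 /S2 /=; case: (injectiveb f) => //=; case: (injectiveb g) => //=.
  rewrite subUset; case: (boolP (e \in img f)) => ef /=; last by rewrite mul0r; case: ifP.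
  case: (boolP (e \in img g)) => eg /=; last by rewrite mulr0; case: ifP.
  rewrite ifT; last by apply/card_gt0P; exists e; rewrite inE ef eg.
  by case: (_ \subset F); case: (_ \subset F); rewrite /= ?mulr1 ?mulr0 ?mul0r.
have XF' : X1 F <= #|embeddings F'|%:R + #|Z|%:R * (eps * M).
  apply: (@le_trans _ _ (\sum_(f | P1 f) ((img f \subset F')%:R +
      \sum_(e in Z) ((e \in img f) && (img f \subset F))%:R))).
    apply: ler_sum => f _; rewrite /F' subsetD.
    case: (boolP (img f \subset F)) => fF /=; last by rewrite add0r sumr_ge0.
    case: (boolP [disjoint img f & Z]) => [_|]; first by rewrite lerDl sumr_ge0.
    rewrite -setI_eq0 => /set0Pn[e /setIP[ef eZ]].
    by rewrite add0r (bigD1 e) //= ef lerDl sumr_ge0.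
  rewrite big_split /=; apply: lerD.
    rewrite -natr_sum ler_nat -sum1_card big_mkcond [leqRHS]big_mkcond; apply: leq_sum => f _.
    by rewrite /embeddings inE /P1; case: (injectiveb f); case: (img f \subset F').
  rewrite exchange_big /= mulr_natl -sumr_const; apply: ler_sum => e _; exact: deg.
have ZM : #|Z|%:R * (eps * M) <= alpha * M.
  rewrite mulrA ler_wpM2r ?(ltW M0) // /eps mulrCA ler_piMr ?(ltW alpha0) //.
  by rewrite ler_pdivrMr ?ltr0n // mul1r ler_nat leqW.
have HE : alpha * M <= #|embeddings F'|%:R.
  have m4 : 4 * alpha = 2^-1 ^+ v by rewrite /alpha mulrC divfK // pnatr_eq0.
  have := mean_ge; rewrite -m4 -mulrA; move: XF' ZM HX'; move: (alpha * M) (#|Z|%:R * _).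
  by move=> am zm; lra.
have [t [t0 Ht]] : exists t : R, 0 < t /\
    K * (t ^+ 2 * q%:R * #|F'|%:R + (h ^ 2)%:R * #|overlapping_pairs F'|%:R) < t * #|embeddings F'|%:R.
  apply: rich_numeric => //.
    by apply: le_trans FN; rewrite ler_nat subset_leq_card // subsetDl.
  apply: le_trans (ltW HY); rewrite /Y /count_in -natr_sum ler_nat -sum1_card big_mkcond [leqRHS]big_mkcond.
  apply: leq_sum => -[f g] _; rewrite inE /over /S2 /=.
  by case: (injectiveb f) => //; case: (injectiveb g) => //; case: (1 < _)%N => //=; case: (_ \subset _).
by exists F', t; split=> //; exact: subsetDl.
Qed.

(** Three failures have probability of order 1 / [N]: Chebyshev for embeddings and for edges, Markov
    for [V]. Pairs sharing two edges must be compared with a multiple of their own mean bound, so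
    they are left to deletion. *)
Lemma rich_prob :
  1 - ((4 * 2 ^+ v ^+ 2 * c1 + 2 + c1 / eps ^+ 2) / N + 2^-1 ^+ z) <=
  expect D p (fun F => `[< client_rich F >]%:R).
Proof.
have mean0 : 0 < mean.
  by apply: lt_le_trans mean_ge; rewrite mulr_gt0 // exprn_gt0 // invr_gt0 ltr0n.
have half0 : 0 < mean / 2 by rewrite divr_gt0 // ltr0n.
have N20 : 0 < N / 2 by rewrite divr_gt0 // ltr0n.
have eM0 : 0 < (eps * M) ^+ 2 by rewrite exprn_gt0 // mulr_gt0.
have b1 : expect D p (fun F => (mean / 2 <= `|X1 F - mean|)%R%:R) <= 4 * 2 ^+ v ^+ 2 * c1 / N.
  apply: le_trans (chebyshev_count p01 imgD half0) _.
  have H1 : \sum_(i | P1 i) \sum_(j | P1 j && (img i :&: img j != set0)) p ^+ #|img i :|: img j| <= c1 * M ^+ 2 / N.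
    have := overlap_sum p0 C1 key (ltn0Sn 0); rewrite expr0 mul1r; apply: le_trans.
    apply: ler_sum => f _; rewrite le_eqVlt; apply/orP; left; apply/eqP; apply: eq_bigl => g.
    by rewrite card_gt0.
  rewrite ler_pdivrMr ?exprn_gt0 //; apply: le_trans H1 _.
  have H2 : (2^-1 ^+ v * M) ^+ 2 <= mean ^+ 2.
    by rewrite ler_sqr ?nnegrE ?mean_ge ?(ltW mean0) // mulr_ge0 ?(ltW M0) // exprn_ge0 // invr_ge0 ler0n.
  have tv : (2 : R) ^+ v != 0 by rewrite expf_neq0 // pnatr_eq0.
  have E : c1 * M ^+ 2 / N = 4 * 2 ^+ v ^+ 2 * c1 / N * ((2^-1 ^+ v * M) ^+ 2 / 4).
    have E (u m w cc : R) : u != 0 -> m != 0 -> cc * w ^+ 2 / m = 4 * u ^+ 2 * cc / m * ((u^-1 * w) ^+ 2 / 4).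
      by move=> u0 m0; field; rewrite u0 m0.
    by rewrite exprVn; apply: E; rewrite ?(lt0r_neq0 N0).
  rewrite E ler_wpM2l //.
    by rewrite divr_ge0 ?(ltW N0) // mulr_ge0 ?(ltW c10) // mulr_ge0 ?ler0n // !exprn_ge0.
  by rewrite expr_div_n -[2 ^+ 2]natrX ler_wpM2r // invr_ge0 ler0n.
have b2 : expect D p (fun F => (N / 2 <= `|edges F - emean|)%R%:R) <= 2 / N.
  have sD (e : {set W}) : mem D e -> [set e] \subset D by rewrite sub1set.
  apply: le_trans (chebyshev_count p01 sD N20) _.
  rewrite ler_pdivrMr ?exprn_gt0 //.
  have sqE (w : R) : w != 0 -> 2 / w * (w / 2) ^+ 2 = w / 2 by move=> w0; field.
  rewrite sqE ?(lt0r_neq0 N0) //.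
  apply: (@le_trans _ _ emean); last exact: emean_le.
  apply: ler_sum => e eD; rewrite (bigD1 e) /=; last by rewrite (eD : e \in D) setIid -card_gt0 cards1.
  rewrite setUid big1 ?addr0 // => f /andP[/andP[_ ef] fe].
  case/negP: ef; rewrite -subset0; apply/subsetP => x; rewrite !inE => /andP[/eqP-> /eqP E].
  by rewrite E eqxx in fe.
have b3 : expect D p (fun F => ((eps * M) ^+ 2 <= V F)%R%:R) <= c1 / eps ^+ 2 / N.
  have V0 F : F \subset D -> 0 <= V F by move=> _; apply: sumr_ge0 => fg _; exact: ler0n.
  apply: le_trans (expect_markov p01 eM0 V0) _.
  rewrite /V expect_count_in //; last exact: overD.
  rewrite ler_pdivrMr //; apply: le_trans (over_mean (ltn0Sn 0)) _.
  rewrite expr0 mul1r.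
  have E (u m w cc : R) : u != 0 -> m != 0 -> cc / u ^+ 2 / m * (u * w) ^+ 2 = cc * w ^+ 2 / m.
    by move=> u0 m0; field; rewrite u0 m0.
  by rewrite E ?(lt0r_neq0 eps0) ?(lt0r_neq0 N0).
have b4 : expect D p (fun F => [forall Z : {set {set W}}, (#|Z| <= 2 * h * z)%N ==>
     (2 * mu <= Y (F :\: Z))%R]%:R) <= 2^-1 ^+ z.
  apply: (deletion_prob p01 (@overD 2) mu0); first exact: (over_mean (ltn0Sn 1)).
  move=> [f g] /and3P[f1 f2 _]; rewrite /S2 /= cardsU !card_img //.
  by rewrite mul2n -addnn leq_subr.
rewrite lerBlDr; apply: (@le_trans _ _ (expect D p (fun F => `[< client_rich F >]%:R +
   ((mean / 2 <= `|X1 F - mean|)%R%:R + (N / 2 <= `|edges F - emean|)%R%:R +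
    ((eps * M) ^+ 2 <= V F)%R%:R + [forall Z : {set {set W}}, (#|Z| <= 2 * h * z)%N ==>
     (2 * mu <= Y (F :\: Z))%R]%:R)))); last first.
  have split3 (x y w i : R) : (x + y + w) * i = x * i + y * i + w * i by rewrite !mulrDl.
  rewrite !expectD lerD2l split3; apply: lerD => //; apply: lerD => //; exact: lerD.
rewrite -[leLHS](expect1 D p); apply: expect_le => // F FD.
have [HX|HX] := leP (mean / 2) `|X1 F - mean|.
  by rewrite -!natrD ler1n !addn_gt0 /= ?orbT.
have [He|He] := leP (N / 2) `|edges F - emean|.
  by rewrite -!natrD ler1n !addn_gt0 /= ?orbT.
have [HV|HV] := leP ((eps * M) ^+ 2) (V F).
  by rewrite -!natrD ler1n !addn_gt0 /= ?orbT.
case: (boolP [forall Z : {set {set W}}, _]) => [_|/forallPn[Z]].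
  by rewrite -!natrD ler1n !addn_gt0 /= ?orbT.
rewrite negb_imply -ltNge => /andP[Zz HY].
have rich : client_rich F by apply: typical_rich => //; exists Z.
by rewrite asboolT // -!natrD ler1n.
Qed.
End Rich.

(** * The threshold *)

(* [t] and [nn] stand for n^(-1/m_2) and n. *)
Section Threshold.
Variables (R : realFieldType) (a b : nat) (t nn : R).
Hypotheses (b0 : (0 < b)%N) (ba : (b < a)%N) (t0 : 0 < t) (nn1 : 1 <= nn).
Hypothesis tE : t ^+ a * nn ^+ b = 1.

Let a0 : (0 < a)%N. Proof. exact: leq_ltn_trans ba. Qed.
Let nn0 : 0 < nn. Proof. exact: lt_le_trans ltr01 nn1. Qed.

Lemma threshold_pow_mul_le1 : t ^+ a * nn <= 1.
Proof.
rewrite -[leRHS]tE; apply: ler_wpM2l; first by rewrite exprn_ge0 // ltW.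
by case: b b0 => // k _; rewrite exprS ler_peMr ?(ltW nn0) // exprn_ege1.
Qed.

Lemma threshold_le1 : t <= 1.
Proof.
rewrite -(expr_le1 a0) ?(ltW t0) //; apply: le_trans threshold_pow_mul_le1.
by rewrite ler_peMr // exprn_ge0 // ltW.
Qed.

Lemma scaled_threshold_le (u w : R) : 0 <= u -> 0 < w -> (u / w) ^+ a <= nn -> u * t <= w.
Proof.
move=> u0 w0 le; rewrite -[leRHS]mul1r -ler_pdivrMr // mulrAC.
rewrite -(expr_le1 a0) ?mulr_ge0 ?invr_ge0 ?(ltW w0) ?(ltW t0) // exprMn mulrC.
apply: le_trans threshold_pow_mul_le1; rewrite ler_wpM2l // exprn_ge0 // ltW //.
Qed.

Lemma threshold_mul_ge1 : 1 <= t * nn.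
Proof.
rewrite -(expr_ge1 a0) ?mulr_ge0 ?(ltW t0) ?(ltW nn0) // exprMn -[leLHS]tE.
by rewrite ler_wpM2l ?exprn_ge0 ?(ltW t0) // ler_weXn2l // ltnW.
Qed.

Lemma threshold_growth i j : (j * b <= a * i)%N -> 1 <= nn ^+ i * t ^+ j.
Proof.
move=> le; rewrite -(expr_ge1 b0) ?mulr_ge0 ?exprn_ge0 ?(ltW t0) ?(ltW nn0) //.
rewrite exprMn -!exprM; apply: (@le_trans _ _ (nn ^+ (i * b) * t ^+ (a * i))).
  by rewrite mulrC exprM [(i * b)%N]mulnC exprM -exprMn tE expr1n.
by rewrite ler_wpM2l ?exprn_ge0 ?(ltW nn0) // ler_wiXn2l ?(ltW t0) ?threshold_le1.
Qed.

(** By integrality [a * v + 1 <= b * u], so the b-th power keeps one spare factor [t], which tends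
    to 0. *)
Lemma threshold_overdense (tau : R) u v : 0 <= tau -> t <= tau ^+ b -> (a * v < b * u)%N ->
  t ^+ u <= tau * nn ^- v.
Proof.
move=> tau0 le uv; rewrite ler_pdivlMr ?exprn_gt0 //.
rewrite -(ler_pXn2r b0) ?nnegrE ?mulr_ge0 ?exprn_ge0 ?(ltW t0) ?(ltW nn0) //.
apply: le_trans le; rewrite exprMn -!exprM.
apply: (@le_trans _ _ (t ^+ (a * v).+1 * nn ^+ (v * b))).
  rewrite ler_wpM2r ?exprn_ge0 ?(ltW nn0) // ler_wiXn2l ?(ltW t0) ?threshold_le1 //.
  by rewrite [(u * b)%N]mulnC.
by rewrite exprS -mulrA exprM [(v * b)%N]mulnC exprM -exprMn tE expr1n mulr1.
Qed.
End Threshold.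

(** Apply the definition of [m2] to the subgraph with edges [D] and no isolated vertex; a single
    edge makes both sides 0. *)
Lemma edges_density (T : finType) (H : graph T) (a b : nat) (D : {set {set T}}) :
  (0 < b)%N -> m2 H = a%:R / b%:R -> D \subset eset H -> D != set0 ->
  exists i j, [/\ #|D| = j.+1, #|cover D| = i.+2 & (j * b <= a * i)%N].
Proof.
move=> b0 mE DH D0.
have pD : pairs_only D.
  by apply/forall_inP => e /(subsetP DH); exact: (forall_inP (pairs_only_eset H)).
have c2 := card_cover_ge2 pD D0.
have d0 : (0 < #|D|)%N by rewrite card_gt0.
exists (#|cover D| - 2)%N, (#|D|.-1); split; [by rewrite prednK| by move: c2; move: #|_|; clear; lia|].
have [c3|c3] := leqP 3 #|cover D|; last first.
  have := pairs_card_bound pD; move: c2 c3 d0; move: #|cover D| #|D| => x y; clear; nia.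
have wf : wf_graph (cover D, D).
  apply/forallP => e; apply/implyP => /= eD.
  by rewrite (forall_inP pD _ eD) /=; exact: bigcup_sup.
have sub : subgraph (Graph wf) H.
  rewrite /subgraph /vset /eset /= DH andbT; apply: subset_trans (cover_eset_sub H).
  by apply/bigcupsP => e eD; apply: bigcup_sup; exact: (subsetP DH).
have := d2_le_m2 sub; rewrite mE /d2 /vset /eset /= c3.
rewrite ler_pdivrMr; last by rewrite subr_gt0 ltr_nat.
rewrite mulrAC ler_pdivlMr ?ltr0n //.
rewrite -(natrB _ (ltnW c3)) -(natrB _ d0) -!natrM ler_nat subn1; exact.
Qed.

(** Monotonicity in p is applied to richness rather than to the outcome of the game. *)
Lemma client_prob_ge (R : realType) (T : finType) (H : graph T) (n q : nat) (p0 p : R) :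
  0 <= p0 <= p -> p <= 1 ->
  expect (all_pairs 'I_n.+1) p0 (fun F => `[< client_rich R H q F >]%:R) <=
  Gnp_prob p (fun G : graph 'I_n.+1 => client_wins_CW G H q).
Proof.
move=> p0p p1; rewrite Gnp_prob_expect.
apply: le_trans (@expect_monotone R _ (all_pairs 'I_n.+1) p0 p (fun F => `[< client_rich R H q F >]) p0p p1 _) _.
  by move=> F F' FF' /asboolP /(client_rich_up FF')/asboolP.
apply: expect_le => [|F FD]; first by rewrite p1 andbT; case/andP: p0p; exact: le_trans.
case: asboolP => [rich|_]; last exact: ler0n.
suff /asboolP-> : client_wins_CW (graph_of_edges F) H q by [].
apply: (@client_rich_wins R) => //.
by rewrite /eset /= (setIidPl FD).
Qed.

Lemma Gnp_prob_le1 (R : realType) n (p : R) (A : graph 'I_n -> Prop) : 0 <= p <= 1 -> Gnp_prob p A <= 1.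
Proof.
move=> p01; rewrite Gnp_prob_expect -[leRHS](expect1 (all_pairs 'I_n) p).
by apply: expect_le => // F _; rewrite lern1 leq_b1.
Qed.

Lemma Gnp_prob_ge0 (R : realType) n (p : R) (A : graph 'I_n -> Prop) : 0 <= p <= 1 -> 0 <= Gnp_prob p A.
Proof. by move=> p01; rewrite Gnp_prob_expect; apply: expect_ge0 => // F _; exact: ler0n. Qed.

Section WaiterProbability.
Variables (R : realType) (T : finType) (H H' : graph T) (a b n q : nat).
Notation W := 'I_n.+1.
Hypotheses (sub : subgraph H' H) (sb : strictly_2_balanced H') (cH : cover (eset H') = vset H').
Hypotheses (ha : #|eset H'| = a.+1) (vb : #|vset H'| = b.+2) (b0 : (0 < b)%N) (ba : (b < a)%N).
Hypothesis mE : m2 H' = a%:R / b%:R.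
Hypotheses (q0 : (0 < q)%N) (tri : triangle H' -> (2 <= q)%N).

Lemma waiter_wins_of_no_dense_atom (F : {set {set W}}) : F \subset all_pairs W ->
  (forall A, is_copy H' A -> A \subset F ->
     ~~ explore_bad (is_copy H') (@overdense a b n) (2 * #|~: A| + #|A|) A A F) ->
  ~ client_wins_CW (graph_of_edges F) H q.
Proof.
move=> FD nobad; apply: waiter_forces_not_client_wins.
have eF : eset (graph_of_edges F) = F by rewrite /eset /= (setIidPl FD).
rewrite eF.
have pF : pairs_only F by apply/forall_inP => e /(subsetP FD); rewrite inE.
apply: waiter_forces_imp (waiter_wins_of_sparse_atoms sb cH ha vb b0 ba mE q0 tri pF _); last first.
  move=> A cA AF; have [B _ _||U aU ndU] := explore_atom (nobad A cA AF) AF (subxx _) (subxx _) _ _ (leqnn _).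
  - by rewrite setDv setI0 eqxx.
  - by [].
  by exists U => //; rewrite leqNgt.
(* A copy of [H] contains a copy of [H'], and Waiter avoids the latter. *)
move=> C' _ _ noC /(contains_copy_sub sub).
case/(contains_copyP H' (G := edge_restrict (graph_of_edges F) C') erefl) => B cB.
rewrite /eset /= -/(eset _) eF subsetI => /andP[BF BC].
by move: (noC B cB BF); rewrite BC.
Qed.

Lemma waiter_prob_le (p c lam tau : R) :
  0 <= p <= 1 -> 0 < c -> 2 * c <= 1 -> 1 <= lam -> 0 <= tau ->
  (2 * c) ^+ a * 2 ^+ (b * (2 * a + 1)) * (#|T| ^ 2)%:R <= 4^-1 ->
  2 ^+ (b.+2 * (2 * a + 1)) * (2 * b.+2 ^ b.+2)%:R <= lam / 4 ->
  (forall U : {set {set W}}, U \subset all_pairs W -> @overdense a b n U ->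
     p ^+ #|U| <= tau * (c ^+ #|U| * n.+1%:R^-1 ^+ #|cover U|)) ->
  Gnp_prob p (fun G : graph W => client_wins_CW G H q) <= tau * (lam * 2 ^+ b.+2) ^+ (2 * a + 1).
Proof.
move=> p01 c0 c2 lam1 tau0 Hc Hlam Hbad; rewrite Gnp_prob_expect.
apply: le_trans (dense_atom_prob sb cH ha vb b0 ba mE p01 c0 c2 lam1 tau0 Hc Hlam Hbad).
apply: expect_le => // F FD; case: asboolP => [win|_]; last exact: ler0n.
rewrite ler1n lt0b; apply: contraT => nb; case: (waiter_wins_of_no_dense_atom FD _ win) => A cA AF.
apply: contra nb => ex; apply/existsP; exists A; by rewrite cA AF ex.
Qed.
End WaiterProbability.

From mathcomp Require Import all_classical all_reals all_analysis.
Import numFieldNormedType.Exports.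
Local Open Scope classical_set_scope.
Local Open Scope ring_scope.

(** * The two limits *)

Lemma threshold_pow (R : realType) (m : rat) (a b n : nat) :
  (0 < a)%N -> m = a%:R / b%:R ->
  (n.+1%:R `^ (- (ratr m)^-1) : R) ^+ a * n.+1%:R ^+ b = 1.
Proof.
move=> a0 mE; have n0 : 0 <= n.+1%:R :> R by rewrite ler0n.
have an0 : (a%:R : R) != 0 by rewrite pnatr_eq0 -lt0n.
have E : ratr m = a%:R / b%:R :> R by rewrite mE fmorph_div /= !rmorph_nat.
rewrite -[_ ^+ a]powR_mulrn ?powR_ge0 // -powRrM E invf_div.
by rewrite mulNr divfK // powRN powR_mulrn // mulVf // expf_neq0 // pnatr_eq0.
Qed.

Lemma half_expn_small (R : realType) (eps : R) : 0 < eps -> exists z : nat, 2^-1 ^+ z <= eps.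
Proof.
move=> e0; exists (Num.truncn eps^-1); rewrite exprVn -[leRHS]invrK lef_pV2 ?posrE ?exprn_gt0 ?invr_gt0 //.
apply/ltW; apply: lt_le_trans (truncnS_gt _) _.
by rewrite -natrX ler_nat; exact: ltn_expl.
Qed.

Lemma client_threshold (R : realType) (T : finType) (H : graph T) (q : nat) :
  1 < m2 H -> (0 < q)%N ->
  exists2 C : R, 0 < C & forall p : nat -> R, (forall n, 0 <= p n <= 1) ->
    (\forall n \near \oo, C * n%:R `^ (- (ratr (m2 H))^-1) <= p n) ->
    (fun n => Gnp_prob (p n) (fun G : graph 'I_n => client_wins_CW G H q)) @ \oo --> (1 : R).
Proof.
move=> m1 q0.
have [a [b [a0 b0 ba mE]]] : exists a b, [/\ 0 < a, 0 < b, b < a & m2 H = a%:R / b%:R :> rat]%N.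
  have [G [sG dG _]] := strictly_2_balanced_subgraph (lt_trans ltr01 m1).
  have dG' : d2 G = m2 G.
    by apply: le_anti; rewrite d2_le_m2 ?subgraph_refl //= dG m2_sub.
  have [|a [b [_ _ b0 ba mE]]] := m2_ratio _ dG'; first by rewrite dG.
  exists a, b; split=> //; first exact: leq_ltn_trans ba.
  by rewrite -dG dG'.
pose alpha : R := 2^-1 ^+ #|T| / 4.
have alpha0 : 0 < alpha by rewrite divr_gt0 ?exprn_gt0 ?invr_gt0 ?ltr0n.
pose c1 : R := overlap_constant R H.
have c10 : 0 <= c1 by exact: ler0n.
pose K0 : R := 8 * (q.+1%:R ^+ #|eset H|) ^+ 2 * q%:R * (#|eset H| ^ 2)%:R * c1.
have K00 : 0 <= K0 by rewrite !mulr_ge0 ?ler0n ?exprn_ge0.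
(* Makes [C * alpha ^+ 2] equal to [alpha ^+ 2 + K0], just above what the choice of [t] requires. *)
pose C : R := 1 + K0 / alpha ^+ 2.
have C1 : 1 <= C by rewrite lerDl divr_ge0 ?exprn_ge0 // ltW.
have C0 : 0 < C by exact: lt_le_trans C1.
exists C => // p p01 Hp; apply/cvgrPdist_le => eps eps0.
(* Deletion may fail with probability half of [eps]; the other half is for the failures of order 1 /
   [N]. *)
have [z zE] := half_expn_small (divr_gt0 eps0 (ltr0Sn R 1)).
pose B : R := 4 * 2 ^+ #|T| ^+ 2 * c1 + 2 + c1 / (alpha / (2 * #|eset H| * z).+1%:R) ^+ 2.
have B0 : 0 <= B.
  rewrite addr_ge0 ?divr_ge0 ?exprn_ge0 ?divr_ge0 ?ler0n ?(ltW alpha0) //.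
  by rewrite addr_ge0 ?ler0n // !mulr_ge0 ?ler0n ?exprn_ge0.
have main n : (0 < n)%N -> (2 * #|T| <= n)%N -> B / (eps / 2) <= n%:R ->
    C * n%:R `^ (- (ratr (m2 H))^-1) <= p n ->
    `|1 - Gnp_prob (p n) (fun G : graph 'I_n => client_wins_CW G H q)| <= eps.
  case: n => // n _ Tn Bn; have := threshold_pow R n a0 mE.
  have : 0 < n.+1%:R `^ (- (ratr (m2 H))^-1) :> R by rewrite powR_gt0 ?ltr0n.
  move: (_ `^ _) => t t0 tE pn.
  have nn1 : 1 <= n.+1%:R :> R by rewrite ler1n.
  have p0p : 0 <= C * t <= p n.+1 by rewrite pn mulr_ge0 ?(ltW C0) ?(ltW t0).
  have /andP[_ p1] := p01 n.+1.
  have Ct0 : 0 < C * t by rewrite mulr_gt0.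
  have th1 : 1 <= t * n.+1%:R := threshold_mul_ge1 ba t0 nn1 tE.
  (* As the density exceeds 1, t n is at least 1, so the expected number of edges is at least of
     order n. *)
  have NN : n.+1%:R <= n.+1%:R ^+ 2 * (C * t).
    rewrite expr2 -mulrA ler_peMr ?ler0n //; apply: le_trans th1 _.
    by rewrite mulrC ler_wpM2l ?ler0n // ler_peMl // ltW.
  have rich : 1 - (B / (n.+1%:R ^+ 2 * (C * t)) + 2^-1 ^+ z) <=
      expect (all_pairs 'I_n.+1) (C * t) (fun F => `[< client_rich R H q F >]%:R).
    apply: (@rich_prob R T H n q _ C) => // [|D DH D0|]; first exact: le_trans p1.
      have [i [j [-> -> le]]] := edges_density b0 mE DH D0.
      have g := threshold_growth b0 ba t0 nn1 tE le.
      rewrite [_.-1]/= exprMn [C ^+ j.+1]exprS [t ^+ j.+1]exprS.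
      rewrite -[i.+2]addn2 exprD.
      have -> : C ^+ j * (n.+1%:R ^+ 2 * (C * t)) = C ^+ j * (n.+1%:R ^+ 2 * (C * t)) * 1 by rewrite mulr1.
      have -> : n.+1%:R ^+ i * n.+1%:R ^+ 2 * (C * C ^+ j * (t * t ^+ j)) =
        C ^+ j * (n.+1%:R ^+ 2 * (C * t)) * (n.+1%:R ^+ i * t ^+ j).
        move: (C ^+ j) (_ ^+ i) (_ ^+ 2) (t ^+ j) => x y w r; clear; ring.
      by rewrite ler_wpM2l // !mulr_ge0 ?exprn_ge0 ?(ltW C0) ?(ltW t0).
    rewrite -/alpha -/c1 -/K0 /C mulrDl mul1r divfK ?ltrDr ?exprn_gt0 //.
    by rewrite expf_neq0 // lt0r_neq0.
  have := le_trans rich (client_prob_ge H n q p0p p1).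
  move: (Gnp_prob_le1 (fun G : graph 'I_n.+1 => client_wins_CW G H q) (p01 n.+1)).
  move: (Gnp_prob _ _) => P P1 PB.
  rewrite ger0_norm ?subr_ge0 //.
  have Beps : B / (n.+1%:R ^+ 2 * (C * t)) <= eps / 2.
    rewrite ler_pdivrMr ?mulr_gt0 ?exprn_gt0 ?ltr0n // mulrC -ler_pdivrMr ?divr_gt0 ?ltr0n //.
    exact: le_trans NN.
  rewrite lerBlDr -lerBlDl; apply: le_trans PB; rewrite lerD2l lerN2 [leRHS]splitr.
  exact: lerD.
near=> n; apply: main.
- by near: n; exists 1%N.
- by near: n; exists (2 * #|T|)%N.
- by near: n; exact: nbhs_infty_ger.
- by near: n.
Unshelve. all: by end_near.
Qed.

Lemma waiter_threshold (R : realType) (T : finType) (H H' : graph T) (q : nat) :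
  subgraph H' H -> d2 H' = m2 H -> strictly_2_balanced H' -> 1 < m2 H -> (0 < q)%N ->
  (triangle H' -> (2 <= q)%N) ->
  exists2 c : R, 0 < c & forall p : nat -> R, (forall n, 0 <= p n <= 1) ->
    (\forall n \near \oo, p n <= c * n%:R `^ (- (ratr (m2 H))^-1)) ->
    (fun n => Gnp_prob (p n) (fun G : graph 'I_n => client_wins_CW G H q)) @ \oo --> (0 : R).
Proof.
move=> sub dH sb m1 q0 tri.
have mH : m2 H = m2 H'.
  by apply: le_anti; rewrite -dH d2_le_m2 ?subgraph_refl //= dH m2_sub.
have dH' : d2 H' = m2 H' by rewrite dH.
have m1' : 1 < m2 H' by rewrite -mH.
have cH := cover_strictly_2_balanced m1' dH' sb.
have [|a [b [ha vb b0 ba mE]]] := m2_ratio _ dH'; first by rewrite dH'.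
have a0 : (0 < a)%N by exact: leq_ltn_trans ba.
have T0 : (0 < #|T| ^ 2)%N by rewrite expn_gt0 (leq_trans _ (max_card (vset H'))) // vb.
pose A : R := 2 ^+ (b * (2 * a + 1)) * (#|T| ^ 2)%:R.
have A1 : 1 <= A by rewrite mulr_ege1 ?ler1n // exprn_ege1 // ler1n.
have A0 : 0 < A by exact: lt_le_trans A1.
(* Gives [2 * c * A = 4^-1]; since [2 * c <= 1], the power [a] only lowers the product. *)
pose c : R := (8 * A)^-1.
have c0 : 0 < c by rewrite invr_gt0 mulr_gt0 ?ltr0n.
have c2A : 2 * c * A = 4^-1 by rewrite /c; field; rewrite lt0r_neq0.
have c2 : 2 * c <= 1.
  rewrite (@le_trans _ _ (2 * c * A)) //; first by rewrite ler_peMr // mulr_ge0 ?ler0n // ltW.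
  by rewrite c2A invf_le1 ?ltr0n // ler1n.
have Hc : (2 * c) ^+ a * 2 ^+ (b * (2 * a + 1)) * (#|T| ^ 2)%:R <= 4^-1.
  rewrite -mulrA -/A -c2A ler_wpM2r ?(ltW A0) // -[leRHS]expr1 ler_wiXn2l //.
  by rewrite mulr_ge0 ?ler0n // ltW.
pose L : R := 2 ^+ (b.+2 * (2 * a + 1)) * (2 * b.+2 ^ b.+2)%:R.
have L1 : 1 <= L by rewrite mulr_ege1 ?exprn_ege1 ?ler1n // muln_gt0 expn_gt0.
pose lam : R := L * 4.
have lam1 : 1 <= lam by rewrite mulr_ege1 ?ler1n.
have Hlam : L <= lam / 4 by rewrite mulfK // pnatr_eq0.
pose K : R := (lam * 2 ^+ b.+2) ^+ (2 * a + 1).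
have K0 : 0 < K by rewrite exprn_gt0 // mulr_gt0 ?exprn_gt0 ?ltr0n // (lt_le_trans ltr01).
exists c => // p p01 Hp; apply/cvgrPdist_le => eps eps0.
(* Turns the final bound [tau * K] into [eps]; [tau] is fixed while t tends to 0. *)
pose tau : R := eps / K.
have tau0 : 0 < tau by rewrite divr_gt0.
have main n : (0 < n)%N -> (1 / tau ^+ b) ^+ a <= n%:R ->
    p n <= c * n%:R `^ (- (ratr (m2 H))^-1) ->
    `|0 - Gnp_prob (p n) (fun G : graph 'I_n => client_wins_CW G H q)| <= eps.
  rewrite mH; case: n => // n _ nt; have := threshold_pow R n a0 mE.
  have : 0 < n.+1%:R `^ (- (ratr (m2 H'))^-1) :> R by rewrite powR_gt0 ?ltr0n.
  move: (_ `^ _) => t t0 tE pn.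
  have nn1 : 1 <= n.+1%:R :> R by rewrite ler1n.
  have ttau : t <= tau ^+ b.
    by rewrite -[t]mul1r (scaled_threshold_le b0 ba t0 nn1 tE) ?ler01 ?exprn_gt0.
  have /andP[p0 _] := p01 n.+1.
  rewrite sub0r normrN ger0_norm ?Gnp_prob_ge0 //.
  apply: le_trans (waiter_prob_le sub sb cH ha vb b0 ba mE q0 tri (p01 n.+1) c0 c2 lam1 (ltW tau0) Hc Hlam _) _; last first.
    by rewrite -/K divfK ?lt0r_neq0.
  move=> U UD dU; apply: le_trans (_ : (c * t) ^+ #|U| <= _).
    by rewrite lerXn2r ?nnegrE // mulr_ge0 ?(ltW c0) ?(ltW t0).
  rewrite exprMn mulrCA ler_wpM2l ?exprn_ge0 ?(ltW c0) // exprVn.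
  exact: (threshold_overdense b0 ba t0 nn1 tE (ltW tau0) ttau dU).
near=> n; apply: main.
- by near: n; exists 1%N.
- by near: n; exact: nbhs_infty_ger.
- by near: n.
Unshelve. all: by end_near.
Qed.

Theorem theorem1p7 (R : realType) (T : finType) (H : graph T) (q : nat)
    (Hcyc : ~ forest H) (q_gt0 : (0 < q)%N)
    (Hq : (2 <= q)%N \/
          exists H' : graph T,
            [/\ subgraph H' H, d2 H' = m2 H, strictly_2_balanced H' &
                ~ triangle H']) :
  exists c C : R,
    [/\ 0 < c, 0 < C &
     forall p : nat -> R, (forall n, 0 <= p n <= 1) ->
       ((\forall n \near \oo, C * n%:R `^ (- (ratr (m2 H))^-1) <= p n) ->
          (fun n => Gnp_prob (p n) (fun G : graph 'I_n => client_wins_CW G H q))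
            @ \oo --> (1 : R)) /\
       ((\forall n \near \oo, p n <= c * n%:R `^ (- (ratr (m2 H))^-1)) ->
          (fun n => Gnp_prob (p n) (fun G : graph 'I_n => client_wins_CW G H q))
            @ \oo --> (0 : R))].
Proof.
have m1 := m2_gt1 Hcyc.
have [H' [sub dH sb tri]] : exists H' : graph T,
    [/\ subgraph H' H, d2 H' = m2 H, strictly_2_balanced H' & triangle H' -> (2 <= q)%N].
  case: Hq => [q2|[H' [sub dH sb ntri]]]; last by exists H'.
  have [H' [sub dH sb]] := strictly_2_balanced_subgraph (lt_trans ltr01 m1).
  by exists H'.
have [C C0 HC] := client_threshold R m1 q_gt0.
have [c c0 Hc] := waiter_threshold R sub dH sb m1 q_gt0 tri.
by exists c, C; split=> // p p01; split; [exact: HC|exact: Hc].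
Qed.
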